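(* Let $b$ be a Bloch function and let $(z_n)_{n\in\mathbb{N}}$ be a sequence in $\mathbb{D}$ satisfying the Carleson condition $\sup_{z\in\mathbb{D}}\sum_{n}(1-\rho^2(z,z_n))<\infty$. Then: (i) there exists $\lambda>0$ such that $$\sup_{z\in\mathbb{D}}\sup_{r\in(0,1)}\sum_{n:\,\rho(z,z_n)<r}\exp\!\left(\frac{\lambda|b(z_n)-b(z)|^2}{-\log(1-r^2)}\right)(1-\rho^2(z,z_n))<\infty;$$ (ii) there exist $\lambda>0$ and $C>0$ such that for every $z\in\mathbb{D}$ and every $t>0$, $$\#\left\{n\in\mathbb{N}:\ \exp\!\left(\frac{\lambda|b(z_n)-b(z)|^2}{-\log(1-\rho^2(z,z_n))}\right)(1-\rho^2(z,z_n))>t\right\}\le\frac{C}{t},$$ with the convention that the exponential factor equals $1$ when $z_n=z$.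
   Context: $\mathbb{D}$ is the open unit disc. The Bloch space $\mathcal{B}$ is the space of holomorphic $b$ on $\mathbb{D}$ with $\|b\|_{\mathcal{B}}=|b(0)|+\sup_{z\in\mathbb{D}}|b'(z)|(1-|z|^2)<\infty$. The pseudo-hyperbolic distance is $\rho(z,w)=\left|\frac{w-z}{1-\bar w z}\right|$. *)

(* Defs.v *)
(* Stdlib reals + Coquelicot complex numbers C.
   is_derive on functions C -> C is the complex (C-linear) derivative. *)
From Stdlib Require Import Reals.
From Coquelicot Require Import Coquelicot.
Open Scope R_scope.

Definition in_disc (z : C) : Prop := Cmod z < 1.

Definition holo_disc (f : C -> C) : Prop :=
  forall z, in_disc z -> ex_derive f z.

Definition bloch (f : C -> C) : Prop :=
  holo_disc f /\
  exists M : R, forall z, in_disc z ->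
    forall d : C, is_derive f z d -> Cmod d * (1 - Cmod z ^ 2) <= M.

Definition rho (z w : C) : R :=
  Cmod ((w - z) / (1 - Cconj w * z))%C.

(* Carleson condition: sup_{z in D} sum_n (1 - rho^2(z,z_n)) < oo
   (nonnegative terms: the sup of all partial sums is finite) *)
Definition carleson (zs : nat -> C) : Prop :=
  exists M : R, forall z, in_disc z -> forall N : nat,
    sum_f_R0 (fun n => 1 - rho z (zs n) ^ 2) N <= M.

Definition weight_ii (lam : R) (b : C -> C) (z w : C) : R :=
  (if Req_EM_T (Cmod (w - z)%C) 0 then 1
   else exp (lam * Cmod (b w - b z)%C ^ 2 / (- ln (1 - rho z w ^ 2))))
  * (1 - rho z w ^ 2).

(* Main.v *)
Require Import Defs.
From Stdlib Require Import Reals Lra Lia ClassicalEpsilon.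
From Coquelicot Require Import Coquelicot.
Open Scope R_scope.

(** Write [s(z,w) = 1 - rho(z,w)^2] and [q = |b - b(a)|^2], where [a] is the point called [z] in the
    theorem, let [K] and [M] be the Bloch and Carleson constants and [L = - ln (1 - r^2)].
    Part (i) comes from the maximum principle on [{s(.,a) >= (1 - r^2)^3}], applied to
      [barrier = sum_n F(z_n) (s_n/2 + s_n^2/4) + e^(M+1) (exp (lam q/L - sum_n s_n) - exp u)],
    where [s_n = s(.,z_n)], the first sum runs over [rho(a,z_n) < r] and [F = exp (lam q/L)].
    Since [s_n] has Laplacian [-4 s_n^2/(1-|z|^2)^2], the second term is so subharmonic that it
    compensates the superharmonicity of the first one, because [F(z_n) s_n(z) <= e F(z)] (this is where
    [|b(z)-b(w)| <= K (1 - ln s(z,w))] enters). The exponent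
      [u = lam q/L + (lam q/L^2 + gam) (3 L + ln s(.,a))],   [gam = 40 lam K^2/L],
    makes [exp u] superharmonic for small [lam K^2], agrees with [lam q/L] on the boundary and stays
    below [1] at [a]: it plays the role of the sub-Gaussian bound for Bloch martingales.
    On the boundary the first sum is at most [3 M], so [barrier(a) <= 3 M] bounds the sum in (i).
    Part (ii) follows by splitting according to the dyadic size of [s(z,z_n)] and applying Chebyshev's
    inequality to the square of the exponential.

    The maximum principle needs second order Taylor expansions of [b], whereas only complex
    differentiability is given: they come from Goursat's bisection argument, applied to a closed
    form on the homotopy between a circle around [0] and a small circle around [h]. *)

(** * Bisection of squares *)

(** Pointwise growth only bounds [q] by a multiple of [K^2 L^2], hence [exp (lam q/L)] by a negative
    power of [1 - r^2], so in (i) this factor has to be cancelled rather than bounded. In the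
    [barrier] the difference of the two exponentials is at most 0 on the boundary and costs only a
    constant at [a]. The exponent [u] is modelled on a Gaussian: for a Brownian motion at [x] with
    time [T] left, the expectation of [exp (mu B^2)] at the end is [exp (mu x^2/(1 - 2 mu T))] over
    [sqrt (1 - 2 mu T)]. The first order expansion in [T] of its logarithm, with [T] a multiple of
    [3 L + ln s(.,a)] and with larger coefficients, is [u]. The cube comes from the boundary: there
    [s(.,z_n) <= 4 (1 - r^2) s(a,z_n)] for the points counted, and the factor [1 - r^2] pays for the
    crude bound [F(z_n) <= 1/(1 - r^2)]. Only finite sums occur, with constants independent of their
    length, so second order expansions at single points suffice. In (ii) Chebyshev with the first
    power would give a bound of order [1/t] for each of infinitely many layers; the square makes the
    bounds summable. *)

Section Cousin.
Variable Pr : R -> R -> R -> Prop.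
Hypothesis split : forall a c l, 0 < l -> Pr a c (l/2) -> Pr (a+l/2) c (l/2) ->
  Pr a (c+l/2) (l/2) -> Pr (a+l/2) (c+l/2) (l/2) -> Pr a c l.

(** The fourth quarter is returned untested: once the other three are good, [split] makes it bad
    whenever the whole square is. *)
Definition bad_quarter (l : R) (q : R * R) : R * R :=
  let (a, c) := q in
  if excluded_middle_informative (Pr a c (l/2)) then
  if excluded_middle_informative (Pr (a+l/2) c (l/2)) then
  if excluded_middle_informative (Pr a (c+l/2) (l/2)) then (a+l/2, c+l/2)
  else (a, c+l/2) else (a+l/2, c) else (a, c).

Fixpoint bad_square (l : R) (q : R * R) (n : nat) : R * R :=
  match n with
  | O => q
  | S m => bad_quarter (l / 2 ^ m) (bad_square l q m)
  end.

Lemma bad_quarter_spec l q : 0 < l -> ~ Pr (fst q) (snd q) l ->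
  let q' := bad_quarter l q in
  ~ Pr (fst q') (snd q') (l/2) /\
  (fst q <= fst q' <= fst q + l/2) /\ (snd q <= snd q' <= snd q + l/2).
Proof.
destruct q as [a c]; simpl; intros Hl Hn.
destruct (excluded_middle_informative (Pr a c (l/2))) as [H1|H1].
2: simpl; repeat split; auto; lra.
destruct (excluded_middle_informative (Pr (a+l/2) c (l/2))) as [H2|H2].
2: simpl; repeat split; auto; lra.
destruct (excluded_middle_informative (Pr a (c+l/2) (l/2))) as [H3|H3].
2: simpl; repeat split; auto; lra.
simpl; repeat split; try lra.
intros H4; apply Hn; now apply split.
Qed.

Lemma nested_point (u : nat -> R) (l : R) : 0 < l ->
  (forall n, u n <= u (S n) <= u n + l / 2 ^ S n) ->
  exists x, forall n, u n <= x <= u n + l / 2 ^ n.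
Proof.
intros Hl Hu.
assert (Hp : forall n, 0 < 2 ^ n) by (intros; apply pow_lt; lra).
assert (Hup : forall n k, u n <= u (n + k)%nat).
{ intros n; induction k as [|k IH].
  - rewrite Nat.add_0_r; lra.
  - rewrite Nat.add_succ_r. specialize (Hu (n+k)%nat). lra. }
assert (Hdn : forall n k, u (n + k)%nat + l / 2 ^ (n + k) <= u n + l / 2 ^ n).
{ intros n; induction k as [|k IH].
  - rewrite Nat.add_0_r; lra.
  - rewrite Nat.add_succ_r. specialize (Hu (n+k)%nat).
    assert (l / 2 ^ (n+k) = 2 * (l / 2 ^ S (n+k))).
    { simpl. field. apply Rgt_not_eq, Hp. }
    lra. }
assert (Hb : forall n m, u m <= u n + l / 2 ^ n).
{ intros n m. destruct (Nat.le_gt_cases m n) as [H|H].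
  - replace n with (m + (n - m))%nat by lia.
    specialize (Hup m (n-m)%nat).
    assert (0 < l / 2 ^ (m + (n-m))) by (apply Rdiv_lt_0_compat; auto). lra.
  - replace m with (n + (m - n))%nat by lia.
    specialize (Hdn n (m-n)%nat).
    assert (0 < l / 2 ^ (n + (m-n))) by (apply Rdiv_lt_0_compat; auto). lra. }
destruct (completeness (fun x => exists n, x = u n)) as [x [Hx1 Hx2]].
- exists (u 0%nat + l / 2 ^ 0). intros y [n ->]. apply Hb.
- exists (u 0%nat), 0%nat; auto.
- exists x. intros n; split.
  + apply Hx1; now exists n.
  + apply Hx2. intros y [m ->]. apply Hb.
Qed.

(** A bad square has a bad quarter, so bisection yields nested bad squares shrinking to a point,
    where the local hypothesis is violated. The same argument serves Goursat's theorem and the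
    compactness of closed bounded sets. *)
Lemma cousin_square a c l : 0 < l ->
  (forall x y, a <= x <= a + l -> c <= y <= c + l ->
   exists d, 0 < d /\ forall a' c' l', 0 < l' < d ->
     a <= a' <= x -> x <= a' + l' <= a + l ->
     c <= c' <= y -> y <= c' + l' <= c + l -> Pr a' c' l') ->
  Pr a c l.
Proof.
intros Hl Hloc.
destruct (classic (Pr a c l)) as [H|Hn]; auto. exfalso.
set (q := bad_square l (a,c)).
assert (Hp : forall n, 0 < 2 ^ n) by (intros; apply pow_lt; lra).
assert (Hlp : forall n, 0 < l / 2 ^ n) by (intros; apply Rdiv_lt_0_compat; auto).
assert (Hhalf : forall n, l / 2 ^ S n = l / 2 ^ n / 2).
{ intros n; simpl; field; apply Rgt_not_eq, Hp. }
assert (Hbad : forall n, ~ Pr (fst (q n)) (snd (q n)) (l / 2 ^ n)).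
{ induction n as [|n IH].
  - simpl. now replace (l/1) with l by field.
  - rewrite Hhalf. apply (bad_quarter_spec (l / 2^n) (q n)); auto. }
destruct (nested_point (fun n => fst (q n)) l) as [x Hx]; auto.
{ intros n. rewrite Hhalf. apply (bad_quarter_spec (l / 2^n) (q n)); auto. }
destruct (nested_point (fun n => snd (q n)) l) as [y Hy]; auto.
{ intros n. rewrite Hhalf. apply (bad_quarter_spec (l / 2^n) (q n)); auto. }
assert (Hin : forall n, a <= fst (q n) /\ fst (q n) + l / 2 ^ n <= a + l /\
  c <= snd (q n) /\ snd (q n) + l / 2 ^ n <= c + l).
{ induction n as [|n IH].
  - simpl. lra.
  - rewrite Hhalf.
    destruct (bad_quarter_spec (l / 2^n) (q n)) as [_ [H1 H2]]; auto.
    change (bad_quarter (l / 2 ^ n) (q n)) with (q (S n)) in H1, H2.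
    specialize (Hlp n). lra. }
destruct (Hloc x y) as [d [Hd HP]].
{ specialize (Hx 0%nat). simpl in Hx. lra. }
{ specialize (Hy 0%nat). simpl in Hy. lra. }
destruct (pow_lt_1_zero (1/2)) with (y := d / l) as [n Hnn].
{ rewrite Rabs_pos_eq; lra. }
{ apply Rdiv_lt_0_compat; auto. }
specialize (Hnn n (Nat.le_refl n)).
apply (Hbad n). specialize (Hin n). specialize (Hx n). specialize (Hy n).
simpl in Hx, Hy.
apply HP; try lra.
split; auto.
replace (l / 2^n) with (l * (1/2)^n).
2:{ unfold Rdiv at 1. rewrite Rmult_1_l, pow_inv; auto; try lra. }
rewrite Rabs_pos_eq in Hnn. 2: apply pow_le; lra.
apply Rmult_lt_reg_r with (/ l). now apply Rinv_0_lt_compat.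
replace (l * (1/2)^n * / l) with ((1/2)^n) by (field; lra). exact Hnn.
Qed.
End Cousin.

(** * Goursat's theorem for closed real one-forms *)

(** A pointwise notion, with the l1 norm on increments: for a holomorphic function continuity of the
    derivative is not yet available. *)
Definition rdiff (f : R -> R -> R) (x y lx ly : R) : Prop :=
  forall eps, 0 < eps -> exists d, 0 < d /\ forall u v,
    Rabs (u - x) < d -> Rabs (v - y) < d ->
    Rabs (f u v - f x y - (lx * (u - x) + ly * (v - y)))
      <= eps * (Rabs (u - x) + Rabs (v - y)).

Lemma continuous_eps_delta (g : R -> R) (x : R) :
  (forall eps, 0 < eps -> exists d, 0 < d /\ forall u, Rabs (u - x) < d ->
     Rabs (g u - g x) < eps) -> continuous g x.
Proof.
intros H. apply filterlim_locally. intros [e He].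
destruct (H e He) as [d [Hd Hc]]. exists (mkposreal d Hd). exact Hc.
Qed.

Lemma rdiff_swap f x y lx ly :
  rdiff f x y lx ly -> rdiff (fun u v => f v u) y x ly lx.
Proof.
intros H eps He. destruct (H eps He) as [d [Hd Hc]].
exists d; split; auto. intros u v Hu Hv. specialize (Hc v u Hv Hu).
rewrite (Rplus_comm (ly * _)), (Rplus_comm (Rabs (u-y))). exact Hc.
Qed.

Lemma rdiff_continuous1 f x y lx ly :
  rdiff f x y lx ly -> continuous (fun u => f u y) x.
Proof.
intros H. apply continuous_eps_delta. intros eps He.
destruct (H 1 Rlt_0_1) as [d [Hd Hc]].
assert (H0 := Rabs_pos lx).
assert (Hq : 0 < eps / (Rabs lx + 2)) by (apply Rdiv_lt_0_compat; lra).
exists (Rmin d (eps / (Rabs lx + 2))). split. now apply Rmin_pos.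
intros u Hu.
assert (Hu1 := Rlt_le_trans _ _ _ Hu (Rmin_l _ _)).
assert (Hu2 := Rlt_le_trans _ _ _ Hu (Rmin_r _ _)).
specialize (Hc u y Hu1). rewrite Rminus_diag, Rabs_R0 in Hc.
specialize (Hc Hd).
replace (f u y - f x y) with
  ((f u y - f x y - (lx * (u - x) + ly * 0)) + lx * (u - x)) by ring.
eapply Rle_lt_trans. apply Rabs_triang. rewrite Rabs_mult.
assert (H1 := Rabs_pos (u - x)).
apply Rle_lt_trans with ((Rabs lx + 1) * Rabs (u - x)). lra.
apply Rle_lt_trans with ((Rabs lx + 1) * (eps / (Rabs lx + 2))).
apply Rmult_le_compat_l; lra.
replace eps with ((Rabs lx + 2) * (eps / (Rabs lx + 2))) at 2 by (field; lra).
apply Rmult_lt_compat_r; lra.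
Qed.

Definition circulation (P Q : R -> R -> R) (a c l : R) : R :=
  (RInt (fun x => P x c) a (a+l) - RInt (fun x => P x (c+l)) a (a+l))
  + (RInt (fun y => Q (a+l) y) c (c+l) - RInt (fun y => Q a y) c (c+l)).

Section Goursat.
Variables P Q : R -> R -> R.
Hypothesis closed_form : forall x y, 0 <= x <= 1 -> 0 <= y <= 1 ->
  exists px k qy, rdiff P x y px k /\ rdiff Q x y k qy.

Lemma ex_RInt_P c a b : 0 <= c <= 1 -> 0 <= a <= b -> b <= 1 ->
  ex_RInt (fun x => P x c) a b.
Proof.
intros Hc Ha Hb. apply (@ex_RInt_continuous R_CompleteNormedModule).
intros x Hx. rewrite Rmin_left, Rmax_right in Hx by lra.
destruct (closed_form x c) as [px [k [qy [H _]]]]; try lra.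
exact (rdiff_continuous1 _ _ _ _ _ H).
Qed.

Lemma ex_RInt_Q c a b : 0 <= c <= 1 -> 0 <= a <= b -> b <= 1 ->
  ex_RInt (fun y => Q c y) a b.
Proof.
intros Hc Ha Hb. apply (@ex_RInt_continuous R_CompleteNormedModule).
intros x Hx. rewrite Rmin_left, Rmax_right in Hx by lra.
destruct (closed_form c x) as [px [k [qy [_ H]]]]; try lra.
exact (rdiff_continuous1 _ _ _ _ _ (rdiff_swap _ _ _ _ _ H)).
Qed.

(** Here [k] is the derivative across the strip between two opposite sides. It will be the same for
    [P] and for [Q], so the terms [k * l * l] of the two pairs of sides cancel in [circulation]. *)
Lemma increment_estimate (f g : R -> R) a l k e : 0 <= l ->
  ex_RInt f a (a+l) -> ex_RInt g a (a+l) ->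
  (forall t, a <= t <= a + l -> Rabs (g t - f t - k * l) <= e) ->
  Rabs (RInt g a (a+l) - RInt f a (a+l) - k * l * l) <= l * e.
Proof.
intros Hl Hf Hg H.
replace (RInt g a (a+l) - RInt f a (a+l) - k * l * l) with
  (RInt (fun t => g t - f t - k * l) a (a+l)).
- replace (l * e) with ((a + l - a) * e) by ring.
  apply abs_RInt_le_const; auto. lra.
  apply (@ex_RInt_minus R_NormedModule (fun t => g t - f t) (fun _ => k * l)).
  now apply (@ex_RInt_minus R_NormedModule g f).
  apply ex_RInt_const.
- rewrite (@RInt_minus R_CompleteNormedModule (fun t => g t - f t) (fun _ => k*l)).
  rewrite (@RInt_minus R_CompleteNormedModule g f); auto.
  rewrite RInt_const. unfold minus, plus, opp, scal; simpl. unfold mult; simpl. ring.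
  now apply (@ex_RInt_minus R_NormedModule g f).
  apply ex_RInt_const.
Qed.

(** The bound [eps * l * l] adds up exactly over four quarters, as the circulation does. On a small
    square the affine parts of [P] and [Q] contribute nothing, and remainders of size at most a
    multiple of [eps * l] are integrated over sides of length [l]. *)
Lemma circulation_small eps : 0 < eps ->
  Rabs (circulation P Q 0 0 1) <= eps.
Proof.
intros He.
assert (Rabs (circulation P Q 0 0 1) <= eps * 1 * 1); [|lra].
revert He.
cut (0 < 1 -> forall He : 0 < eps, 0 <= 0 -> 0 + 1 <= 1 -> 0 <= 0 -> 0 + 1 <= 1 ->
  Rabs (circulation P Q 0 0 1) <= eps * 1 * 1).
{ intros H He; apply H; lra. }
intros H01 He.
(* Inclusion in the unit square is made part of the predicate, since integrability is known only
   there. *)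
apply (cousin_square (fun a c l => 0 <= a -> a + l <= 1 -> 0 <= c -> c + l <= 1 ->
  Rabs (circulation P Q a c l) <= eps * l * l)); auto; clear H01.
- intros a c l Hl H1 H2 H3 H4 Ha Hal Hc Hcl.
  replace (circulation P Q a c l) with
   ((circulation P Q a c (l/2) + circulation P Q (a+l/2) c (l/2)) +
    (circulation P Q a (c+l/2) (l/2) + circulation P Q (a+l/2) (c+l/2) (l/2))).
  + eapply Rle_trans. apply Rabs_triang.
    assert (T1 := Rabs_triang (circulation P Q a c (l/2)) (circulation P Q (a+l/2) c (l/2))).
    assert (T2 := Rabs_triang (circulation P Q a (c+l/2) (l/2)) (circulation P Q (a+l/2) (c+l/2) (l/2))).
    specialize (H1 ltac:(lra) ltac:(lra) ltac:(lra) ltac:(lra)).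
    specialize (H2 ltac:(lra) ltac:(lra) ltac:(lra) ltac:(lra)).
    specialize (H3 ltac:(lra) ltac:(lra) ltac:(lra) ltac:(lra)).
    specialize (H4 ltac:(lra) ltac:(lra) ltac:(lra) ltac:(lra)).
    assert (eps * (l/2) * (l/2) * 4 = eps * l * l) by field. lra.
  + unfold circulation.
    assert (CP : forall y, 0 <= y <= 1 ->
      RInt (fun x => P x y) a (a+l/2) + RInt (fun x => P x y) (a+l/2) (a+l)
      = RInt (fun x => P x y) a (a+l)).
    { intros y Hy. apply (@RInt_Chasles R_CompleteNormedModule); apply ex_RInt_P; lra. }
    assert (CQ : forall x, 0 <= x <= 1 ->
      RInt (fun y => Q x y) c (c+l/2) + RInt (fun y => Q x y) (c+l/2) (c+l)
      = RInt (fun y => Q x y) c (c+l)).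
    { intros y Hy. apply (@RInt_Chasles R_CompleteNormedModule); apply ex_RInt_Q; lra. }
    replace (a + l/2 + l/2) with (a+l) by field.
    replace (c + l/2 + l/2) with (c+l) by field.
    rewrite <- (CP c), <- (CP (c+l)), <- (CQ a), <- (CQ (a+l)) by lra. ring.
- intros x y Hx Hy.
  destruct (closed_form x y) as [px [k [qy [HP HQ]]]]; try lra.
  destruct (HP (eps/8) ltac:(lra)) as [d1 [Hd1 HP']].
  destruct (HQ (eps/8) ltac:(lra)) as [d2 [Hd2 HQ']].
  exists (Rmin d1 d2). split. now apply Rmin_pos.
  intros a c l Hl Ha Hal Hc Hcl Ha0 Hal1 Hc0 Hcl1.
  assert (Hm1 := Rmin_l d1 d2). assert (Hm2 := Rmin_r d1 d2).
  assert (HPe : forall u v, a <= u <= a + l -> c <= v <= c + l ->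
     Rabs (P u v - P x y - (px * (u - x) + k * (v - y))) <= eps / 4 * l).
  { intros u v Hu Hv.
    assert (Rabs (u - x) <= l) by (apply Rabs_le; lra).
    assert (Rabs (v - y) <= l) by (apply Rabs_le; lra).
    specialize (HP' u v ltac:(lra) ltac:(lra)).
    assert (eps/8 * (Rabs (u-x) + Rabs (v-y)) <= eps/8 * (l + l)).
    { apply Rmult_le_compat_l; lra. }
    lra. }
  assert (HQe : forall u v, a <= u <= a + l -> c <= v <= c + l ->
     Rabs (Q u v - Q x y - (k * (u - x) + qy * (v - y))) <= eps / 4 * l).
  { intros u v Hu Hv.
    assert (Rabs (u - x) <= l) by (apply Rabs_le; lra).
    assert (Rabs (v - y) <= l) by (apply Rabs_le; lra).
    specialize (HQ' u v ltac:(lra) ltac:(lra)).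
    assert (eps/8 * (Rabs (u-x) + Rabs (v-y)) <= eps/8 * (l + l)).
    { apply Rmult_le_compat_l; lra. }
    lra. }
  assert (E1 := increment_estimate (fun t => P t c) (fun t => P t (c+l)) a l k (eps/2*l)).
  assert (E2 := increment_estimate (fun t => Q a t) (fun t => Q (a+l) t) c l k (eps/2*l)).
  simpl in E1, E2.
  specialize (E1 ltac:(lra) ltac:(apply ex_RInt_P; lra) ltac:(apply ex_RInt_P; lra)).
  specialize (E2 ltac:(lra) ltac:(apply ex_RInt_Q; lra) ltac:(apply ex_RInt_Q; lra)).
  unfold circulation.
  match type of E1 with ?A -> _ => assert (HA : A) end.
  { intros t Ht.
    assert (B1 := HPe t c ltac:(lra) ltac:(lra)).
    assert (B2 := HPe t (c+l) ltac:(lra) ltac:(lra)).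
    apply Rabs_le_between in B1. apply Rabs_le_between in B2.
    apply Rabs_le. lra. }
  specialize (E1 HA).
  match type of E2 with ?A -> _ => assert (HB : A) end.
  { intros t Ht.
    assert (B1 := HQe a t ltac:(lra) ltac:(lra)).
    assert (B2 := HQe (a+l) t ltac:(lra) ltac:(lra)).
    apply Rabs_le_between in B1. apply Rabs_le_between in B2.
    apply Rabs_le. lra. }
  specialize (E2 HB).
  apply Rabs_le_between in E1. apply Rabs_le_between in E2.
  apply Rabs_le. lra.
Qed.

Lemma goursat :
  RInt (fun x => P x 0) 0 1 + RInt (fun y => Q 1 y) 0 1
  = RInt (fun x => P x 1) 0 1 + RInt (fun y => Q 0 y) 0 1.
Proof.
assert (H : circulation P Q 0 0 1 = 0).
{ destruct (Req_dec (circulation P Q 0 0 1) 0) as [H|H]; auto. exfalso.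
  apply Rabs_pos_lt in H.
  assert (H1 := circulation_small (Rabs (circulation P Q 0 0 1) / 2) ltac:(lra)). lra. }
unfold circulation in H. rewrite !Rplus_0_l in H. lra.
Qed.
End Goursat.

(** * Complex and planar differentiability *)

Definition cder (f : C -> C) (z d : C) : Prop :=
  forall eps, 0 < eps -> exists r, 0 < r /\ forall w, Cmod (w - z)%C < r ->
    Cmod (f w - f z - d * (w - z))%C <= eps * Cmod (w - z)%C.

Lemma is_derive_cder f z d : is_derive f z d <-> cder f z d.
Proof.
split.
- intros [_ H] eps He.
  specialize (H z (fun P HP => HP) (mkposreal eps He)).
  destruct H as [r Hr].
  exists r; split. apply cond_pos.
  intros w Hw. specialize (Hr w Hw). simpl in Hr.
  replace (f w - f z - d * (w - z))%C with
    (minus (minus (f w) (f z)) (scal (minus w z) d)). exact Hr.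
  unfold minus, plus, opp, scal; simpl. unfold mult; simpl. ring.
- intros H. split. apply is_linear_scal_l.
  intros x Hx. apply (@is_filter_lim_locally_unique C_AbsRing (AbsRing_NormedModule C_AbsRing)) in Hx. subst x.
  intros [eps He]. destruct (H eps He) as [r [Hr Hc]].
  exists (mkposreal r Hr).
  intros w Hw. specialize (Hc w Hw).
  replace (f w - f z - d * (w - z))%C with
    (minus (minus (f w) (f z)) (scal (minus w z) d)) in Hc. exact Hc.
  unfold minus, plus, opp, scal; simpl. unfold mult; simpl. ring.
Qed.

Lemma cder_inv (z : C) : z <> 0%C -> cder Cinv z (- / (z * z))%C.
Proof.
intros Hz eps He.
assert (H0 : 0 < Cmod z) by (apply (proj1 (Cmod_gt_0 z)); exact Hz).
set (m := Cmod z) in *.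
assert (Hq : 0 < eps * (m * m * m) / 2).
{ apply Rdiv_lt_0_compat; try lra. repeat apply Rmult_lt_0_compat; auto. }
exists (Rmin (m / 2) (eps * (m * m * m) / 2)). split. apply Rmin_pos; lra.
intros w Hw.
assert (Hw1 := Rlt_le_trans _ _ _ Hw (Rmin_l _ _)).
assert (Hw2 := Rlt_le_trans _ _ _ Hw (Rmin_r _ _)).
assert (Hwm : m / 2 <= Cmod w).
{ assert (T := Cmod_triangle w (z - w)%C).
  replace (w + (z - w))%C with z in T by ring.
  replace (z - w)%C with (- (w - z))%C in T by ring. rewrite Cmod_opp in T.
  fold m in T. lra. }
assert (Hwz : w <> 0%C) by (apply (proj2 (Cmod_gt_0 w)); lra).
replace (/ w - / z - - / (z * z) * (w - z))%C with ((w - z) * (w - z) * / (w * (z * z)))%C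
  by (field; auto).
rewrite !Cmod_mult, Cmod_inv by (repeat apply Cmult_neq_0; auto).
rewrite !Cmod_mult. fold m.
assert (H1 := Cmod_ge_0 (w - z)%C). set (e := Cmod (w - z)%C) in *.
rewrite Rmult_assoc, (Rmult_comm eps). apply Rmult_le_compat_l; auto.
apply Rmult_le_reg_r with (Cmod w * (m * m)).
{ repeat apply Rmult_lt_0_compat; lra. }
replace (e * / (Cmod w * (m * m)) * (Cmod w * (m * m))) with e by (field; split; lra).
apply Rle_trans with (eps * (m / 2 * (m * m))). lra.
apply Rmult_le_compat_l. lra. apply Rmult_le_compat_r; auto. nra.
Qed.

(** Keeps complex formulas intact under differentiation in two real parameters; real and imaginary
    parts are separated only afterwards. *)
Definition cdif (F : R -> R -> C) (x y : R) (lx ly : C) : Prop :=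
  forall eps, 0 < eps -> exists d, 0 < d /\ forall u v : R,
    Rabs (u - x) < d -> Rabs (v - y) < d ->
    Cmod (F u v - F x y - (lx * (u - x)%R + ly * (v - y)%R))%C
      <= eps * (Rabs (u - x) + Rabs (v - y)).

Lemma cdif_ext F x y lx ly lx' ly' : cdif F x y lx ly -> lx = lx' -> ly = ly' ->
  cdif F x y lx' ly'.
Proof. now intros H <- <-. Qed.

Lemma cdif_const c x y : cdif (fun _ _ => c) x y 0 0.
Proof.
intros eps He. exists 1. split. lra. intros u v _ _.
replace (c - c - (0 * (u - x)%R + 0 * (v - y)%R))%C with (RtoC 0) by ring.
rewrite Cmod_0. apply Rmult_le_pos. lra.
apply Rplus_le_le_0_compat; apply Rabs_pos.
Qed.

Lemma cdif_fst x y : cdif (fun u _ => RtoC u) x y 1 0.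
Proof.
intros eps He. exists 1. split. lra. intros u v _ _.
replace (u - x - (1 * (u - x)%R + 0 * (v - y)%R))%C with (RtoC 0)
  by (rewrite !RtoC_minus; ring).
rewrite Cmod_0. apply Rmult_le_pos. lra.
apply Rplus_le_le_0_compat; apply Rabs_pos.
Qed.

Lemma cdif_plus F G x y fx fy gx gy : cdif F x y fx fy -> cdif G x y gx gy ->
  cdif (fun u v => F u v + G u v)%C x y (fx + gx)%C (fy + gy)%C.
Proof.
intros HF HG eps He.
destruct (HF (eps/2) ltac:(lra)) as [d1 [Hd1 HF']].
destruct (HG (eps/2) ltac:(lra)) as [d2 [Hd2 HG']].
exists (Rmin d1 d2). split. now apply Rmin_pos.
intros u v Hu Hv. assert (M1 := Rmin_l d1 d2). assert (M2 := Rmin_r d1 d2).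
specialize (HF' u v ltac:(lra) ltac:(lra)). specialize (HG' u v ltac:(lra) ltac:(lra)).
match goal with |- Cmod ?A <= _ => replace A with
 ((F u v - F x y - (fx * (u - x)%R + fy * (v - y)%R)) +
  (G u v - G x y - (gx * (u - x)%R + gy * (v - y)%R)))%C by ring end.
eapply Rle_trans. apply Cmod_triangle. lra.
Qed.

Lemma Cmod_linear (lx ly : C) (s t : R) :
  Cmod (lx * s + ly * t)%C <= (Cmod lx + Cmod ly) * (Rabs s + Rabs t).
Proof.
eapply Rle_trans. apply Cmod_triangle. rewrite !Cmod_mult, !Cmod_R.
assert (H1 := Cmod_ge_0 lx). assert (H2 := Cmod_ge_0 ly).
assert (H3 := Rabs_pos s). assert (H4 := Rabs_pos t). nra.
Qed.

Lemma cdif_lipschitz F x y lx ly : cdif F x y lx ly -> exists k d, 0 < k /\ 0 < d /\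
  forall u v, Rabs (u - x) < d -> Rabs (v - y) < d ->
    Cmod (F u v - F x y)%C <= k * (Rabs (u - x) + Rabs (v - y)).
Proof.
intros H. destruct (H 1 Rlt_0_1) as [d [Hd Hc]].
exists (1 + (Cmod lx + Cmod ly)), d.
assert (H1 := Cmod_ge_0 lx). assert (H2 := Cmod_ge_0 ly).
repeat split; try lra. intros u v Hu Hv. specialize (Hc u v Hu Hv).
assert (T := Cmod_linear lx ly (u-x) (v-y)).
replace (F u v - F x y)%C with
  ((F u v - F x y - (lx * (u - x)%R + ly * (v - y)%R)) +
   (lx * (u - x)%R + ly * (v - y)%R))%C by ring.
eapply Rle_trans. apply Cmod_triangle. lra.
Qed.

Lemma cdif_comp g F x y d lx ly : cder g (F x y) d -> cdif F x y lx ly ->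
  cdif (fun u v => g (F u v)) x y (d * lx)%C (d * ly)%C.
Proof.
intros Hg HF eps He.
destruct (cdif_lipschitz _ _ _ _ _ HF) as [k [d0 [Hk [Hd0 HL]]]].
assert (Hd := Cmod_ge_0 d).
assert (Hq1 : 0 < eps / (2 * (Cmod d + 1))) by (apply Rdiv_lt_0_compat; lra).
assert (Hq2 : 0 < eps / (2 * k)) by (apply Rdiv_lt_0_compat; lra).
destruct (HF _ Hq1) as [d1 [Hd1 HF']].
destruct (Hg _ Hq2) as [r [Hr Hg']].
assert (Hq3 : 0 < r / (2 * k)) by (apply Rdiv_lt_0_compat; lra).
exists (Rmin (Rmin d0 d1) (r / (2 * k))). split. repeat apply Rmin_pos; auto.
intros u v Hu Hv.
assert (M1 := Rmin_l (Rmin d0 d1) (r / (2*k))). assert (M2 := Rmin_r (Rmin d0 d1) (r/(2*k))).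
assert (M3 := Rmin_l d0 d1). assert (M4 := Rmin_r d0 d1).
specialize (HL u v ltac:(lra) ltac:(lra)). specialize (HF' u v ltac:(lra) ltac:(lra)).
set (s := Rabs (u - x) + Rabs (v - y)) in *.
assert (Hs : 0 <= s) by (apply Rplus_le_le_0_compat; apply Rabs_pos).
assert (Hks : k * s < r).
{ replace r with (k * (2 * (r / (2 * k)))) by (field; lra).
  apply Rmult_lt_compat_l; auto. unfold s. lra. }
specialize (Hg' (F u v) ltac:(lra)).
match goal with |- Cmod ?A <= _ => replace A with
 ((g (F u v) - g (F x y) - d * (F u v - F x y)) +
  d * (F u v - F x y - (lx * (u - x)%R + ly * (v - y)%R)))%C by ring end.
eapply Rle_trans. apply Cmod_triangle. rewrite Cmod_mult.
assert (A1 : eps / (2*k) * Cmod (F u v - F x y)%C <= eps / (2*k) * (k * s)).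
{ apply Rmult_le_compat_l; lra. }
replace (eps / (2*k) * (k * s)) with (eps / 2 * s) in A1 by (field; lra).
match goal with |- _ + Cmod d * ?X <= _ =>
 assert (A2 : Cmod d * X <= (Cmod d + 1) * (eps / (2 * (Cmod d + 1)) * s)) end.
{ apply Rmult_le_compat; auto; try lra. apply Cmod_ge_0. }
replace ((Cmod d + 1) * (eps / (2 * (Cmod d + 1)) * s)) with (eps / 2 * s) in A2
  by (field; lra).
lra.
Qed.

Lemma cdif_mult F G x y fx fy gx gy : cdif F x y fx fy -> cdif G x y gx gy ->
  cdif (fun u v => F u v * G u v)%C x y
    (fx * G x y + F x y * gx)%C (fy * G x y + F x y * gy)%C.
Proof.
intros HF HG eps He.
destruct (cdif_lipschitz _ _ _ _ _ HF) as [k1 [d1 [Hk1 [Hd1 HL1]]]].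
destruct (cdif_lipschitz _ _ _ _ _ HG) as [k2 [d2 [Hk2 [Hd2 HL2]]]].
assert (HF0 := Cmod_ge_0 (F x y)). assert (HG0 := Cmod_ge_0 (G x y)).
assert (Hq1 : 0 < eps / (3 * (Cmod (G x y) + 1))) by (apply Rdiv_lt_0_compat; lra).
assert (Hq2 : 0 < eps / (3 * (Cmod (F x y) + 1))) by (apply Rdiv_lt_0_compat; lra).
assert (Hk12 : 0 < k1 * k2) by now apply Rmult_lt_0_compat.
assert (Hq3 : 0 < eps / (6 * (k1 * k2))) by (apply Rdiv_lt_0_compat; lra).
destruct (HF _ Hq1) as [d3 [Hd3 HF']].
destruct (HG _ Hq2) as [d4 [Hd4 HG']].
exists (Rmin (Rmin d1 d2) (Rmin (Rmin d3 d4) (eps / (6 * (k1 * k2))))).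
split. repeat apply Rmin_pos; auto.
intros u v Hu Hv.
assert (M1 := Rmin_l (Rmin d1 d2) (Rmin (Rmin d3 d4) (eps / (6 * (k1 * k2))))).
assert (M2 := Rmin_r (Rmin d1 d2) (Rmin (Rmin d3 d4) (eps / (6 * (k1 * k2))))).
assert (M3 := Rmin_l (Rmin d3 d4) (eps / (6 * (k1 * k2)))).
assert (M4 := Rmin_r (Rmin d3 d4) (eps / (6 * (k1 * k2)))).
assert (M5 := Rmin_l d1 d2). assert (M6 := Rmin_r d1 d2).
assert (M7 := Rmin_l d3 d4). assert (M8 := Rmin_r d3 d4).
specialize (HL1 u v ltac:(lra) ltac:(lra)). specialize (HL2 u v ltac:(lra) ltac:(lra)).
specialize (HF' u v ltac:(lra) ltac:(lra)). specialize (HG' u v ltac:(lra) ltac:(lra)).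
set (s := Rabs (u - x) + Rabs (v - y)) in *.
assert (Hs : 0 <= s) by (apply Rplus_le_le_0_compat; apply Rabs_pos).
assert (Hs2 : s <= 2 * (eps / (6 * (k1 * k2)))) by (unfold s; lra).
match goal with |- Cmod ?A <= _ => replace A with
 ((F u v - F x y - (fx * (u - x)%R + fy * (v - y)%R)) * G x y +
  F x y * (G u v - G x y - (gx * (u - x)%R + gy * (v - y)%R)) +
  (F u v - F x y) * (G u v - G x y))%C by ring end.
eapply Rle_trans. apply Cmod_triangle.
eapply Rle_trans. apply Rplus_le_compat_r. apply Cmod_triangle. rewrite !Cmod_mult.
assert (B1 : Cmod (F u v - F x y - (fx * (u - x)%R + fy * (v - y)%R))%C * Cmod (G x y)
  <= (eps / (3 * (Cmod (G x y) + 1)) * s) * (Cmod (G x y) + 1)).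
{ apply Rmult_le_compat; auto; try lra. apply Cmod_ge_0. }
replace ((eps / (3 * (Cmod (G x y) + 1)) * s) * (Cmod (G x y) + 1)) with (eps/3*s) in B1
  by (field; lra).
assert (B2 : Cmod (F x y) * Cmod (G u v - G x y - (gx * (u - x)%R + gy * (v - y)%R))%C
  <= (Cmod (F x y) + 1) * (eps / (3 * (Cmod (F x y) + 1)) * s)).
{ apply Rmult_le_compat; auto; try lra. apply Cmod_ge_0. }
replace ((Cmod (F x y) + 1) * (eps / (3 * (Cmod (F x y) + 1)) * s)) with (eps/3*s) in B2
  by (field; lra).
assert (B3 : Cmod (F u v - F x y)%C * Cmod (G u v - G x y)%C <= (k1 * s) * (k2 * s)).
{ apply Rmult_le_compat; auto; apply Cmod_ge_0. }
assert (B4 : (k1 * s) * (k2 * s) <= k1 * k2 * (2 * (eps / (6 * (k1 * k2)))) * s).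
{ replace (k1 * s * (k2 * s)) with (k1 * k2 * s * s) by ring.
  apply Rmult_le_compat_r; auto. apply Rmult_le_compat_l; lra. }
replace (k1 * k2 * (2 * (eps / (6 * (k1 * k2)))) * s) with (eps/3*s) in B4
  by (field; lra).
lra.
Qed.

Lemma is_derive_eps f y l : is_derive f y l -> forall eps, 0 < eps ->
  exists d, 0 < d /\ forall v : R, Rabs (v - y) < d ->
    Rabs (f v - f y - l * (v - y)) <= eps * Rabs (v - y).
Proof.
intros [_ H] eps He.
specialize (H y (fun P HP => HP) (mkposreal eps He)). destruct H as [d Hd].
exists d. split. apply cond_pos. intros v Hv. specialize (Hd v Hv).
simpl in Hd. unfold minus, plus, opp, scal, norm in Hd; simpl in Hd.
unfold mult, abs in Hd; simpl in Hd.
replace (f v - f y - l * (v - y)) with (f v + - f y + - ((v + - y) * l)) by ring.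
exact Hd.
Qed.

Lemma Cmod_pair a b : Cmod (a, b) <= Rabs a + Rabs b.
Proof.
replace (a, b) with (RtoC a + Ci * RtoC b)%C.
- eapply Rle_trans. apply Cmod_triangle. rewrite Cmod_mult, Cmod_Ci, !Cmod_R. lra.
- unfold RtoC, Ci, Cplus, Cmult; simpl. f_equal; ring.
Qed.

Lemma cdif_pair a b x y a' b' : is_derive a y a' -> is_derive b y b' ->
  cdif (fun _ v => (a v, b v)) x y 0 (a', b').
Proof.
intros Ha Hb eps He.
destruct (is_derive_eps _ _ _ Ha (eps/2) ltac:(lra)) as [d1 [Hd1 Ha']].
destruct (is_derive_eps _ _ _ Hb (eps/2) ltac:(lra)) as [d2 [Hd2 Hb']].
exists (Rmin d1 d2). split. now apply Rmin_pos.
intros u v Hu Hv. assert (M1 := Rmin_l d1 d2). assert (M2 := Rmin_r d1 d2).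
specialize (Ha' v ltac:(lra)). specialize (Hb' v ltac:(lra)).
match goal with |- Cmod ?A <= _ => replace A with
  (a v - a y - a' * (v - y), b v - b y - b' * (v - y)) end.
2:{ unfold RtoC, Cplus, Cminus, Copp, Cmult; simpl. apply injective_projections; simpl; ring. }
eapply Rle_trans. apply Cmod_pair.
assert (H := Rabs_pos (u - x)). nra.
Qed.

Lemma im_le_Cmod (c : C) : Rabs (Im c) <= Cmod c.
Proof. eapply Rle_trans; [apply Rmax_r | apply (Rmax_Cmod c)]. Qed.

Lemma cdif_Re F x y lx ly : cdif F x y lx ly ->
  rdiff (fun u v => Re (F u v)) x y (Re lx) (Re ly).
Proof.
intros H eps He. destruct (H eps He) as [d [Hd Hc]]. exists d; split; auto.
intros u v Hu Hv. eapply Rle_trans; [|apply (Hc u v Hu Hv)].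
eapply Rle_trans; [|apply re_le_Cmod].
unfold Cminus. rewrite !re_plus, !re_opp, re_plus, !re_scal_r. apply Req_le; f_equal; ring.
Qed.

Lemma cdif_Im F x y lx ly : cdif F x y lx ly ->
  rdiff (fun u v => Im (F u v)) x y (Im lx) (Im ly).
Proof.
intros H eps He. destruct (H eps He) as [d [Hd Hc]]. exists d; split; auto.
intros u v Hu Hv. eapply Rle_trans; [|apply (Hc u v Hu Hv)].
eapply Rle_trans; [|apply im_le_Cmod].
unfold Im, Cminus, Cplus, Copp, Cmult, RtoC; simpl. apply Req_le; f_equal; ring.
Qed.

(** * Cauchy's formula and second order expansions *)

(* [RInt] yields equations typed in a structure projecting to [R], which [ring] does not see through. *)
Ltac Rring := match goal with |- @eq _ ?a ?b => change (@eq R a b); ring end.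

Definition circle_int (g : R -> C) : C :=
  (RInt (fun y => Re (g y)) 0 1, RInt (fun y => Im (g y)) 0 1).

(** Phrased through [cdif] with a dummy first variable, so that the rules for sums, products and
    compositions also prove integrability and boundedness on the circle. *)
Definition circle_cont (g : R -> C) : Prop := forall y, 0 <= y <= 1 ->
  exists l, cdif (fun _ v => g v) 0 y 0 l.

Lemma circle_cont_ex_RInt g : circle_cont g ->
  ex_RInt (fun y => Re (g y)) 0 1 /\ ex_RInt (fun y => Im (g y)) 0 1.
Proof.
intros H; split; apply (@ex_RInt_continuous R_CompleteNormedModule); intros y Hy;
 rewrite Rmin_left, Rmax_right in Hy by lra; destruct (H y Hy) as [l Hl].
- exact (rdiff_continuous1 _ _ _ _ _ (rdiff_swap _ _ _ _ _ (cdif_Re _ _ _ _ _ Hl))).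
- exact (rdiff_continuous1 _ _ _ _ _ (rdiff_swap _ _ _ _ _ (cdif_Im _ _ _ _ _ Hl))).
Qed.

Lemma circle_int_ext f g : (forall y, 0 < y < 1 -> f y = g y) -> circle_int f = circle_int g.
Proof.
intros H. unfold circle_int. f_equal; apply RInt_ext; intros y Hy;
 rewrite Rmin_left, Rmax_right in Hy by lra; now rewrite H.
Qed.

Lemma circle_int_lin f g (c : C) : circle_cont f -> circle_cont g ->
  circle_int (fun y => f y + c * g y)%C = (circle_int f + c * circle_int g)%C.
Proof.
intros Hf Hg. apply circle_cont_ex_RInt in Hf. apply circle_cont_ex_RInt in Hg.
destruct Hf as [F1 F2]. destruct Hg as [G1 G2].
assert (Lin : forall (p q r : R -> R) (a b : R), ex_RInt p 0 1 -> ex_RInt q 0 1 -> ex_RInt r 0 1 ->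
  RInt (fun y => p y + (a * q y + b * r y)) 0 1 = RInt p 0 1 + (a * RInt q 0 1 + b * RInt r 0 1)).
{ intros p q r a b Hp Hq Hr.
  apply is_RInt_unique.
  apply (@is_RInt_plus R_NormedModule). now apply (@RInt_correct R_CompleteNormedModule).
  apply (@is_RInt_plus R_NormedModule); apply (@is_RInt_scal R_NormedModule);
    now apply (@RInt_correct R_CompleteNormedModule). }
unfold circle_int, Cplus, Cmult; simpl. f_equal.
- transitivity (RInt (fun y => Re (f y) + (fst c * Re (g y) + (- snd c) * Im (g y))) 0 1).
  + apply RInt_ext. intros y _. unfold Re, Im; simpl. Rring.
  + rewrite Lin by auto. Rring.
- transitivity (RInt (fun y => Im (f y) + (fst c * Im (g y) + snd c * Re (g y))) 0 1).
  + apply RInt_ext. intros y _. unfold Re, Im; simpl. Rring.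
  + rewrite Lin by auto. Rring.
Qed.

Lemma circle_int_bound f B : circle_cont f -> (forall y, 0 <= y <= 1 -> Cmod (f y) <= B) ->
  Cmod (circle_int f) <= 2 * B.
Proof.
intros Hf HB. apply circle_cont_ex_RInt in Hf. destruct Hf as [F1 F2].
eapply Rle_trans. apply Cmod_pair.
assert (Rabs (RInt (fun y => Re (f y)) 0 1) <= (1 - 0) * B).
{ apply abs_RInt_le_const; auto. lra. intros t Ht.
  eapply Rle_trans. apply re_le_Cmod. auto. }
assert (Rabs (RInt (fun y => Im (f y)) 0 1) <= (1 - 0) * B).
{ apply abs_RInt_le_const; auto. lra. intros t Ht.
  eapply Rle_trans. apply im_le_Cmod. auto. }
lra.
Qed.

Lemma circle_int_const c : circle_int (fun _ => c) = c.
Proof.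
unfold circle_int. rewrite !RInt_const. unfold scal; simpl. unfold mult; simpl.
destruct c; simpl. f_equal; ring.
Qed.

Lemma cdif_fixed (F : R -> R -> C) x y lx ly :
  cdif F x y lx ly -> cdif (fun _ v => F x v) 0 y 0 ly.
Proof.
intros H eps He. destruct (H eps He) as [d [Hd Hc]]. exists d; split; auto.
intros u v Hu Hv.
specialize (Hc x v). rewrite Rminus_diag, Rabs_R0 in Hc. specialize (Hc Hd Hv).
replace (F x v - F x y - (0 * (u - 0)%R + ly * (v - y)%R))%C
 with (F x v - F x y - (lx * 0 + ly * (v - y)%R))%C by ring.
eapply Rle_trans. exact Hc. apply Rmult_le_compat_l. lra.
apply Rplus_le_compat_r. apply Rabs_pos.
Qed.

Definition expi (y : R) : C := (cos (2 * PI * y), sin (2 * PI * y)).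
Definition two_pi_i : C := (0, 2 * PI).

Lemma cdif_expi x y : cdif (fun _ v => expi v) x y 0 (expi y * two_pi_i)%C.
Proof.
eapply cdif_ext.
- apply (cdif_pair (fun v => cos (2 * PI * v)) (fun v => sin (2 * PI * v)));
  auto_derive; auto; reflexivity.
- reflexivity.
- unfold expi, two_pi_i, Cmult; simpl. f_equal; ring.
Qed.

Lemma Cmod_expi y : Cmod (expi y) = 1.
Proof.
unfold Cmod, expi; simpl fst; simpl snd.
replace (cos (2*PI*y)^2 + sin (2*PI*y)^2) with 1. apply sqrt_1.
assert (H := sin2_cos2 (2*PI*y)). unfold Rsqr in H. lra.
Qed.

Lemma expi_0 : expi 0 = 1%C.
Proof. unfold expi. now rewrite Rmult_0_r, cos_0, sin_0. Qed.

Lemma expi_1 : expi 1 = 1%C.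
Proof. unfold expi. now rewrite Rmult_1_r, cos_2PI, sin_2PI. Qed.

Lemma Cmod_Rpos (r : R) : 0 <= r -> Cmod r = r.
Proof. intros H. rewrite Cmod_R. now apply Rabs_pos_eq. Qed.

(** * Cauchy's formula by a homotopy of circles *)

Section CauchyFormula.
Variables (f : C -> C) (R0 r : R).
Hypothesis Hr : 0 < r < R0.
Hypothesis Hf : forall z, Cmod z < R0 -> exists d, cder f z d.

Section Homotopy.
Variables (h : C) (e : R).
Hypothesis He : 0 < e < r - Cmod h.

Definition hpath (u v : R) : C := ((RtoC r + RtoC u * RtoC (e - r)) * expi v + RtoC u * h)%C.
(** [Pform] and [Qform] are the components of the pullback of [f(w) dw/(w - h)] under [hpath]. *)
Definition Pform (u v : R) : C :=
  (f (hpath u v) * (/ (hpath u v + - h) * (RtoC (e - r) * expi v + h)))%C.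
Definition Qform (u v : R) : C :=
  (f (hpath u v) * (/ (hpath u v + - h) * ((RtoC r + RtoC u * RtoC (e - r)) * (expi v * two_pi_i))))%C.

Lemma cdif_scalar x y :
  cdif (fun u _ => RtoC r + RtoC u * RtoC (e - r))%C x y (RtoC (e - r)) 0.
Proof.
eapply cdif_ext.
apply cdif_plus. apply cdif_const.
apply cdif_mult. apply cdif_fst. apply cdif_const.
1,2: cbv beta; ring.
Qed.

Lemma cdif_hpath x y : cdif hpath x y (RtoC (e - r) * expi y + h)%C
  ((RtoC r + RtoC x * RtoC (e - r)) * (expi y * two_pi_i))%C.
Proof.
eapply cdif_ext.
apply cdif_plus. apply cdif_mult. apply cdif_scalar. apply cdif_expi.
apply cdif_mult. apply cdif_fst. apply cdif_const.
1,2: cbv beta; ring.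
Qed.

Lemma hpath_in x y : 0 <= x <= 1 -> Cmod (hpath x y) < R0.
Proof.
intros Hx. unfold hpath. eapply Rle_lt_trans. apply Cmod_triangle.
rewrite !Cmod_mult, Cmod_expi, <- RtoC_mult, <- RtoC_plus.
assert (H := Cmod_ge_0 h).
rewrite !Cmod_Rpos by nra. nra.
Qed.

(** Equality would force [r + x (e - r) = (1 - x) |h|], but the difference of the two sides is
    [(1 - x) (r - |h|) + x e > 0]. *)
Lemma hpath_avoid x y : 0 <= x <= 1 -> (hpath x y + - h)%C <> RtoC 0.
Proof.
intros Hx H0. unfold hpath in H0.
assert (H1 : ((RtoC r + RtoC x * RtoC (e - r)) * expi y)%C = (RtoC (1 - x) * h)%C).
{ rewrite (RtoC_minus 1 x).
  replace ((RtoC r + RtoC x * RtoC (e - r)) * expi y)%C with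
   (((RtoC r + RtoC x * RtoC (e - r)) * expi y + x * h + - h) + (1 - x) * h)%C by ring.
  rewrite H0. ring. }
apply (f_equal Cmod) in H1.
assert (H := Cmod_ge_0 h).
rewrite !Cmod_mult, Cmod_expi, <- RtoC_mult, <- RtoC_plus, !Cmod_Rpos in H1 by nra.
nra.
Qed.

(** With [g(w) = f(w)/(w - h)] and [w = hpath u v], both mixed derivatives equal
    [g' w_u w_v + g w_uv]. This common value [k] is the closedness that [goursat] asks for. *)
Lemma cdif_forms x y : 0 <= x <= 1 -> exists px k qy,
  cdif Pform x y px k /\ cdif Qform x y k qy.
Proof.
intros Hx.
destruct (Hf (hpath x y)) as [d Hd]. now apply hpath_in.
assert (HZ := cdif_hpath x y).
assert (HF := cdif_comp f hpath x y d _ _ Hd HZ).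
assert (HI := cdif_comp Cinv (fun u v => hpath u v + - h)%C x y _ _ _
  (cder_inv _ (hpath_avoid x y Hx)) (cdif_plus _ _ _ _ _ _ _ _ HZ (cdif_const (- h)%C x y))).
assert (HE := cdif_expi x y).
assert (HN := hpath_avoid x y Hx).
do 3 eexists. split.
- unfold Pform. apply cdif_mult. exact HF. apply cdif_mult. exact HI.
  apply cdif_plus. apply cdif_mult. apply cdif_const. exact HE. apply cdif_const.
- eapply cdif_ext.
  unfold Qform. apply cdif_mult. exact HF. apply cdif_mult. exact HI.
  apply cdif_mult. apply cdif_scalar. apply cdif_mult. exact HE. apply cdif_const.
  2: reflexivity.
  cbv beta; ring.
Qed.

Lemma Pform_periodic x : Pform x 0 = Pform x 1.
Proof. unfold Pform, hpath. now rewrite expi_0, expi_1. Qed.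

(** The sides [v = 0] and [v = 1] of the parameter square have the same image, so their
    contributions cancel and only the two circles remain. *)
Lemma circle_int_homotopy : circle_int (fun y => Qform 0 y) = circle_int (fun y => Qform 1 y).
Proof.
unfold circle_int. f_equal.
- assert (G := goursat (fun u v => Re (Pform u v)) (fun u v => Re (Qform u v))).
  cbv beta in G. rewrite (RInt_ext (fun x => Re (Pform x 0)) (fun x => Re (Pform x 1))) in G.
  2: intros x _; now rewrite Pform_periodic.
  symmetry. apply (Rplus_eq_reg_l (RInt (fun x => Re (Pform x 1)) 0 1)). apply G.
  intros x y Hx Hy. destruct (cdif_forms x y Hx) as [px [k [qy [HP HQ]]]].
  exists (Re px), (Re k), (Re qy). split; now apply cdif_Re.
- assert (G := goursat (fun u v => Im (Pform u v)) (fun u v => Im (Qform u v))).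
  cbv beta in G. rewrite (RInt_ext (fun x => Im (Pform x 0)) (fun x => Im (Pform x 1))) in G.
  2: intros x _; now rewrite Pform_periodic.
  symmetry. apply (Rplus_eq_reg_l (RInt (fun x => Im (Pform x 1)) 0 1)). apply G.
  intros x y Hx Hy. destruct (cdif_forms x y Hx) as [px [k [qy [HP HQ]]]].
  exists (Im px), (Im k), (Im qy). split; now apply cdif_Im.
Qed.

Lemma circle_cont_Qform x : 0 <= x <= 1 -> circle_cont (fun y => Qform x y).
Proof.
intros Hx y Hy. destruct (cdif_forms x y Hx) as [px [k [qy [HP HQ]]]].
exists qy. exact (cdif_fixed _ _ _ _ _ HQ).
Qed.
End Homotopy.

Definition cauchy_kernel (h : C) (y : R) : C :=
  (f (RtoC r * expi y) * (/ (RtoC r * expi y + - h) * (RtoC r * (expi y * two_pi_i))))%C.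

Lemma Qform_0 h e y : Qform h e 0 y = cauchy_kernel h y.
Proof.
unfold Qform, cauchy_kernel, hpath.
replace ((RtoC r + 0 * RtoC (e - r)) * expi y + 0 * h)%C with (RtoC r * expi y)%C by ring.
now replace (RtoC r + 0 * RtoC (e - r))%C with (RtoC r) by ring.
Qed.

Lemma Qform_1 h e y : 0 < e -> Qform h e 1 y = (f (h + RtoC e * expi y) * two_pi_i)%C.
Proof.
intros He. unfold Qform, hpath.
replace ((RtoC r + 1 * RtoC (e - r)) * expi y + 1 * h)%C with (h + RtoC e * expi y)%C
  by (rewrite RtoC_minus; ring).
replace (RtoC r + 1 * RtoC (e - r))%C with (RtoC e) by (rewrite RtoC_minus; ring).
assert (expi y <> 0%C).
{ intros H. assert (T := Cmod_expi y). rewrite H, Cmod_0 in T. lra. }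
assert (RtoC e <> 0%C). { intros H1. apply RtoC_inj in H1. lra. }
f_equal. replace (h + e * expi y + - h)%C with (e * expi y)%C by ring.
field. now split.
Qed.

Lemma circle_cont_cauchy_kernel h : Cmod h < r -> circle_cont (cauchy_kernel h).
Proof.
intros Hh y Hy.
destruct (circle_cont_Qform h ((r - Cmod h)/2) ltac:(lra) 0 ltac:(lra) y Hy) as [l Hl].
exists l. intros eps He. destruct (Hl eps He) as [d [Hd Hc]]. exists d; split; auto.
intros u v Hu Hv. specialize (Hc u v Hu Hv). rewrite !Qform_0 in Hc. exact Hc.
Qed.

(** The integral over the large circle equals that over each small one, where the integrand is
    [f (h + e * expi y) * two_pi_i], at a distance of order [e] from [f h * two_pi_i]. *)
Lemma cauchy_formula h : Cmod h < r -> circle_int (cauchy_kernel h) = (f h * two_pi_i)%C.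
Proof.
intros Hh.
assert (Hz : Cmod (circle_int (cauchy_kernel h) - f h * two_pi_i)%C = 0).
2:{ apply Cmod_eq_0 in Hz.
  replace (circle_int (cauchy_kernel h)) with
    ((circle_int (cauchy_kernel h) - f h * two_pi_i) + f h * two_pi_i)%C by ring.
  rewrite Hz. ring. }
apply Rle_antisym; [|apply Cmod_ge_0].
apply le_epsilon. intros eps Heps. rewrite Rplus_0_l.
assert (Ht : 0 <= Cmod two_pi_i) by apply Cmod_ge_0.
destruct (Hf h ltac:(lra)) as [d Hd].
destruct (Hd 1 Rlt_0_1) as [s [Hs Hd']].
assert (Hd0 := Cmod_ge_0 d).
set (A := 2 * (1 + Cmod d) * (Cmod two_pi_i + 1)).
assert (HA : 0 < A) by (unfold A; apply Rmult_lt_0_compat; lra).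
assert (Hq : 0 < eps / A) by (apply Rdiv_lt_0_compat; lra).
(* [s/2] gives the derivative estimate on the small circle, [(r - Cmod h)/2] makes the homotopy
   admissible, and [eps / A] makes the final error at most [eps]. *)
set (e := Rmin (Rmin (s/2) ((r - Cmod h)/2)) (eps / A)).
assert (He : 0 < e) by (unfold e; repeat apply Rmin_pos; lra).
assert (M1 := Rmin_l (Rmin (s/2) ((r - Cmod h)/2)) (eps / A)).
assert (M2 := Rmin_r (Rmin (s/2) ((r - Cmod h)/2)) (eps / A)).
assert (M3 := Rmin_l (s/2) ((r - Cmod h)/2)).
assert (M4 := Rmin_r (s/2) ((r - Cmod h)/2)).
fold e in M1, M2.
assert (He' : 0 < e < r - Cmod h) by lra.
rewrite (circle_int_ext (cauchy_kernel h) (fun y => Qform h e 0 y)).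
2: intros; now rewrite Qform_0.
rewrite (circle_int_homotopy h e He').
assert (CQ := circle_cont_Qform h e He' 1 ltac:(lra)).
assert (Cc : circle_cont (fun _ => f h * two_pi_i)%C).
{ intros y Hy. exists 0%C. apply cdif_const. }
replace (circle_int (fun y => Qform h e 1 y) - f h * two_pi_i)%C with
  (circle_int (fun y => Qform h e 1 y + (-(1)) * (f h * two_pi_i)))%C.
2:{ rewrite circle_int_lin by auto. rewrite circle_int_const.
  change (circle_int (fun y : R => Qform h e 1 y)) with (circle_int (Qform h e 1)). ring. }
apply Rle_trans with (2 * ((1 + Cmod d) * e * (Cmod two_pi_i + 1))).
- apply circle_int_bound.
  + intros y Hy. destruct (CQ y Hy) as [l1 H1].
    eexists. eapply cdif_ext. apply cdif_plus. exact H1. apply cdif_const. 1: cbv beta; ring. reflexivity.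
  + intros y Hy. rewrite Qform_1 by auto.
    specialize (Hd' (h + e * expi y)%C).
    replace (h + e * expi y - h)%C with (e * expi y)%C in Hd' by ring.
    assert (Em : Cmod (e * expi y)%C = e).
    { rewrite Cmod_mult, Cmod_expi, Cmod_Rpos; lra. }
    rewrite Em in Hd'. specialize (Hd' ltac:(lra)).
    replace (f (h + e * expi y) * two_pi_i + - (1) * (f h * two_pi_i))%C with
     (((f (h + e * expi y) - f h - d * (e * expi y)) + d * (e * expi y)) * two_pi_i)%C by ring.
    rewrite Cmod_mult.
    apply Rmult_le_compat; auto; try apply Cmod_ge_0; try lra.
    eapply Rle_trans. apply Cmod_triangle. rewrite (Cmod_mult d), Em. lra.
- apply Rle_trans with (A * e). unfold A; apply Req_le; ring.
  replace eps with (A * (eps / A)) by (field; lra).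
  apply Rmult_le_compat_l; lra.
Qed.

(** Cauchy's formula with [w/(w - h) = 1 + h/w + h^2/w^2 + h^3/(w^2 (w - h))] under the integral;
    [|h| < r/2] keeps [|w - h|] above [r/2], which makes the last term cubic in [h]. *)
Lemma taylor_2_at_0 : exists c0 c1 c2 B, 0 < B /\
  forall h, Cmod h < r / 2 ->
    Cmod (f h - c0 - c1 * h - c2 * (h * h))%C <= B * Cmod h ^ 3.
Proof.
assert (Htau : two_pi_i <> 0%C).
{ intros H. apply (f_equal snd) in H. simpl in H. assert (P := PI_RGT_0). lra. }
assert (Hr0 : RtoC r <> 0%C). { intros H1. apply RtoC_inj in H1. lra. }
assert (HE : forall y, expi y <> 0%C).
{ intros y H. assert (T := Cmod_expi y). rewrite H, Cmod_0 in T. lra. }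
pose (ck := fun (k : R -> C) y => (f (RtoC r * expi y) * (k y * two_pi_i))%C).
pose (inv1 := fun y => (/ (RtoC r * expi y))%C).
assert (C1 : forall y, cdif (fun _ v => inv1 v) 0 y 0
   (- / ((RtoC r * expi y) * (RtoC r * expi y)) * (RtoC r * (expi y * two_pi_i)))%C).
{ intros y. eapply cdif_ext.
  apply (cdif_comp Cinv). apply cder_inv. now apply Cmult_neq_0.
  apply cdif_mult. apply cdif_const. apply cdif_expi. 1,2: cbv beta; ring. }
assert (Hck : forall k, (forall y, exists l, cdif (fun _ v => k v) 0 y 0 l) -> circle_cont (ck k)).
{ intros k Hk y Hy. destruct (Hk y) as [l Hl].
  destruct (Hf (RtoC r * expi y)%C) as [d Hd].
  { rewrite Cmod_mult, Cmod_expi, Cmod_Rpos; lra. }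
  eexists. eapply cdif_ext. unfold ck. apply cdif_mult.
  apply (cdif_comp f (fun _ v => RtoC r * expi v)%C). exact Hd.
  apply cdif_mult. apply cdif_const. apply cdif_expi.
  apply cdif_mult. exact Hl. apply cdif_const. 1: cbv beta; ring. reflexivity. }
assert (K0 : circle_cont (ck (fun _ => 1%C))).
{ apply Hck. intros y. eexists. apply cdif_const. }
assert (K1 : circle_cont (ck inv1)).
{ apply Hck. intros y. eexists. apply C1. }
assert (K2 : circle_cont (ck (fun y => inv1 y * inv1 y)%C)).
{ apply Hck. intros y. eexists. eapply cdif_ext. apply cdif_mult; apply C1. 1: cbv beta; ring. reflexivity. }
assert (HB : exists B, 0 <= B /\ forall y, 0 <= y <= 1 -> Cmod (ck (fun _ => 1%C) y) <= B).
{ destruct (bounded_continuity (fun y => Re (ck (fun _ => 1%C) y)) 0 1) as [B1 HB1].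
  { intros y Hy. destruct (K0 y Hy) as [l Hl].
    exact (rdiff_continuous1 _ _ _ _ _ (rdiff_swap _ _ _ _ _ (cdif_Re _ _ _ _ _ Hl))). }
  destruct (bounded_continuity (fun y => Im (ck (fun _ => 1%C) y)) 0 1) as [B2 HB2].
  { intros y Hy. destruct (K0 y Hy) as [l Hl].
    exact (rdiff_continuous1 _ _ _ _ _ (rdiff_swap _ _ _ _ _ (cdif_Im _ _ _ _ _ Hl))). }
  assert (HH : forall y, 0 <= y <= 1 -> Cmod (ck (fun _ => 1%C) y) <= B1 + B2).
  { intros y Hy. specialize (HB1 y Hy). specialize (HB2 y Hy).
    rewrite (surjective_pairing (ck (fun _ => 1%C) y)).
    eapply Rle_trans. apply Cmod_pair.
    change (Rabs (fst (ck (fun _ => 1%C) y)) < B1) in HB1.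
    change (Rabs (snd (ck (fun _ => 1%C) y)) < B2) in HB2. lra. }
  exists (B1 + B2). split; auto.
  eapply Rle_trans. apply Cmod_ge_0. apply (HH 0). lra. }
destruct HB as [B [HB0 HB]].
exists (circle_int (ck (fun _ => 1%C)) / two_pi_i)%C, (circle_int (ck inv1) / two_pi_i)%C,
  (circle_int (ck (fun y => inv1 y * inv1 y)%C) / two_pi_i)%C.
set (T := Cmod two_pi_i). assert (HT : 0 < T) by (apply (proj1 (Cmod_gt_0 two_pi_i)); exact Htau).
assert (Hr2 : 0 < r * r) by nra.
set (D := 2 * (B * (/ (r * r) * (2 / r))) / T).
assert (H2r : 0 < 2 / r) by (apply Rdiv_lt_0_compat; lra).
assert (HD0 : 0 <= D).
{ unfold D. apply Rdiv_le_0_compat; auto.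
  apply Rmult_le_pos. lra. apply Rmult_le_pos; auto. apply Rmult_le_pos; try lra.
  apply Rlt_le, Rinv_0_lt_compat; auto. }
exists (D + 1). split. lra.
intros h Hh.
assert (Hh0 := Cmod_ge_0 h).
assert (Hhr : Cmod h < r) by lra.
assert (KH := circle_cont_cauchy_kernel h Hhr).
assert (CF := cauchy_formula h Hhr).
set (rem := fun y => (((cauchy_kernel h y + (- (1)) * ck (fun _ => 1) y) + (-h) * ck inv1 y)
   + (- (h * h)) * ck (fun y => inv1 y * inv1 y) y)%C).
assert (clin : forall g1 g2 c, circle_cont g1 -> circle_cont g2 -> circle_cont (fun y => g1 y + c * g2 y)%C).
{ intros g1 g2 c H1 H2 y Hy. destruct (H1 y Hy) as [l1 L1]. destruct (H2 y Hy) as [l2 L2].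
  eexists. eapply cdif_ext. apply cdif_plus. exact L1. apply cdif_mult. apply cdif_const. exact L2.
  1: cbv beta; ring. reflexivity. }
assert (Hrem : circle_int rem = (f h * two_pi_i + - (1) * circle_int (ck (fun _ => 1%C))
   + (- h) * circle_int (ck inv1)
   + (- (h * h)) * circle_int (ck (fun y => inv1 y * inv1 y)%C))%C).
{ unfold rem. do 3 (rewrite circle_int_lin; auto). now rewrite CF. }
assert (Hb : Cmod (circle_int rem) <= 2 * (B * (Cmod h ^ 3 * (/ (r * r) * (2 / r))))).
{ apply circle_int_bound. unfold rem; auto.
  intros y Hy.
  assert (Hne : (r * expi y + - h)%C <> 0%C).
  { intros H. assert (X : (r * expi y)%C = h).
    { replace (r * expi y)%C with ((r * expi y + - h) + h)%C by ring. rewrite H. ring. }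
    apply (f_equal Cmod) in X. rewrite Cmod_mult, Cmod_expi, Cmod_Rpos in X; lra. }
  assert (Hl : r / 2 <= Cmod (r * expi y + - h)%C).
  { assert (X := Cmod_triangle (r * expi y + - h)%C h).
    replace (r * expi y + - h + h)%C with (r * expi y)%C in X by ring.
    rewrite Cmod_mult, Cmod_expi, Cmod_Rpos in X; lra. }
  replace (rem y) with (ck (fun _ => 1%C) y *
     (h * (h * h) * (/ ((RtoC r * expi y) * (RtoC r * expi y)) * / (r * expi y + - h))))%C.
  2:{ unfold rem, ck, inv1, cauchy_kernel. assert (Y := HE y). field. repeat split; auto. }
  rewrite Cmod_mult. apply Rmult_le_compat; auto; try apply Cmod_ge_0.
  rewrite !Cmod_mult, !Cmod_inv, !Cmod_mult, !Cmod_expi, !Cmod_Rpos by (try lra; auto;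
     repeat apply Cmult_neq_0; auto).
  replace (Cmod h * (Cmod h * Cmod h)) with (Cmod h ^ 3) by ring.
  apply Rmult_le_compat_l. apply pow_le; auto.
  rewrite !Rmult_1_r.
  apply Rmult_le_compat_l. apply Rlt_le, Rinv_0_lt_compat; auto.
  replace (2 / r) with (/ (r / 2)) by (field; lra).
  apply Rinv_le_contravar; lra. }
replace (f h - circle_int (ck (fun _ => 1)) / two_pi_i - circle_int (ck inv1) / two_pi_i * h -
   circle_int (ck (fun y : R => inv1 y * inv1 y)) / two_pi_i * (h * h))%C with (circle_int rem * / two_pi_i)%C.
2:{ rewrite Hrem. field. auto. }
rewrite Cmod_mult, Cmod_inv by auto. fold T.
apply Rle_trans with (D * Cmod h ^ 3).
- replace (D * Cmod h ^ 3) with (2 * (B * (Cmod h ^ 3 * (/ (r * r) * (2 / r)))) * / T).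
  apply Rmult_le_compat_r; auto. apply Rlt_le, Rinv_0_lt_compat; auto.
  unfold D. field. split; lra.
- apply Rmult_le_compat_r. apply pow_le; auto. lra.
Qed.
End CauchyFormula.

(** The expansion at 0 is translated to [p]. It shows that its own linear coefficient is the
    derivative of [b], which ties it to the Bloch condition. *)
Lemma holo_taylor2 b p : holo_disc b -> in_disc p ->
  exists d c B delta, 0 < delta /\ 0 < B /\ is_derive b p d /\
   forall h, Cmod h < delta -> Cmod (b (p + h) - b p - d * h - c * (h * h))%C <= B * Cmod h ^ 3.
Proof.
intros Hb Hp. unfold in_disc in Hp.
set (R0 := 1 - Cmod p). assert (HR0 : 0 < R0) by (unfold R0; lra).
destruct (taylor_2_at_0 (fun z => b (p + z)%C) R0 (R0/2) ltac:(lra)) as [c0 [d [c [B [HB HT]]]]].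
{ intros z Hz. destruct (Hb (p + z)%C) as [d Hd].
  { unfold in_disc. eapply Rle_lt_trans. apply Cmod_triangle. unfold R0 in Hz; lra. }
  apply is_derive_cder in Hd. exists d. intros eps He. destruct (Hd eps He) as [r [Hr Hc]].
  exists r; split; auto. intros w Hw. specialize (Hc (p + w)%C).
  replace (p + w - (p + z))%C with (w - z)%C in Hc by ring. auto. }
assert (H0 : c0 = b p).
{ specialize (HT 0%C). rewrite Cmod_0 in HT. specialize (HT ltac:(lra)).
  assert (H := Cmod_ge_0 (b (p + 0) - c0 - d * 0 - c * (0 * 0))%C).
  assert (E : (b (p + 0) - c0 - d * 0 - c * (0 * 0))%C = 0%C).
  { apply Cmod_eq_0. simpl in HT. lra. }
  replace (p + 0)%C with p in E by ring.
  replace c0 with (b p - (b p - c0 - d * 0 - c * (0 * 0)))%C by ring. rewrite E. ring. }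
subst c0.
exists d, c, B, (R0/2/2). split. lra. split; auto. split; auto.
apply is_derive_cder. intros eps He.
assert (Hc := Cmod_ge_0 c).
assert (Hq : 0 < eps / (B + Cmod c + 1)) by (apply Rdiv_lt_0_compat; lra).
exists (Rmin (Rmin 1 (R0/2/2)) (eps / (B + Cmod c + 1))).
split. repeat apply Rmin_pos; lra.
intros w Hw.
assert (M1 := Rmin_l (Rmin 1 (R0/2/2)) (eps / (B + Cmod c + 1))).
assert (M2 := Rmin_r (Rmin 1 (R0/2/2)) (eps / (B + Cmod c + 1))).
assert (M3 := Rmin_l 1 (R0/2/2)). assert (M4 := Rmin_r 1 (R0/2/2)).
specialize (HT (w - p)%C ltac:(lra)).
replace (p + (w - p))%C with w in HT by ring.
replace (b w - b p - d * (w - p))%C with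
 ((b w - b p - d * (w - p) - c * ((w - p) * (w - p))) + c * ((w-p)*(w-p)))%C by ring.
eapply Rle_trans. apply Cmod_triangle. rewrite !Cmod_mult.
assert (Hx := Cmod_ge_0 (w - p)%C). set (x := Cmod (w - p)%C) in *.
assert (B * x^3 <= B * (x * x)). { apply Rmult_le_compat_l. lra. simpl. nra. }
apply Rle_trans with ((B + Cmod c + 1) * x * x). nra.
apply Rmult_le_compat_r; auto.
replace eps with ((B + Cmod c + 1) * (eps / (B + Cmod c + 1))) by (field; lra).
apply Rmult_le_compat_l; lra.
Qed.

(** * Second order jets *)

(** A Peano expansion, [g2] being half of the second derivative. Unlike an iterated derivative it
    concerns one point only, and it passes through products and compositions. *)
Definition jet2 (g : R -> R) (g0 g1 g2 : R) : Prop :=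
  forall eps, 0 < eps -> exists d, 0 < d /\ forall t, Rabs t < d ->
    Rabs (g t - (g0 + g1 * t + g2 * (t * t))) <= eps * (t * t).

Lemma jet2_ext g h g0 g1 g2 h1 h2 : jet2 g g0 g1 g2 -> (forall t, g t = h t) ->
  g1 = h1 -> g2 = h2 -> jet2 h g0 h1 h2.
Proof.
intros H E <- <- eps He. destruct (H eps He) as [d [Hd Hc]]. exists d; split; auto.
intros t Ht. rewrite <- E. auto.
Qed.

Lemma jet2_cubic g g0 g1 g2 B d : 0 < d -> 0 < B -> (forall t, Rabs t < d ->
  Rabs (g t - (g0 + g1 * t + g2 * (t * t))) <= B * Rabs t ^ 3) -> jet2 g g0 g1 g2.
Proof.
intros Hd HB H eps He.
assert (Hq : 0 < eps / B) by (apply Rdiv_lt_0_compat; lra).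
exists (Rmin d (eps / B)). split. now apply Rmin_pos.
intros t Ht. assert (M1 := Rmin_l d (eps / B)). assert (M2 := Rmin_r d (eps / B)).
eapply Rle_trans. apply H. lra.
assert (Ha := Rabs_pos t).
replace (t * t) with (Rabs t * Rabs t) by (rewrite <- Rabs_mult; apply Rabs_pos_eq; nra).
replace (B * Rabs t ^ 3) with ((B * Rabs t) * (Rabs t * Rabs t)) by ring.
apply Rmult_le_compat_r. nra.
replace eps with (B * (eps / B)) by (field; lra). apply Rmult_le_compat_l; lra.
Qed.

Lemma jet2_quadratic g g0 g1 g2 : (forall t, g t = g0 + g1 * t + g2 * (t * t)) ->
  jet2 g g0 g1 g2.
Proof.
intros H. apply jet2_cubic with 1 1; try lra. intros t _. rewrite H, Rminus_diag, Rabs_R0.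
apply Rmult_le_pos. lra. apply pow_le, Rabs_pos.
Qed.

Lemma jet2_lipschitz g g0 g1 g2 : jet2 g g0 g1 g2 -> exists k d, 0 < k /\ 0 < d /\
  forall t, Rabs t < d -> Rabs (g t - g0) <= k * Rabs t.
Proof.
intros H. destruct (H 1 Rlt_0_1) as [d [Hd Hc]].
exists (1 + Rabs g1 + Rabs g2), (Rmin 1 d).
assert (H1 := Rabs_pos g1). assert (H2 := Rabs_pos g2).
split. lra. split. apply Rmin_pos; lra.
intros t Ht. assert (M1 := Rmin_l 1 d). assert (M2 := Rmin_r 1 d).
specialize (Hc t ltac:(lra)).
replace (g t - g0) with ((g t - (g0 + g1 * t + g2 * (t*t))) + (g1 * t + g2 * (t * t))) by ring.
assert (Ha := Rabs_pos t).
assert (Ht2 : t * t = Rabs t * Rabs t) by (rewrite <- Rabs_mult; symmetry; apply Rabs_pos_eq; nra).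
eapply Rle_trans. apply Rabs_triang.
eapply Rle_trans. apply Rplus_le_compat_l. apply Rabs_triang.
rewrite !Rabs_mult. replace (1 * (t * t)) with (Rabs t * Rabs t) in Hc by lra.
assert (Rabs t * Rabs t <= Rabs t) by nra.
assert (Rabs g2 * (Rabs t * Rabs t) <= Rabs g2 * Rabs t) by (apply Rmult_le_compat_l; lra).
lra.
Qed.

Lemma jet2_comp F g g0 g1 g2 F0 F1 F2 : jet2 g g0 g1 g2 ->
  jet2 (fun s => F (g0 + s)) F0 F1 F2 ->
  jet2 (fun t => F (g t)) F0 (F1 * g1) (F1 * g2 + F2 * (g1 * g1)).
Proof.
intros Hg HF eps He.
destruct (jet2_lipschitz _ _ _ _ Hg) as [k [d0 [Hk [Hd0 HL]]]].
assert (A1 := Rabs_pos F1). assert (A2 := Rabs_pos F2). assert (A3 := Rabs_pos g1).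
set (m := Rabs F1 + Rabs F2 * (k + Rabs g1 + Rabs g2 + 1) + 1).
assert (A4 := Rabs_pos g2).
assert (Hm : 0 < m).
{ assert (0 <= Rabs F2 * (k + Rabs g1 + Rabs g2 + 1)) by (apply Rmult_le_pos; lra).
  unfold m; lra. }
assert (Hq1 : 0 < eps / (2 * m)) by (apply Rdiv_lt_0_compat; lra).
assert (Hq2 : 0 < eps / (2 * (k * k))) by (apply Rdiv_lt_0_compat; nra).
destruct (Hg (Rmin 1 (eps / (2*m))) ltac:(apply Rmin_pos; lra)) as [d1 [Hd1 Hg']].
destruct (HF _ Hq2) as [d2 [Hd2 HF']].
assert (Hq3 : 0 < d2 / k) by (apply Rdiv_lt_0_compat; lra).
assert (Hq4 : 0 < eps / (2 * m * (Rabs g2 + 1))) by (apply Rdiv_lt_0_compat; nra).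
set (d := Rmin (Rmin (Rmin d0 d1) (Rmin 1 (d2 / k))) (eps / (2 * m * (Rabs g2 + 1)))).
exists d. split. unfold d; repeat apply Rmin_pos; lra.
intros t Ht.
assert (M1 := Rmin_l (Rmin (Rmin d0 d1) (Rmin 1 (d2 / k))) (eps / (2 * m * (Rabs g2 + 1)))).
assert (M2 := Rmin_r (Rmin (Rmin d0 d1) (Rmin 1 (d2 / k))) (eps / (2 * m * (Rabs g2 + 1)))).
fold d in M1, M2.
assert (M3 := Rmin_l (Rmin d0 d1) (Rmin 1 (d2 / k))).
assert (M4 := Rmin_r (Rmin d0 d1) (Rmin 1 (d2 / k))).
assert (M5 := Rmin_l d0 d1). assert (M6 := Rmin_r d0 d1).
assert (M7 := Rmin_l 1 (d2/k)). assert (M8 := Rmin_r 1 (d2/k)).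
specialize (HL t ltac:(lra)). specialize (Hg' t ltac:(lra)).
set (s := g t - g0) in *. set (x := Rabs t) in *.
assert (Hx : 0 <= x) by apply Rabs_pos.
assert (Hs : Rabs s < d2).
{ eapply Rle_lt_trans. exact HL. replace d2 with (k * (d2 / k)) by (field; lra).
  apply Rmult_lt_compat_l; lra. }
specialize (HF' s Hs). replace (g0 + s) with (g t) in HF' by (unfold s; ring).
assert (Ht2 : t * t = x * x) by (unfold x; rewrite <- Rabs_mult; symmetry; apply Rabs_pos_eq; nra).
assert (Hs2 : s * s <= k * k * (x * x)).
{ replace (s * s) with (Rabs s * Rabs s) by (rewrite <- Rabs_mult; apply Rabs_pos_eq; nra).
  replace (k * k * (x * x)) with ((k * x) * (k * x)) by ring.
  apply Rmult_le_compat; auto; apply Rabs_pos. }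
assert (E1 : eps / (2 * (k * k)) * (s * s) <= eps / 2 * (x * x)).
{ replace (eps / 2 * (x * x)) with (eps / (2 * (k * k)) * (k * k * (x * x))) by (field; lra).
  apply Rmult_le_compat_l; lra. }
set (r := g t - (g0 + g1 * t + g2 * (t * t))) in *.
assert (Er : Rabs r <= eps / (2*m) * (x * x)).
{ rewrite Ht2 in Hg'. eapply Rle_trans. exact Hg'. apply Rmult_le_compat_r. nra. apply Rmin_r. }
(* Three errors: the outer remainder at [s], the inner remainder [r] times [F1], and the defect
   [s^2 - (g1 t)^2], factored because [s - g1 t] is quadratic in [t]. *)
replace (F (g t) - (F0 + F1 * g1 * t + (F1 * g2 + F2 * (g1 * g1)) * (t * t))) with
  ((F (g t) - (F0 + F1 * s + F2 * (s * s))) + (F1 * r + F2 * ((s + g1 * t) * (s - g1 * t))))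
  by (unfold s, r; ring).
eapply Rle_trans. apply Rabs_triang.
eapply Rle_trans. apply Rplus_le_compat_l. apply Rabs_triang.
rewrite !Rabs_mult.
assert (Esp : Rabs (s + g1 * t) <= (k + Rabs g1) * x).
{ eapply Rle_trans. apply Rabs_triang. rewrite Rabs_mult. fold x. lra. }
assert (Esm : Rabs (s - g1 * t) <= (Rabs g2 + 1) * (x * x)).
{ replace (s - g1 * t) with (r + g2 * (t * t)) by (unfold s, r; ring).
  eapply Rle_trans. apply Rabs_triang. rewrite Rabs_mult.
  rewrite (Rabs_pos_eq (t*t)) by nra. rewrite Ht2 in *.
  assert (Rmin 1 (eps / (2 * m)) * (x * x) <= 1 * (x * x)).
  { apply Rmult_le_compat_r. nra. apply Rmin_l. } lra. }
assert (E2 : Rabs (s + g1 * t) * Rabs (s - g1 * t) <= (k + Rabs g1) * (eps / (2 * m)) * (x * x)).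
{ apply Rle_trans with ((k + Rabs g1) * x * ((Rabs g2 + 1) * (x * x))).
  apply Rmult_le_compat; auto; apply Rabs_pos.
  replace ((k + Rabs g1) * x * ((Rabs g2 + 1) * (x * x))) with
   ((k + Rabs g1) * ((Rabs g2 + 1) * x) * (x * x)) by ring.
  apply Rmult_le_compat_r. nra. apply Rmult_le_compat_l. lra.
  replace (eps / (2*m)) with ((Rabs g2 + 1) * (eps / (2 * m * (Rabs g2 + 1)))) by (field; lra).
  apply Rmult_le_compat_l; lra. }
assert (E3 : Rabs F2 * (Rabs (s + g1 * t) * Rabs (s - g1 * t)) <=
  Rabs F2 * ((k + Rabs g1) * (eps / (2 * m)) * (x * x))) by (apply Rmult_le_compat_l; auto).
assert (E4 : Rabs F1 * Rabs r <= Rabs F1 * (eps / (2*m) * (x * x))) by (apply Rmult_le_compat_l; auto).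
assert (E5 : (Rabs F1 + Rabs F2 * (k + Rabs g1)) * (eps / (2*m) * (x * x)) <= m * (eps / (2*m) * (x * x))).
{ apply Rmult_le_compat_r. apply Rmult_le_pos; nra. unfold m.
  assert (0 <= Rabs F2 * (Rabs g2 + 1)) by (apply Rmult_le_pos; lra). lra. }
replace (m * (eps / (2*m) * (x * x))) with (eps / 2 * (x * x)) in E5 by (field; lra).
rewrite Ht2. lra.
Qed.

Lemma jet2_lin f g f0 f1 f2 g0 g1 g2 a b : jet2 f f0 f1 f2 -> jet2 g g0 g1 g2 ->
  jet2 (fun t => a * f t + b * g t) (a * f0 + b * g0) (a * f1 + b * g1) (a * f2 + b * g2).
Proof.
intros Hf Hg eps He.
assert (A1 := Rabs_pos a). assert (A2 := Rabs_pos b).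
assert (Hq : 0 < eps / (Rabs a + Rabs b + 1)) by (apply Rdiv_lt_0_compat; lra).
destruct (Hf _ Hq) as [d1 [Hd1 Hf']]. destruct (Hg _ Hq) as [d2 [Hd2 Hg']].
exists (Rmin d1 d2). split. now apply Rmin_pos.
intros t Ht. assert (M1 := Rmin_l d1 d2). assert (M2 := Rmin_r d1 d2).
specialize (Hf' t ltac:(lra)). specialize (Hg' t ltac:(lra)).
match goal with |- Rabs ?X <= _ => replace X with
 (a * (f t - (f0 + f1 * t + f2 * (t * t))) + b * (g t - (g0 + g1 * t + g2 * (t * t)))) by ring end.
eapply Rle_trans. apply Rabs_triang. rewrite !Rabs_mult.
set (q := eps / (Rabs a + Rabs b + 1)) in *.
assert (E : eps = q * (Rabs a + Rabs b + 1)) by (unfold q; field; lra).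
assert (0 <= t * t) by nra.
apply (Rmult_le_compat_l _ _ _ A1) in Hf'. apply (Rmult_le_compat_l _ _ _ A2) in Hg'.
assert (0 <= q * (t * t)) by nra.
rewrite E. nra.
Qed.

(** The mean value theorem is applied to the remainder, whose derivative at [s] is
    [F' (x + s) - F' x - F2 * s], small against [s] by differentiability of [F'] at [x]. *)
Lemma jet2_twice_derivable (F F' : R -> R) (x F2 d : R) : 0 < d ->
  (forall y, Rabs (y - x) < d -> is_derive F y (F' y)) -> is_derive F' x F2 ->
  jet2 (fun s => F (x + s)) (F x) (F' x) (F2 / 2).
Proof.
intros Hd H1 H2 eps He.
destruct (is_derive_eps _ _ _ H2 eps He) as [d1 [Hd1 HF']].
exists (Rmin d d1). split. now apply Rmin_pos.
intros t Ht. assert (M1 := Rmin_l d d1). assert (M2 := Rmin_r d d1).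
assert (D : forall s, Rmin 0 t <= s <= Rmax 0 t -> is_derive (fun s => F (x + s)) s (F' (x + s))).
{ intros s Hs. assert (Rabs s < d).
  { unfold Rmin, Rmax in Hs. apply Rabs_lt_between in Ht.
    apply Rabs_lt_between. destruct (Rle_dec 0 t); lra. }
  assert (D := H1 (x + s)). replace (x + s - x) with s in D by ring. specialize (D H).
  rewrite <- (Rmult_1_l (F' (x + s))).
  apply (is_derive_comp F (fun s => x + s) s (F' (x + s)) 1 D).
  auto_derive; auto. }
assert (D2 : forall s, Rmin 0 t <= s <= Rmax 0 t ->
  is_derive (fun s => F (x + s) - (F x + F' x * s + F2 / 2 * (s * s))) s
    (F' (x + s) - (F' x + F2 * s))).
{ intros s Hs. apply (@is_derive_minus R_AbsRing R_NormedModule). now apply D.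
  auto_derive; auto. field. }
destruct (MVT_gen (fun s => F (x + s) - (F x + F' x * s + F2 / 2 * (s * s))) 0 t
  (fun s => F' (x + s) - (F' x + F2 * s))) as [c [Hc E]].
- intros s Hs. apply D2; lra.
- intros s Hs. apply derivable_continuous_pt. eexists. apply is_derive_Reals. now apply D2.
- cbv beta in E. rewrite Rplus_0_r in E.
  replace (F (x + t) - (F x + F' x * t + F2 / 2 * (t * t))) with
   ((F' (x + c) - (F' x + F2 * c)) * (t - 0)) by (rewrite <- E; ring).
  rewrite Rminus_0_r, Rabs_mult.
  assert (Hct : Rabs c <= Rabs t).
  { unfold Rmin, Rmax in Hc. apply Rabs_le_between.
    destruct (Rle_dec 0 t); unfold Rabs; destruct (Rcase_abs t); lra. }
  specialize (HF' (x + c)). replace (x + c - x) with c in HF' by ring.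
  specialize (HF' ltac:(lra)).
  replace (F' (x + c) - (F' x + F2 * c)) with (F' (x + c) - F' x - F2 * c) by ring.
  assert (Ha := Rabs_pos t). assert (Hb := Rabs_pos c).
  replace (t * t) with (Rabs t * Rabs t) by (rewrite <- Rabs_mult; apply Rabs_pos_eq; nra).
  rewrite <- Rmult_assoc. apply Rmult_le_compat_r; auto.
  eapply Rle_trans. exact HF'. apply Rmult_le_compat_l; lra.
Qed.

Lemma jet2_exp x : jet2 (fun s => exp (x + s)) (exp x) (exp x) (exp x / 2).
Proof.
apply (jet2_twice_derivable exp exp x (exp x) 1). lra.
intros; apply is_derive_exp. apply is_derive_exp.
Qed.

Lemma jet2_inv x : 0 < x -> jet2 (fun s => / (x + s)) (/ x) (- / (x * x)) (/ (x * x * x)).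
Proof.
intros Hx.
eapply jet2_ext.
apply (jet2_twice_derivable Rinv (fun y => - / (y * y)) x (2 / (x * x * x)) x Hx).
- intros y Hy. apply Rabs_lt_between in Hy. auto_derive. lra. field. lra.
- auto_derive. nra. field. lra.
- reflexivity.
- reflexivity.
- field. lra.
Qed.

Lemma jet2_ln x : 0 < x -> jet2 (fun s => ln (x + s)) (ln x) (/ x) (- / (2 * (x * x))).
Proof.
intros Hx.
eapply jet2_ext.
apply (jet2_twice_derivable ln (fun y => / y) x (- / (x * x)) x Hx).
- intros y Hy. apply Rabs_lt_between in Hy. auto_derive. lra. field. lra.
- auto_derive. lra. field. lra.
- reflexivity.
- reflexivity.
- field. lra.
Qed.

(** Polarization, [4 f g = (f + g)^2 - (f - g)^2], reduces products to linear combinations and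
    composition with the square. *)
Lemma jet2_mult f g f0 f1 f2 g0 g1 g2 : jet2 f f0 f1 f2 -> jet2 g g0 g1 g2 ->
  jet2 (fun t => f t * g t) (f0 * g0) (f0 * g1 + g0 * f1) (f0 * g2 + g0 * f2 + f1 * g1).
Proof.
intros Hf Hg.
assert (Sq : forall x, jet2 (fun s => (x + s) * (x + s)) (x * x) (2 * x) 1).
{ intros x. apply jet2_quadratic. intros t. ring. }
assert (P := jet2_lin _ _ _ _ _ _ _ _ 1 1 Hf Hg).
assert (M := jet2_lin _ _ _ _ _ _ _ _ 1 (-1) Hf Hg).
assert (P2 := jet2_comp (fun x => x * x) _ _ _ _ _ _ _ P (Sq _)).
assert (M2 := jet2_comp (fun x => x * x) _ _ _ _ _ _ _ M (Sq _)).
assert (L := jet2_lin _ _ _ _ _ _ _ _ (1/4) (-1/4) P2 M2).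
assert (E : 1/4 * ((1 * f0 + 1 * g0) * (1 * f0 + 1 * g0)) +
   -1/4 * ((1 * f0 + -1 * g0) * (1 * f0 + -1 * g0)) = f0 * g0) by field.
rewrite E in L.
eapply jet2_ext. exact L. intros t; simpl; field. field. field.
Qed.

Lemma jet2_continuous F x F1 F2 : jet2 (fun s => F (x + s)) (F x) F1 F2 -> continuous F x.
Proof.
intros H. apply continuous_eps_delta. intros eps He.
destruct (jet2_lipschitz _ _ _ _ H) as [k [d [Hk [Hd HL]]]].
assert (Hq : 0 < eps / k) by (apply Rdiv_lt_0_compat; lra).
exists (Rmin d (eps / k)). split. now apply Rmin_pos.
intros u Hu. assert (M1 := Rmin_l d (eps / k)). assert (M2 := Rmin_r d (eps / k)).
specialize (HL (u - x) ltac:(lra)). replace (x + (u - x)) with u in HL by ring.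
eapply Rle_lt_trans. exact HL. replace eps with (k * (eps / k)) by (field; lra).
apply Rmult_lt_compat_l; lra.
Qed.

(* [(a, a')] is the gradient of [f] at [p], and [l] half of its Laplacian. *)
Definition lap (f : C -> R) (p : C) (a a' l : R) : Prop :=
  continuous f p /\ exists c c',
  jet2 (fun t => f (fst p + t, snd p)) (f p) a c /\
  jet2 (fun t => f (fst p, snd p + t)) (f p) a' c' /\ l = c + c'.

Lemma lap_ext f g p a a' l b b' m : lap f p a a' l -> (forall z, f z = g z) ->
  a = b -> a' = b' -> l = m -> lap g p b b' m.
Proof.
intros [H0 [c [c' [H1 [H2 E]]]]] H <- <- <-. split.
- apply continuous_ext with f; auto.
- exists c, c'. rewrite <- H. split; [|split]; auto.
  apply (jet2_ext _ _ _ _ _ _ _ H1); auto.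
  apply (jet2_ext _ _ _ _ _ _ _ H2); auto.
Qed.

Lemma lap_const k p : lap (fun _ => k) p 0 0 0.
Proof.
split. apply continuous_const.
exists 0, 0. repeat split. 3: ring. all: apply jet2_quadratic; intros; ring.
Qed.

Lemma lap_fst p : lap (fun z => fst z) p 1 0 0.
Proof.
split. apply continuous_fst.
exists 0, 0. repeat split. 3: ring. all: apply jet2_quadratic; intros; simpl; ring.
Qed.

Lemma lap_snd p : lap (fun z => snd z) p 0 1 0.
Proof.
split. apply continuous_snd.
exists 0, 0. repeat split. 3: ring. all: apply jet2_quadratic; intros; simpl; ring.
Qed.

Lemma lap_lin f g p a a' l b b' m x y : lap f p a a' l -> lap g p b b' m ->
  lap (fun z => x * f z + y * g z) p (x * a + y * b) (x * a' + y * b') (x * l + y * m).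
Proof.
intros [F0 [c [c' [F1 [F2 ->]]]]] [G0 [d [d' [G1 [G2 ->]]]]]. split.
- apply (continuous_plus (fun z => x * f z) (fun z => y * g z));
   apply (@continuous_scal_r C_UniformSpace R_AbsRing R_NormedModule); auto.
- exists (x * c + y * d), (x * c' + y * d'). split; [|split].
  now apply (jet2_lin (fun t => f (fst p + t, snd p))).
  now apply (jet2_lin (fun t => f (fst p, snd p + t))).
  ring.
Qed.

Lemma lap_plus f g p a a' l b b' m : lap f p a a' l -> lap g p b b' m ->
  lap (fun z => f z + g z) p (a + b) (a' + b') (l + m).
Proof.
intros F G. eapply lap_ext. apply (lap_lin _ _ _ _ _ _ _ _ _ 1 1 F G).
intros; simpl; ring. all: ring.
Qed.

Lemma lap_scal f p a a' l x : lap f p a a' l ->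
  lap (fun z => x * f z) p (x * a) (x * a') (x * l).
Proof.
intros F. eapply lap_ext. apply (lap_lin _ _ _ _ _ _ _ _ _ x 0 F (lap_const 0 p)).
intros; simpl; ring. all: ring.
Qed.

Lemma lap_mult f g p a a' l b b' m : lap f p a a' l -> lap g p b b' m ->
  lap (fun z => f z * g z) p (f p * b + g p * a) (f p * b' + g p * a')
    (f p * m + g p * l + (a * b + a' * b')).
Proof.
intros [F0 [c [c' [F1 [F2 ->]]]]] [G0 [d [d' [G1 [G2 ->]]]]]. split.
- now apply (@continuous_mult C_UniformSpace R_AbsRing f g).
- exists (f p * d + g p * c + a * b), (f p * d' + g p * c' + a' * b'). split; [|split].
  now apply (jet2_mult (fun t => f (fst p + t, snd p))).
  now apply (jet2_mult (fun t => f (fst p, snd p + t))).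
  ring.
Qed.

Lemma lap_comp F f p a a' l F1 F2 : lap f p a a' l ->
  jet2 (fun s => F (f p + s)) (F (f p)) F1 F2 ->
  lap (fun z => F (f z)) p (F1 * a) (F1 * a') (F1 * l + F2 * (a * a + a' * a')).
Proof.
intros [H0 [c [c' [H1 [H2 ->]]]]] HF. split.
- apply (continuous_comp f F); auto. eapply jet2_continuous; eauto.
- exists (F1 * c + F2 * (a * a)), (F1 * c' + F2 * (a' * a')). split; [|split].
  now apply (jet2_comp F (fun t => f (fst p + t, snd p)) (f p)).
  now apply (jet2_comp F (fun t => f (fst p, snd p + t)) (f p)).
  ring.
Qed.

Lemma lap_sum (f : nat -> C -> R) p (a a' l : nat -> R) N :
  (forall n, lap (f n) p (a n) (a' n) (l n)) ->
  lap (fun z => sum_f_R0 (fun n => f n z) N) p (sum_f_R0 a N) (sum_f_R0 a' N) (sum_f_R0 l N).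
Proof.
intros H. induction N as [|N IH]; simpl. apply H. now apply lap_plus.
Qed.

(** Adding the inequalities at the four points at distance [t] on the two axes cancels the first
    order terms; if [l > 0], a tolerance [l/4] on each axis leaves a positive multiple of [t^2]. *)
Lemma lap_max f p a a' l d : lap f p a a' l -> 0 < d ->
  (forall z, Cmod (z - p)%C < d -> f z <= f p) -> l <= 0.
Proof.
intros [_ [c [c' [H1 [H2 ->]]]]] Hd Hm.
apply Rnot_lt_le. intros Hl.
destruct (H1 ((c + c')/4) ltac:(lra)) as [d1 [Hd1 J1]].
destruct (H2 ((c + c')/4) ltac:(lra)) as [d2 [Hd2 J2]].
set (t := Rmin d (Rmin d1 d2) / 2).
assert (Hmin : 0 < Rmin d (Rmin d1 d2)) by (repeat apply Rmin_pos; auto).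
assert (M1 := Rmin_l d (Rmin d1 d2)). assert (M2 := Rmin_r d (Rmin d1 d2)).
assert (M3 := Rmin_l d1 d2). assert (M4 := Rmin_r d1 d2).
assert (Ht : 0 < t) by (unfold t; lra).
assert (Hbnd : forall s, s = t \/ s = - t -> Rabs s < d /\ Rabs s < d1 /\ Rabs s < d2 /\ s * s = t * t).
{ intros s [-> | ->]; rewrite ?Rabs_Ropp, Rabs_pos_eq by lra; unfold t; repeat split; try lra. }
assert (K : forall s, s = t \/ s = - t ->
  a * s + a' * s + (c + c') / 2 * (t * t) <= 0).
{ intros s Hs. destruct (Hbnd s Hs) as [B1 [B2 [B3 B4]]].
  specialize (J1 s B2). specialize (J2 s B3).
  apply Rabs_le_between in J1. apply Rabs_le_between in J2.
  assert (N1 := Hm (fst p + s, snd p)). assert (N2 := Hm (fst p, snd p + s)).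
  replace (Cminus (fst p + s, snd p) p) with (RtoC s) in N1.
  2:{ destruct p; unfold RtoC, Cminus, Cplus, Copp; simpl. f_equal; ring. }
  replace (Cminus (fst p, snd p + s) p) with (RtoC s * Ci)%C in N2.
  2:{ destruct p; unfold RtoC, Ci, Cmult, Cminus, Cplus, Copp; simpl. f_equal; ring. }
  rewrite Cmod_mult, Cmod_Ci, Rmult_1_r in N2. rewrite Cmod_R in N1, N2.
  specialize (N1 B1). specialize (N2 B1). rewrite B4 in *. lra. }
assert (K1 := K t (or_introl eq_refl)). assert (K2 := K (- t) (or_intror eq_refl)).
assert (0 < (c + c') / 2 * (t * t)) by (apply Rmult_lt_0_compat; nra).
lra.
Qed.

(** * Pseudo-hyperbolic geometry *)

(** This is [1 - rho^2], written as a rational function of the coordinates so that its jets can be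
    computed. *)
Definition hs (z w : C) : R :=
  (1 - Cmod z ^ 2) * (1 - Cmod w ^ 2) / Cmod (1 - Cconj w * z)%C ^ 2.

Lemma Cmod_sqr (z : C) : Cmod z ^ 2 = fst z ^ 2 + snd z ^ 2.
Proof. apply Cmod2_alt. Qed.

Lemma Cmod_disc_kernel_sqr (z w : C) : Cmod (1 - Cconj w * z)%C ^ 2 =
  (1 - fst w * fst z - snd w * snd z) ^ 2 + (fst w * snd z - snd w * fst z) ^ 2.
Proof. rewrite Cmod_sqr. unfold Cconj; simpl. ring. Qed.

Lemma disc_kernel_pos (z w : C) : in_disc z -> in_disc w -> 0 < Cmod (1 - Cconj w * z)%C.
Proof.
unfold in_disc. intros Hz Hw.
assert (T := Cmod_triangle (1 - Cconj w * z)%C (Cconj w * z)%C).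
replace (1 - Cconj w * z + Cconj w * z)%C with (RtoC 1) in T by ring.
rewrite Cmod_1, Cmod_mult, Cmod_conj in T.
assert (A := Cmod_ge_0 z). assert (B := Cmod_ge_0 w). nra.
Qed.

Lemma disc_pos z : in_disc z -> 0 < 1 - Cmod z ^ 2.
Proof. unfold in_disc. intros H. assert (A := Cmod_ge_0 z). nra. Qed.

Lemma disc_kernel_identity z w : Cmod (1 - Cconj w * z)%C ^ 2 - (1 - Cmod z ^ 2) * (1 - Cmod w ^ 2)
  = Cmod (w - z)%C ^ 2.
Proof. rewrite Cmod_disc_kernel_sqr, !Cmod_sqr. simpl. ring. Qed.

Lemma hs_rho z w : in_disc z -> in_disc w -> 1 - rho z w ^ 2 = hs z w.
Proof.
intros Hz Hw. assert (K := disc_kernel_pos z w Hz Hw).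
unfold rho, hs. rewrite Cmod_div by (apply (proj2 (Cmod_gt_0 _)); exact K).
assert (I := disc_kernel_identity z w). set (D := Cmod (1 - Cconj w * z)%C) in *.
replace ((Cmod (w - z) / D) ^ 2) with (Cmod (w - z) ^ 2 / D ^ 2) by (field; lra).
rewrite <- I. field. lra.
Qed.

Lemma hs_pos z w : in_disc z -> in_disc w -> 0 < hs z w.
Proof.
intros Hz Hw. unfold hs. apply Rdiv_lt_0_compat.
apply Rmult_lt_0_compat; now apply disc_pos. apply pow_lt. now apply disc_kernel_pos.
Qed.

Lemma hs_le_1 z w : in_disc z -> in_disc w -> hs z w <= 1.
Proof. intros Hz Hw. rewrite <- hs_rho by auto. assert (A := pow2_ge_0 (rho z w)). lra. Qed.

Lemma hs_sym z w : hs z w = hs w z.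
Proof. unfold hs. rewrite !Cmod_disc_kernel_sqr. f_equal; ring. Qed.

Lemma hs_refl z : in_disc z -> hs z z = 1.
Proof.
intros Hz. rewrite <- hs_rho by auto. unfold rho.
replace ((z - z) / (1 - Cconj z * z))%C with (RtoC 0).
rewrite Cmod_0. ring.
unfold Cdiv. replace (z - z)%C with (RtoC 0) by ring. ring.
Qed.

(** A triangle inequality for [- ln hs] up to the constant [ln 4]. It rests on [(1 - |w|^2)(1 - a'
    z) = (1 - w' z)(1 - a' w) - (a' - w')(z - w)], primes denoting conjugates, and on
    [|z - w| <= |1 - w' z|], [|a - w| <= |1 - a' w|]. *)
Lemma hs_triangle z w a : in_disc z -> in_disc w -> in_disc a ->
  hs z w * hs w a <= 4 * hs z a.
Proof.
intros Hz Hw Ha.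
assert (K1 := disc_kernel_pos z w Hz Hw). assert (K2 := disc_kernel_pos w a Hw Ha).
assert (K3 := disc_kernel_pos z a Hz Ha).
assert (D1 := disc_pos z Hz). assert (D2 := disc_pos w Hw). assert (D3 := disc_pos a Ha).
assert (I1 := disc_kernel_identity z w). assert (I2 := disc_kernel_identity w a).
assert (C1 := Cmod_ge_0 (w - z)%C). assert (C2 := Cmod_ge_0 (a - w)%C).
set (k1 := Cmod (1 - Cconj w * z)%C) in *. set (k2 := Cmod (1 - Cconj a * w)%C) in *.
assert (L1 : Cmod (w - z)%C <= k1). { nra. }
assert (L2 : Cmod (a - w)%C <= k2) by nra.
assert (Key : (1 - Cmod w ^ 2) * Cmod (1 - Cconj a * z)%C <= 2 * (k1 * k2)).
{ replace ((1 - Cmod w ^ 2) * Cmod (1 - Cconj a * z)%C) with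
   (Cmod (RtoC (1 - Cmod w ^ 2) * (1 - Cconj a * z))%C).
  2:{ rewrite Cmod_mult, Cmod_Rpos; lra. }
  replace (RtoC (1 - Cmod w ^ 2) * (1 - Cconj a * z))%C with
    ((1 - Cconj w * z) * (1 - Cconj a * w) + - (Cconj (a - w) * (z - w)))%C.
  2:{ rewrite RtoC_minus, Cmod2_conj, Cminus_conj. ring. }
  eapply Rle_trans. apply Cmod_triangle. rewrite Cmod_opp, !Cmod_mult, Cmod_conj.
  fold k1 k2. replace (z - w)%C with (- (w - z))%C by ring. rewrite Cmod_opp. nra. }
unfold hs. fold k1 k2. set (k3 := Cmod (1 - Cconj a * z)%C) in *.
set (X := 1 - Cmod z ^ 2) in *. set (Y := 1 - Cmod w ^ 2) in *. set (Z := 1 - Cmod a ^ 2) in *.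
replace (X * Y / k1 ^ 2 * (Y * Z / k2 ^ 2)) with
  ((X * Z / (k1 ^ 2 * k2 ^ 2 * k3 ^ 2)) * ((Y * k3) ^ 2)) by (field; repeat split; lra).
replace (4 * (X * Z / k3 ^ 2)) with ((X * Z / (k1 ^ 2 * k2 ^ 2 * k3 ^ 2)) * ((2 * (k1 * k2)) ^ 2))
  by (field; repeat split; lra).
apply Rmult_le_compat_l.
- apply Rlt_le, Rdiv_lt_0_compat. now apply Rmult_lt_0_compat.
  apply Rmult_lt_0_compat; [apply Rmult_lt_0_compat|]; now apply pow_lt.
- apply pow_incr. split; auto. apply Rlt_le, Rmult_lt_0_compat; auto.
Qed.

Lemma lap_norm_sqr p : lap (fun z => 1 - Cmod z ^ 2) p (- 2 * fst p) (- 2 * snd p) (-2).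
Proof.
assert (F := lap_mult _ _ _ _ _ _ _ _ _ (lap_fst p) (lap_fst p)).
assert (S := lap_mult _ _ _ _ _ _ _ _ _ (lap_snd p) (lap_snd p)).
eapply lap_ext.
apply (lap_plus _ _ _ _ _ _ _ _ _ (lap_const 1 p)
  (lap_lin _ _ _ _ _ _ _ _ _ (-1) (-1) F S)).
intros z. rewrite Cmod_sqr. ring.
all: simpl; ring.
Qed.

Lemma lap_disc_kernel_sqr p w : lap (fun z => Cmod (1 - Cconj w * z)%C ^ 2) p
  (- 2 * fst w * (1 - fst w * fst p - snd w * snd p) - 2 * snd w * (fst w * snd p - snd w * fst p))
  (- 2 * snd w * (1 - fst w * fst p - snd w * snd p) + 2 * fst w * (fst w * snd p - snd w * fst p))
  (2 * (fst w ^ 2 + snd w ^ 2)).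
Proof.
assert (A := lap_plus _ _ _ _ _ _ _ _ _ (lap_const 1 p)
  (lap_lin _ _ _ _ _ _ _ _ _ (- fst w) (- snd w) (lap_fst p) (lap_snd p))).
assert (B := lap_lin _ _ _ _ _ _ _ _ _ (- snd w) (fst w) (lap_fst p) (lap_snd p)).
eapply lap_ext.
apply (lap_plus _ _ _ _ _ _ _ _ _ (lap_mult _ _ _ _ _ _ _ _ _ A A)
   (lap_mult _ _ _ _ _ _ _ _ _ B B)).
intros z. rewrite Cmod_disc_kernel_sqr. ring.
all: simpl; ring.
Qed.

(** From these two identities [ln hs] has half Laplacian [-2/(1 - |p|^2)^2], and [s/2 + s^2/4] with
    [s = hs] has half Laplacian [-2 s^3/(1 - |p|^2)^2]. *)
Lemma lap_hs p w : in_disc p -> in_disc w -> exists a a',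
  lap (fun z => hs z w) p a a' (- 2 * hs p w ^ 2 / (1 - Cmod p ^ 2) ^ 2) /\
  a * a + a' * a' = 4 * (1 - hs p w) * hs p w ^ 2 / (1 - Cmod p ^ 2) ^ 2.
Proof.
intros Hp Hw.
assert (K := disc_kernel_pos p w Hp Hw). assert (X := disc_pos p Hp).
assert (K2 : 0 < Cmod (1 - Cconj w * p)%C ^ 2) by now apply pow_lt.
assert (L := lap_mult _ _ _ _ _ _ _ _ _
  (lap_scal _ _ _ _ _ (1 - Cmod w ^ 2) (lap_norm_sqr p))
  (lap_comp Rinv _ _ _ _ _ _ _ (lap_disc_kernel_sqr p w) (jet2_inv _ K2))).
do 2 eexists. split.
- eapply lap_ext. exact L.
  intros z. unfold hs, Rdiv. simpl. ring. reflexivity. reflexivity.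
  unfold hs. rewrite Cmod_disc_kernel_sqr in *. rewrite !Cmod_sqr in *.
  destruct p as [x y], w as [u v]; simpl fst in *; simpl snd in *. field. lra.
- unfold hs. rewrite Cmod_disc_kernel_sqr in *. rewrite !Cmod_sqr in *.
  destruct p as [x y], w as [u v]; simpl fst in *; simpl snd in *. field. lra.
Qed.

(** The uniform structure of [C] is that of boxes, while the estimates use discs; hence the factor 2
    in one direction. *)
Lemma continuous_C_eps_delta (f : C -> R) (p : C) : continuous f p <->
  forall eps, 0 < eps -> exists d, 0 < d /\ forall z, Cmod (z - p)%C < d ->
     Rabs (f z - f p) < eps.
Proof.
split.
- intros H eps He. unfold continuous in H. rewrite filterlim_locally in H.
  destruct (H (mkposreal eps He)) as [d Hd].
  exists d. split. apply cond_pos. intros z Hz. apply (Hd z).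
  split.
  + eapply Rle_lt_trans; [|exact Hz]. exact (re_le_Cmod (z - p)%C).
  + eapply Rle_lt_trans; [|exact Hz]. exact (im_le_Cmod (z - p)%C).
- intros H. apply filterlim_locally. intros [eps He].
  destruct (H eps He) as [d [Hd Hc]].
  assert (Hd2 : 0 < d / 2) by lra.
  exists (mkposreal _ Hd2). intros z [H1 H2]. apply Hc.
  change (Rabs (fst z - fst p) < d / 2) in H1. change (Rabs (snd z - snd p) < d / 2) in H2.
  eapply Rle_lt_trans. apply (Cmod_pair (fst (z - p)%C) (snd (z - p)%C)).
  simpl. unfold Rminus in H1, H2. lra.
Qed.

(** The quadratic part [c (x^2 - y^2) + e x y] has trace zero. Continuity comes from the full planar
    expansion, since expansions along the two axes alone do not give it. *)
Lemma lap_harmonic (f : C -> R) (p : C) a a' c e B delta : 0 < delta -> 0 < B ->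
  (forall h : C, Cmod h < delta ->
    Rabs (f (p + h)%C - (f p + (a * fst h + a' * snd h)
      + (c * (fst h * fst h - snd h * snd h) + e * (fst h * snd h)))) <= B * Cmod h ^ 3) ->
  lap f p a a' 0.
Proof.
intros Hd HB H. split.
- apply continuous_C_eps_delta. intros eps He.
  assert (A1 := Rabs_pos a). assert (A2 := Rabs_pos a').
  assert (A3 := Rabs_pos c). assert (A4 := Rabs_pos e).
  set (k := Rabs a + Rabs a' + 2 * Rabs c + Rabs e + B) in *.
  assert (Hk : 0 < k) by (unfold k; lra).
  assert (Hq : 0 < eps / k) by (apply Rdiv_lt_0_compat; lra).
  exists (Rmin (Rmin 1 delta) (eps / k)). split. repeat apply Rmin_pos; lra.
  intros z Hz. assert (M1 := Rmin_l (Rmin 1 delta) (eps / k)).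
  assert (M2 := Rmin_r (Rmin 1 delta) (eps / k)).
  assert (M3 := Rmin_l 1 delta). assert (M4 := Rmin_r 1 delta).
  set (h := (z - p)%C) in *. specialize (H h ltac:(lra)).
  replace (p + h)%C with z in H by (unfold h; ring).
  assert (H1 := re_le_Cmod h). assert (H2 := im_le_Cmod h). unfold Re, Im in H1, H2.
  assert (H0 := Cmod_ge_0 h). set (x := Cmod h) in *.
  assert (Hx3 : B * x ^ 3 <= B * x). { apply Rmult_le_compat_l. lra. simpl. nra. }
  assert (P1 : Rabs (a * fst h) <= Rabs a * x).
  { rewrite Rabs_mult. now apply Rmult_le_compat_l. }
  assert (P2 : Rabs (a' * snd h) <= Rabs a' * x).
  { rewrite Rabs_mult. now apply Rmult_le_compat_l. }
  assert (Sq : forall u v, Rabs u <= x -> Rabs v <= x -> Rabs (u * v) <= x).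
  { intros u v Hu Hv. rewrite Rabs_mult. assert (Rabs u * Rabs v <= x * x).
    apply Rmult_le_compat; auto; apply Rabs_pos. nra. }
  assert (P3 : Rabs (c * (fst h * fst h - snd h * snd h)) <= Rabs c * (2 * x)).
  { rewrite Rabs_mult. apply Rmult_le_compat_l; auto.
    unfold Rminus. eapply Rle_trans. apply Rabs_triang. rewrite Rabs_Ropp.
    assert (S1 := Sq _ _ H1 H1). assert (S2 := Sq _ _ H2 H2). lra. }
  assert (P4 : Rabs (e * (fst h * snd h)) <= Rabs e * x).
  { rewrite Rabs_mult. apply Rmult_le_compat_l; auto. }
  apply Rle_lt_trans with (k * x).
  + apply Rabs_le_between in H. apply Rabs_le_between in P1. apply Rabs_le_between in P2.
    apply Rabs_le_between in P3. apply Rabs_le_between in P4.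
    apply Rabs_le. unfold k. lra.
  + replace eps with (k * (eps / k)) by (field; lra). apply Rmult_lt_compat_l; lra.
- exists c, (-c). split; [|split; [|ring]].
  + apply jet2_cubic with B delta; auto. intros t Ht.
    specialize (H (t, 0)). replace (Cmod (t, 0)) with (Rabs t) in H by (symmetry; apply Cmod_R).
    specialize (H Ht). simpl in H.
    replace (f (fst p + t, snd p)) with (f (p + (t, 0))%C).
    2:{ f_equal. unfold Cplus; simpl. f_equal; ring. }
    eapply Rle_trans; [|exact H]. apply Req_le. f_equal. ring.
  + apply jet2_cubic with B delta; auto. intros t Ht.
    specialize (H (0, t)).
    assert (E : Cmod (0, t) = Rabs t).
    { replace (0, t) with (t * Ci)%C. rewrite Cmod_mult, Cmod_Ci, Cmod_R. ring.
      unfold Cmult; simpl. f_equal; ring. }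
    rewrite E in H. specialize (H Ht). simpl in H.
    replace (f (fst p, snd p + t)) with (f (p + (0, t))%C).
    2:{ f_equal. unfold Cplus; simpl. f_equal; ring. }
    eapply Rle_trans; [|exact H]. apply Req_le. f_equal. ring.
Qed.

(** By the Cauchy-Riemann equations real and imaginary part are harmonic with orthogonal gradients
    of length [Cmod d]; both formulas follow by expanding the sum of two squares. *)
Lemma lap_holo_sqr b p beta : holo_disc b -> in_disc p -> exists d a a',
  is_derive b p d /\
  lap (fun z => Cmod (b z - beta)%C ^ 2) p a a' (2 * Cmod d ^ 2) /\
  a * a + a' * a' = 4 * Cmod (b p - beta)%C ^ 2 * Cmod d ^ 2.
Proof.
intros Hb Hp.
destruct (holo_taylor2 b p Hb Hp) as [d [c [B [delta [Hd [HB [HD HT]]]]]]].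
assert (Lf : lap (fun z => fst (b z)) p (fst d) (- snd d) 0).
{ apply lap_harmonic with (fst c) (- 2 * snd c) B delta; auto.
  intros h Hh. eapply Rle_trans; [|apply (HT h Hh)].
  eapply Rle_trans; [|apply re_le_Cmod]. unfold Re; simpl. apply Req_le; f_equal; ring. }
assert (Ls : lap (fun z => snd (b z)) p (snd d) (fst d) 0).
{ apply lap_harmonic with (snd c) (2 * fst c) B delta; auto.
  intros h Hh. eapply Rle_trans; [|apply (HT h Hh)].
  eapply Rle_trans; [|apply im_le_Cmod]. unfold Im; simpl. apply Req_le; f_equal; ring. }
assert (F := lap_plus _ _ _ _ _ _ _ _ _ Lf (lap_const (- fst beta) p)).
assert (S := lap_plus _ _ _ _ _ _ _ _ _ Ls (lap_const (- snd beta) p)).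
exists d. do 2 eexists. split; auto. split.
- eapply lap_ext.
  apply (lap_plus _ _ _ _ _ _ _ _ _ (lap_mult _ _ _ _ _ _ _ _ _ F F)
   (lap_mult _ _ _ _ _ _ _ _ _ S S)).
  intros z. rewrite Cmod_sqr. simpl. ring. reflexivity. reflexivity.
  rewrite Cmod_sqr. ring.
- rewrite !Cmod_sqr. simpl. ring.
Qed.

(** * Extreme values *)

Section Compactness.
Variable K : C -> Prop.
Hypothesis K_bounded : forall z, K z -> Cmod z <= 1.
Hypothesis K_closed : forall z, ~ K z -> exists d, 0 < d /\
  forall w, Cmod (w - z)%C < d -> ~ K w.

(** Heine-Borel without covers: the bounds on the four quarters of a square combine into their
    maximum, because [Q] is monotone in the bound. A point outside [K] has a neighbourhood on which
    nothing is to be shown. *)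
Lemma compact_uniform (Q : R -> C -> Prop) :
  (forall B B' z, Q B z -> B <= B' -> Q B' z) ->
  (forall p, K p -> exists B d, 0 < d /\ forall z, K z -> Cmod (z - p)%C < d -> Q B z) ->
  exists B, forall z, K z -> Q B z.
Proof.
intros Hmono Hloc.
destruct (cousin_square (fun a c l => exists B, forall z, K z ->
  a <= fst z <= a + l -> c <= snd z <= c + l -> Q B z)) with (-1) (-1) 2 as [B HB].
- intros a c l Hl [B1 H1] [B2 H2] [B3 H3] [B4 H4].
  exists (Rmax (Rmax B1 B2) (Rmax B3 B4)). intros z Kz Hx Hy.
  assert (M1 := Rmax_l B1 B2). assert (M2 := Rmax_r B1 B2).
  assert (M3 := Rmax_l B3 B4). assert (M4 := Rmax_r B3 B4).
  assert (M5 := Rmax_l (Rmax B1 B2) (Rmax B3 B4)).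
  assert (M6 := Rmax_r (Rmax B1 B2) (Rmax B3 B4)).
  destruct (Rle_dec (fst z) (a + l/2)), (Rle_dec (snd z) (c + l/2)).
  + apply Hmono with B1; [apply H1; auto; lra|lra].
  + apply Hmono with B3; [apply H3; auto; lra|lra].
  + apply Hmono with B2; [apply H2; auto; lra|lra].
  + apply Hmono with B4; [apply H4; auto; lra|lra].
- lra.
- intros x y Hx Hy.
  assert (Hball : exists d B, 0 < d /\ forall z, K z -> Cmod (z - (x, y))%C < d -> Q B z).
  { destruct (classic (K (x, y))) as [HK|HK].
    - destruct (Hloc _ HK) as [B [d [Hd H]]]. exists d, B; auto.
    - destruct (K_closed _ HK) as [d [Hd H]]. exists d, 0. split; auto.
      intros z Kz Hz. exfalso. now apply (H z). }
  destruct Hball as [d [B [Hd H]]].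
  exists (d/2). split. lra. intros a c l Hl Ha1 Ha2 Hc1 Hc2.
  exists B. intros z Kz Hzx Hzy. apply H; auto.
  eapply Rle_lt_trans. apply (Cmod_pair (fst (z - (x,y))%C) (snd (z - (x,y))%C)).
  simpl. assert (Rabs (fst z + - x) <= l) by (apply Rabs_le; lra).
  assert (Rabs (snd z + - y) <= l) by (apply Rabs_le; lra). lra.
- exists B. intros z Kz. specialize (K_bounded z Kz).
  assert (H1 := re_le_Cmod z). assert (H2 := im_le_Cmod z). unfold Re, Im in H1, H2.
  assert (Rabs (fst z) <= 1) by lra. assert (Rabs (snd z) <= 1) by lra.
  apply Rabs_le_between in H. apply Rabs_le_between in H0.
  apply HB; auto; lra.
Qed.

Lemma extreme_value (W : C -> R) (a : C) : K a ->
  (forall p, K p -> continuous W p) -> exists p, K p /\ forall z, K z -> W z <= W p.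
Proof.
intros Ka Wc.
destruct (compact_uniform (fun B z => W z <= B)) as [B HB].
{ cbv beta. intros; lra. }
{ intros p Kp. destruct (proj1 (continuous_C_eps_delta W p) (Wc p Kp) 1 Rlt_0_1) as [d [Hd H]].
  exists (W p + 1), d. split; auto. intros z _ Hz. specialize (H z Hz).
  apply Rabs_lt_between in H. lra. }
destruct (completeness (fun x => exists z, K z /\ x = W z)) as [S [HS1 HS2]].
{ exists B. intros x [z [Kz ->]]. auto. }
{ exists (W a), a; auto. }
apply NNPP. intros Hno.
assert (Hlt : forall p, K p -> W p < S).
{ intros p Kp. assert (W p <= S) by (apply HS1; now exists p).
  destruct (Req_dec (W p) S) as [E|E]; [|lra].
  exfalso. apply Hno. exists p. split; auto. intros z Kz. rewrite E. apply HS1. now exists z. }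
(* If the supremum is not attained, [W] stays below [S] by a local gap. Writing gaps as [exp (- B)]
   makes the property monotone in [B], and a uniform gap contradicts the choice of [S]. *)
destruct (compact_uniform (fun B z => W z <= S - exp (- B))) as [B2 HB2].
{ cbv beta. intros b b' z H Hbb. assert (exp (- b') <= exp (- b)); [|lra].
  destruct Hbb as [Hbb | ->]; [|lra]. apply Rlt_le, exp_increasing. lra. }
{ intros p Kp. specialize (Hlt p Kp).
  destruct (proj1 (continuous_C_eps_delta W p) (Wc p Kp) ((S - W p)/2) ltac:(lra)) as [d [Hd H]].
  exists (- ln ((S - W p)/2)), d. split; auto. intros z _ Hz. specialize (H z Hz).
  apply Rabs_lt_between in H. rewrite Ropp_involutive, exp_ln; lra. }
assert (S <= S - exp (- B2)). { apply HS2. intros x [z [Kz ->]]. auto. }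
assert (H0 := exp_pos (- B2)). lra.
Qed.
End Compactness.

Lemma rdiff_is_derive f x y lx ly : rdiff f x y lx ly -> is_derive (fun u => f u y) x lx.
Proof.
intros H. apply is_derive_Reals. intros eps He.
destruct (H (eps/2) ltac:(lra)) as [d [Hd Hc]].
exists (mkposreal d Hd). intros h Hh0 Hh. simpl in Hh.
specialize (Hc (x + h) y). rewrite Rminus_diag, Rabs_R0 in Hc.
replace (x + h - x) with h in Hc by ring. specialize (Hc Hh Hd).
replace ((f (x + h) y - f x y) / h - lx) with
  ((f (x + h) y - f x y - (lx * h + ly * 0)) / h) by (field; auto).
assert (Ha : 0 < Rabs h) by now apply Rabs_pos_lt.
unfold Rdiv. rewrite Rabs_mult, Rabs_inv.
apply Rmult_lt_reg_r with (Rabs h); auto.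
rewrite Rmult_assoc, Rinv_l by lra. assert (0 < eps * Rabs h) by now apply Rmult_lt_0_compat. lra.
Qed.

Lemma ln_le_sub_1 x : 0 < x -> ln x <= x - 1.
Proof.
intros Hx. assert (H := exp_ineq1_le (x - 1)).
rewrite <- (ln_exp (x - 1)). apply ln_le; lra.
Qed.

(** * Growth of Bloch functions *)

Section Growth.
Variables (b : C -> C) (K : R).
Hypothesis holo : holo_disc b.
Hypothesis HK : 0 <= K.
Hypothesis Bl : forall z, in_disc z -> forall d : C, is_derive b z d ->
  Cmod d * (1 - Cmod z ^ 2) <= K.

Definition artanh (x : R) : R := / 2 * (ln (1 + x) - ln (1 - x)).

(** Integration along the hyperbolic geodesic from [w] to [z], the image of the segment from 0 to
    [U] under an automorphism of the disc: the Bloch bound makes the speed of [b] at time [t] at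
    most [K q/(1 - t^2 q^2)], the derivative of [K artanh (t q)]. *)
Lemma growth_artanh z w : in_disc z -> in_disc w -> Cmod (b z - b w)%C <= K * artanh (rho z w).
Proof.
intros Hz Hw.
assert (Kp := disc_kernel_pos z w Hz Hw).
assert (Kn : (1 - Cconj w * z)%C <> 0%C) by (apply (proj2 (Cmod_gt_0 _)); exact Kp).
set (U := ((z - w) / (1 - Cconj w * z))%C).
assert (HU : Cmod U = rho z w).
{ unfold U, rho. rewrite !Cmod_div by auto. f_equal.
  replace (z - w)%C with (- (w - z))%C by ring. apply Cmod_opp. }
set (q := rho z w) in *.
assert (Hq0 : 0 <= q) by (rewrite <- HU; apply Cmod_ge_0).
assert (Hq1 : q < 1).
{ assert (A := hs_pos z w Hz Hw). rewrite <- hs_rho in A by auto. fold q in A. nra. }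
pose (den := fun t : R => (1 + Cconj w * (RtoC t * U))%C).
pose (path := fun t _ : R => ((w + RtoC t * U) * / den t)%C).
assert (Htq : forall t, 0 <= t <= 1 -> Cmod (RtoC t * U)%C = t * q).
{ intros t Ht. rewrite Cmod_mult, HU, Cmod_Rpos; lra. }
assert (Hwp := Cmod_ge_0 w). unfold in_disc in Hw.
assert (Dn : forall t, 0 <= t <= 1 -> 0 < Cmod (den t)).
{ intros t Ht. unfold den.
  assert (T := Cmod_triangle (1 + Cconj w * (t * U))%C (- (Cconj w * (t * U)))%C).
  replace (1 + Cconj w * (t * U) + - (Cconj w * (t * U)))%C with (RtoC 1) in T by ring.
  rewrite Cmod_1, Cmod_opp, (Cmod_mult (Cconj w)), Cmod_conj, (Htq t Ht) in T.
  assert (t * q <= 1) by nra.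
  assert (Cmod w * (t * q) <= Cmod w * 1) by (apply Rmult_le_compat_l; auto). lra. }
assert (Dn0 : forall t, 0 <= t <= 1 -> den t <> 0%C).
{ intros t Ht. apply (proj2 (Cmod_gt_0 _)). auto. }
assert (Id : forall t, 0 <= t <= 1 ->
  1 - Cmod (path t 0) ^ 2 = (1 - Cmod w ^ 2) * (1 - (t * q) ^ 2) / Cmod (den t) ^ 2).
{ intros t Ht. specialize (Dn t Ht). unfold path. rewrite Cmod_mult, Cmod_inv by auto.
  rewrite <- (Htq t Ht).
  assert (E : Cmod (den t) ^ 2 - Cmod (w + t * U) ^ 2 =
    (1 - Cmod w ^ 2) * (1 - Cmod (t * U) ^ 2)).
  { unfold den. rewrite !Cmod_sqr. simpl. ring. }
  rewrite <- E. field. lra. }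
assert (In : forall t, 0 <= t <= 1 -> in_disc (path t 0)).
{ intros t Ht. assert (X : 0 < 1 - Cmod (path t 0) ^ 2).
  { rewrite Id by auto. apply Rdiv_lt_0_compat. apply Rmult_lt_0_compat. nra.
    assert (0 <= t * q < 1) by nra. nra.
    apply pow_lt; auto. }
  unfold in_disc. assert (Y := Cmod_ge_0 (path t 0)). nra. }
assert (P0 : path 0 0 = w).
{ unfold path, den. replace (1 + Cconj w * (0 * U))%C with (RtoC 1) by ring.
  field. }
assert (P1 : path 1 0 = z).
{ unfold path, den, U.
  replace (1 + Cconj w * (1 * ((z - w) / (1 - Cconj w * z))))%C with
    ((1 - Cconj w * w) / (1 - Cconj w * z))%C by (field; auto).
  replace (w + 1 * ((z - w) / (1 - Cconj w * z)))%C with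
    (z * (1 - Cconj w * w) / (1 - Cconj w * z))%C by (field; auto).
  field. split; auto. apply (proj2 (Cmod_gt_0 _)). now apply disc_kernel_pos. }
assert (Pd : forall t, 0 <= t <= 1 ->
  cdif path t 0 (U * RtoC (1 - Cmod w ^ 2) * / (den t * den t))%C 0).
{ intros t Ht.
  assert (LU : cdif (fun u _ : R => RtoC u * U)%C t 0 U 0).
  { eapply cdif_ext. apply cdif_mult. apply cdif_fst. apply cdif_const. 1,2: cbv beta; ring. }
  assert (LD : cdif (fun u _ : R => den u) t 0 (Cconj w * U)%C 0).
  { eapply cdif_ext. apply cdif_plus. apply cdif_const. apply cdif_mult. apply cdif_const.
    exact LU. 1,2: cbv beta; ring. }
  assert (D := Dn0 t Ht).
  eapply cdif_ext. apply cdif_mult. apply cdif_plus. apply cdif_const. exact LU.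
  apply (cdif_comp Cinv (fun u _ => den u)). apply cder_inv. exact D. exact LD.
  - cbv beta. rewrite RtoC_minus, Cmod2_conj.
    replace ((0 + U) * / den t + (w + t * U) * (- / (den t * den t) * (Cconj w * U)))%C
     with (U * (den t - (w + t * U) * Cconj w) * / (den t * den t))%C by (field; auto).
    unfold den at 1. f_equal. f_equal. ring.
  - cbv beta. ring. }
set (D := (b z - b w)%C).
destruct (Req_dec (Cmod D) 0) as [HD|HD].
{ rewrite HD. apply Rmult_le_pos; auto. unfold artanh.
  assert (ln (1 - q) <= ln (1 + q)) by (apply ln_le; lra). lra. }
assert (HDp : 0 < Cmod D) by (assert (X := Cmod_ge_0 D); lra).
(* Projection on the direction of [D] gives a real function, open to the mean value theorem, with
   increment [Cmod D ^ 2]; one factor [Cmod D] is divided out at the end. *)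
pose (psi := fun t => Re (Cconj D * b (path t 0))%C).
assert (Hpsi : forall t, 0 <= t <= 1 -> exists l, is_derive psi t l /\
  l <= Cmod D * (K * (q / (1 - (t * q) ^ 2)))).
{ intros t Ht. destruct (holo (path t 0) (In t Ht)) as [d Hd].
  assert (Bd := Bl _ (In t Ht) d Hd). apply is_derive_cder in Hd.
  assert (Lb := cdif_comp b path t 0 d _ _ Hd (Pd t Ht)).
  assert (Lp := cdif_mult _ _ _ _ _ _ _ _ (cdif_const (Cconj D) t 0) Lb).
  apply cdif_Re in Lp. apply rdiff_is_derive in Lp. cbv beta in Lp.
  eexists. split. exact Lp.
  assert (tq : 0 <= t * q < 1) by nra.
  assert (tq2 : 0 < 1 - (t * q) ^ 2) by nra.
  specialize (Dn t Ht). rewrite (Id t Ht) in Bd.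
  eapply Rle_trans. apply RRle_abs. eapply Rle_trans. apply re_le_Cmod.
  match goal with |- Cmod ?X <= _ => replace X with
    (Cconj D * (d * (U * RtoC (1 - Cmod w ^ 2) * / (den t * den t))))%C by ring end.
  rewrite !Cmod_mult, Cmod_conj, Cmod_inv, Cmod_mult, HU, Cmod_Rpos
    by (try nra; apply Cmult_neq_0; auto).
  apply Rmult_le_compat_l. lra.
  replace (Cmod d * (q * (1 - Cmod w ^ 2) * / (Cmod (den t) * Cmod (den t)))) with
   ((Cmod d * ((1 - Cmod w ^ 2) * (1 - (t * q) ^ 2) / Cmod (den t) ^ 2)) * (q / (1 - (t * q) ^ 2)))
   by (field; split; lra).
  apply Rmult_le_compat_r; auto. apply Rdiv_le_0_compat; auto. }
pose (Ar := fun t => Cmod D * (K * artanh (t * q))).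
assert (HAr : forall t, 0 <= t <= 1 -> is_derive Ar t (Cmod D * (K * (q / (1 - (t * q) ^ 2))))).
{ intros t Ht. assert (tq : 0 <= t * q < 1) by nra. unfold Ar, artanh.
  auto_derive. lra. field. repeat split; nra. }
assert (Hall : forall t, 0 <= t <= 1 -> exists l, is_derive (fun t => psi t - Ar t) t l /\ l <= 0).
{ intros t Ht. destruct (Hpsi t Ht) as [l [Hl Hle]]. eexists. split.
  apply (@is_derive_minus R_AbsRing R_NormedModule). exact Hl. now apply HAr.
  change (l - Cmod D * (K * (q / (1 - (t * q) ^ 2))) <= 0). lra. }
destruct (MVT_gen (fun t => psi t - Ar t) 0 1 (Derive (fun t => psi t - Ar t))) as [c [Hc E]].
- intros t Ht. rewrite Rmin_left, Rmax_right in Ht by lra.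
  destruct (Hall t ltac:(lra)) as [l [Hl _]]. apply Derive_correct. now exists l.
- intros t Ht. rewrite Rmin_left, Rmax_right in Ht by lra.
  destruct (Hall t ltac:(lra)) as [l [Hl _]].
  apply derivable_continuous_pt. eexists. apply is_derive_Reals. exact Hl.
- rewrite Rmin_left, Rmax_right in Hc by lra.
  destruct (Hall c Hc) as [l [Hl Hle]]. apply is_derive_unique in Hl.
  change (Derive (fun t : R => psi t - Ar t) c = l) in Hl. rewrite Hl in E.
  assert (A0 : Ar 0 = 0).
  { unfold Ar, artanh. rewrite Rmult_0_l, Rplus_0_r, Rminus_0_r. ring. }
  assert (A1 : Ar 1 = Cmod D * (K * artanh q)) by (unfold Ar; now rewrite Rmult_1_l).
  assert (Eps : psi 1 - psi 0 = Cmod D ^ 2).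
  { unfold psi. rewrite P0, P1, Cmod_sqr. unfold D, Re; simpl. ring. }
  rewrite A0, A1 in E.
  apply Rmult_le_reg_l with (Cmod D); auto. simpl in Eps. lra.
Qed.

(** A coarse form of the preceding bound, kept because [exp (1 - ln hs) = e/hs] is what the
    comparison of weights produces. *)
Lemma growth_log z w : in_disc z -> in_disc w -> Cmod (b z - b w)%C <= K * (1 - ln (hs z w)).
Proof.
intros Hz Hw. eapply Rle_trans. now apply growth_artanh.
apply Rmult_le_compat_l; auto.
assert (A := hs_pos z w Hz Hw). assert (A1 := hs_le_1 z w Hz Hw). rewrite <- hs_rho in * by auto.
assert (Hq0 : 0 <= rho z w) by apply Cmod_ge_0. set (q := rho z w) in *.
assert (Hq1 : q < 1) by nra.
unfold artanh. replace (1 - q ^ 2) with ((1 + q) * (1 - q)) by ring.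
rewrite ln_mult by lra.
assert (ln (1 - q) <= 0) by (rewrite <- ln_1; apply ln_le; lra).
assert (L := ln_le_sub_1 (1 + q) ltac:(lra)).
assert (ln (1 + q) + ln (1 - q) <= 0).
{ rewrite <- ln_mult by lra. rewrite <- ln_1. apply ln_le; nra. }
lra.
Qed.

(** Near the diagonal the bound must vanish with [rho], because the denominators [- ln (1 - r^2)]
    and [- ln hs] tend to 0 as well. For [q^2 <= 1/2] one has [artanh q <= q + q^2 <= 2 q]. *)
Lemma growth_small z w : in_disc z -> in_disc w -> / 2 <= hs z w ->
  Cmod (b z - b w)%C ^ 2 <= 4 * K ^ 2 * (1 - hs z w).
Proof.
intros Hz Hw Hs. assert (G := growth_artanh z w Hz Hw).
assert (A := hs_pos z w Hz Hw). assert (A1 := hs_le_1 z w Hz Hw). rewrite <- hs_rho in * by auto.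
assert (Hq0 : 0 <= rho z w) by apply Cmod_ge_0. set (q := rho z w) in *.
assert (Hq1 : q < 1) by nra.
assert (Har : artanh q <= 2 * q).
{ unfold artanh.
  assert (L1 := ln_le_sub_1 (1 + q) ltac:(lra)).
  assert (L2 := ln_le_sub_1 (/ (1 - q ^ 2)) ltac:(apply Rinv_0_lt_compat; lra)).
  rewrite ln_Rinv in L2 by lra. replace (1 - q ^ 2) with ((1 + q) * (1 - q)) in L2 by ring.
  rewrite ln_mult in L2 by lra. replace ((1 + q) * (1 - q)) with (1 - q ^ 2) in L2 by ring.
  assert (/ (1 - q ^ 2) - 1 <= 2 * q ^ 2).
  { apply Rmult_le_reg_r with (1 - q ^ 2). lra. rewrite Rmult_minus_distr_r, Rinv_l by lra. nra. }
  nra. }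
replace (4 * K ^ 2 * (1 - (1 - q ^ 2))) with ((K * (2 * q)) ^ 2) by ring.
apply pow_incr. split. apply Cmod_ge_0. eapply Rle_trans. exact G. now apply Rmult_le_compat_l.
Qed.
End Growth.

(** * The maximum principle argument *)

Lemma sum_nonneg f N : (forall n, 0 <= f n) -> 0 <= sum_f_R0 f N.
Proof. intros H. apply cond_pos_sum, H. Qed.

(** The expression is the half Laplacian of [u2] plus half of its squared gradient, so its sign is
    that of the Laplacian of [exp u2]; [g] and [h] are the gradients of [q] and [ln hs],
    [d2 = |b'|^2] and [Y = 1/(1 - |z|^2)^2]. The gain [2 be Y] from the superharmonicity of [ln hs]
    must beat the rest. With [j = lam K^2/L] the first order terms cost at most
    [(8 j + 32 j + ka q/4) Y], and [ga = 40 j] is chosen so that only half of its gain is spent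
    there. The squared gradient costs [(264 lam K^2 (ka q) + 8 ga^2) Y], absorbed because
    [ga <= 80 lam K^2 <= 1/16]. *)
Lemma supersolution_exponent (lam K L q sig d2 Y gx gy hx hy : R) :
  0 < lam -> 0 < K -> / 2 <= L -> lam * K ^ 2 <= / 1280 -> 0 <= q <= 25 * K ^ 2 * L ^ 2 ->
  0 <= sig <= 3 * L -> 0 < Y -> 0 <= d2 <= K ^ 2 * Y ->
  gx * gx + gy * gy = 4 * q * d2 -> hx * hx + hy * hy <= 4 * Y ->
  let mu := lam / L in let ka := lam / L ^ 2 in let ga := 40 * lam * K ^ 2 / L in
  let al := mu + ka * sig in let be := ka * q + ga in
  (mu * (2 * d2) + (be * (- 2 * Y) + sig * (ka * (2 * d2)) + (ka * gx * hx + ka * gy * hy)))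
  + / 2 * ((al * gx + be * hx) * (al * gx + be * hx) + (al * gy + be * hy) * (al * gy + be * hy))
  < 0.
Proof.
intros Hlam HK HL Hm Hq Hsg HY Hd Hg Hh mu ka ga al be.
set (m := lam * K ^ 2) in *.
assert (HK2 : 0 < K ^ 2) by (apply pow_lt; auto).
assert (Hm0 : 0 < m) by (unfold m; apply Rmult_lt_0_compat; auto).
assert (Hka : 0 < ka) by (unfold ka; apply Rdiv_lt_0_compat; auto; apply pow_lt; lra).
assert (Hmu : 0 < mu) by (unfold mu; apply Rdiv_lt_0_compat; lra).
set (j := m / L).
assert (Hj0 : 0 < j) by (unfold j; apply Rdiv_lt_0_compat; lra).
assert (Hj : j <= 2 * m).
{ unfold j. apply Rmult_le_reg_r with L. lra. unfold Rdiv. rewrite Rmult_assoc, Rinv_l; nra. }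
assert (Hga : ga = 40 * j) by (unfold ga, j, m; field; lra).
assert (HkaK : ka * K ^ 2 <= 2 * j).
{ replace (ka * K ^ 2) with (j / L) by (unfold ka, j, m; field; lra).
  apply Rmult_le_reg_r with L. lra. unfold Rdiv. rewrite Rmult_assoc, Rinv_l; nra. }
assert (Hal : 0 <= al <= 4 * mu).
{ assert (0 <= ka * sig) by (apply Rmult_le_pos; lra).
  assert (ka * sig <= ka * (3 * L)) by (apply Rmult_le_compat_l; lra).
  replace (ka * (3 * L)) with (3 * mu) in H0 by (unfold ka, mu; field; lra).
  unfold al. lra. }
assert (HmuK : mu * K ^ 2 = j) by (unfold mu, j, m; field; lra).
assert (Hmu2 : mu * mu * K ^ 2 = m * ka) by (unfold mu, ka, m; field; lra).
assert (Hkq : ka * q <= 25 * m).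
{ replace (25 * m) with (ka * (25 * K ^ 2 * L ^ 2)) by (unfold ka, m; field; lra).
  apply Rmult_le_compat_l; lra. }
assert (Hkq0 : 0 <= ka * q) by (apply Rmult_le_pos; lra).
assert (T1 : 2 * al * d2 <= 8 * j * Y).
{ apply Rle_trans with (2 * (4 * mu) * (K ^ 2 * Y)).
  apply Rmult_le_compat; lra. apply Req_le. rewrite <- HmuK. ring. }
assert (T2 : ka * gx * hx + ka * gy * hy <= ka * (q / 4 + 16 * K ^ 2) * Y).
{ assert (P : forall u v, u * v <= u * u / (16 * K ^ 2) + 4 * K ^ 2 * (v * v)).
  { intros u v.
    assert (0 <= (u / (4 * K) - 2 * K * v) ^ 2) by apply pow2_ge_0.
    replace ((u / (4 * K) - 2 * K * v) ^ 2) with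
      (u * u / (16 * K ^ 2) + 4 * K ^ 2 * (v * v) - u * v) in H by (field; lra). lra. }
  assert (P1 := P gx hx). assert (P2 := P gy hy).
  assert (Q1 : (gx * gx + gy * gy) / (16 * K ^ 2) <= q / 4 * Y).
  { rewrite Hg. apply Rmult_le_reg_r with (16 * K ^ 2). lra.
    unfold Rdiv at 1. rewrite Rmult_assoc, Rinv_l by lra.
    assert (q * d2 <= q * (K ^ 2 * Y)) by (apply Rmult_le_compat_l; lra). lra. }
  assert (Q2 : 4 * K ^ 2 * (hx * hx + hy * hy) <= 16 * K ^ 2 * Y) by nra.
  assert (gx * hx + gy * hy <= (q / 4 + 16 * K ^ 2) * Y).
  { assert ((gx * gx + gy * gy) / (16 * K ^ 2) = gx * gx / (16 * K ^ 2) + gy * gy / (16 * K ^ 2))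
      by (field; lra). lra. }
  replace (ka * gx * hx + ka * gy * hy) with (ka * (gx * hx + gy * hy)) by ring.
  rewrite Rmult_assoc. apply Rmult_le_compat_l; lra. }
assert (T3 : al * al * (gx * gx + gy * gy) <= 64 * m * (ka * q) * Y).
{ rewrite Hg.
  apply Rle_trans with ((4 * mu) * (4 * mu) * (4 * q * (K ^ 2 * Y))).
  - apply Rmult_le_compat.
    + apply Rmult_le_pos; lra.
    + apply Rmult_le_pos; lra.
    + apply Rmult_le_compat; lra.
    + apply Rmult_le_compat_l; lra.
  - replace (4 * mu * (4 * mu) * (4 * q * (K ^ 2 * Y))) with
      (64 * (mu * mu * K ^ 2) * q * Y) by ring.
    rewrite Hmu2. apply Req_le. ring. }
assert (T4 : be * be * (hx * hx + hy * hy) <= (8 * (25 * m) * (ka * q) + 8 * ga * ga) * Y).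
{ assert (be * be <= 2 * (25 * m * (ka * q)) + 2 * ga * ga).
  { unfold be. assert (ka * q * (ka * q) <= 25 * m * (ka * q)) by (apply Rmult_le_compat_r; auto).
    assert (0 <= (ka * q - ga) ^ 2) by apply pow2_ge_0. nra. }
  apply Rle_trans with ((2 * (25 * m * (ka * q)) + 2 * ga * ga) * (4 * Y)).
  - apply Rmult_le_compat; auto; try nra.
  - apply Req_le. ring. }
assert (T5 : / 2 * ((al * gx + be * hx) * (al * gx + be * hx) + (al * gy + be * hy) * (al * gy + be * hy))
  <= al * al * (gx * gx + gy * gy) + be * be * (hx * hx + hy * hy)).
{ assert (0 <= (al * gx - be * hx) ^ 2) by apply pow2_ge_0.
  assert (0 <= (al * gy - be * hy) ^ 2) by apply pow2_ge_0. nra. }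
assert (T6 : ka * (q / 4 + 16 * K ^ 2) * Y <= (ka * q / 4 + 32 * j) * Y).
{ apply Rmult_le_compat_r; lra. }
replace (mu * (2 * d2) + (be * (-2 * Y) + sig * (ka * (2 * d2)) + (ka * gx * hx + ka * gy * hy)))
 with (2 * al * d2 + (ka * gx * hx + ka * gy * hy) - 2 * be * Y) by (unfold al; ring).
assert (T7 : 8 * j * Y + (ka * q / 4 + 32 * j) * Y - 2 * be * Y + 64 * m * (ka * q) * Y
   + (8 * (25 * m) * (ka * q) + 8 * ga * ga) * Y < 0).
{ replace (8 * j * Y + (ka * q / 4 + 32 * j) * Y - 2 * be * Y + 64 * m * (ka * q) * Y
   + (8 * (25 * m) * (ka * q) + 8 * ga * ga) * Y) with
   (- (Y * ((7/4 - 264 * m) * (ka * q) + (ga - 8 * ga * ga)))).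
  2:{ unfold be. replace (32 * j) with (32 / 40 * ga) by (rewrite Hga; field).
      replace (8 * j * Y) with (8 / 40 * ga * Y) by (rewrite Hga; field). field. }
  apply Ropp_lt_gt_0_contravar. apply Rmult_lt_0_compat; auto.
  assert (0 <= (7/4 - 264 * m) * (ka * q)) by (apply Rmult_le_pos; lra).
  assert (0 < ga - 8 * ga * ga).
  { replace (ga - 8 * ga * ga) with (ga * (1 - 8 * ga)) by ring.
    apply Rmult_lt_0_compat; lra. }
  lra. }
lra.
Qed.

Section MainEstimate.
Variables (b : C -> C) (K M : R) (zs : nat -> C).
Hypothesis holo : holo_disc b.
Hypothesis HK : 0 < K.
Hypothesis Bl : forall z, in_disc z -> forall d : C, is_derive b z d ->
  Cmod d * (1 - Cmod z ^ 2) <= K.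
Hypothesis zs_in : forall n, in_disc (zs n).
Hypothesis Carl : forall z, in_disc z -> forall N,
  sum_f_R0 (fun n => hs z (zs n)) N <= M.

Variables (lam r : R) (a : C) (N : nat).
Hypothesis Hlam : 0 < lam.
Hypothesis HlamK : lam * K ^ 2 <= / 1280.
Hypothesis Hr : 0 < r < 1.
Hypothesis Hr2 : / 2 < r ^ 2.
Hypothesis Ha : in_disc a.

Let L := - ln (1 - r ^ 2).
Let mu := lam / L.
Let ka := lam / L ^ 2.
Let ga := 40 * lam * K ^ 2 / L.
Let q (z : C) := Cmod (b z - b a)%C ^ 2.
Let F (z : C) := exp (mu * q z).
Definition stopped_weight (n : nat) := if Rlt_dec (rho a (zs n)) r then F (zs n) else 0.
Let phi (z : C) := sum_f_R0 (fun n => hs z (zs n)) N.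
(* [t/2 + t^2/4] is chosen so that the Laplacian of [s/2 + s^2/4], for [s = hs z w],
   is a multiple of [s^3] instead of [s^2]: the gain [s] absorbs the oscillation of [F]. *)
Definition potential (z : C) :=
  sum_f_R0 (fun n => stopped_weight n *
    (/ 2 * hs z (zs n) + / 4 * (hs z (zs n) * hs z (zs n)))) N.
(** Equals [3 * L] at [a] and 0 where [hs z a = s0]: the remaining time in the Gaussian model behind
    [u2]. *)
Let sig (z : C) := 3 * L + ln (hs z a).
Let u2 (z : C) := mu * q z + (ka * q z + ga) * sig z.
Let A := exp (M + 1).
Definition barrier (z : C) := potential z + (A * exp (mu * q z + -1 * phi z) + - A * exp (u2 z)).
Let s0 := (1 - r ^ 2) ^ 3.

Lemma one_minus_r2_bounds : 0 < 1 - r ^ 2 < / 2.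
Proof. split. nra. lra. Qed.

Lemma L_ge_half : / 2 <= L.
Proof. assert (X := one_minus_r2_bounds). unfold L. assert (H := ln_le_sub_1 (1 - r ^ 2) (proj1 X)). lra. Qed.

Lemma mu_pos : 0 < mu.
Proof. assert (X := L_ge_half). unfold mu. apply Rdiv_lt_0_compat; lra. Qed.

Lemma hs_gt_of_rho_lt z w : in_disc z -> in_disc w -> rho z w < r -> 1 - r ^ 2 < hs z w.
Proof.
intros Hz Hw H. rewrite <- hs_rho by auto.
assert (0 <= rho z w) by apply Cmod_ge_0. nra.
Qed.

Lemma s0_pos : 0 < s0.
Proof. unfold s0. apply pow_lt, one_minus_r2_bounds. Qed.

Lemma ln_s0 : ln s0 = - 3 * L.
Proof.
assert (X := one_minus_r2_bounds). unfold s0, L.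
replace ((1 - r ^ 2) ^ 3) with ((1 - r ^ 2) * ((1 - r ^ 2) * (1 - r ^ 2))) by ring.
set (x := 1 - r ^ 2) in *. rewrite ln_mult by nra. rewrite ln_mult by lra. ring.
Qed.

Lemma growth_stopped n : rho a (zs n) < r -> Cmod (b (zs n) - b a)%C <= K * (3 * L).
Proof.
intros H. assert (X := one_minus_r2_bounds). assert (XL := L_ge_half).
eapply Rle_trans. apply (growth_log b K holo (Rlt_le _ _ HK) Bl); auto.
apply Rmult_le_compat_l. lra. rewrite hs_sym. apply hs_gt_of_rho_lt in H; auto.
assert (ln (1 - r ^ 2) <= ln (hs a (zs n))) by (apply ln_le; lra). unfold L in *; lra.
Qed.

(** From [1 - ln s0 = 1 + 3 L <= 5 L], as [L >= 1/2]. *)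
Lemma growth_region z : in_disc z -> s0 <= hs z a -> Cmod (b z - b a)%C <= K * (5 * L).
Proof.
intros Hz H. assert (XL := L_ge_half). assert (S0 := s0_pos).
eapply Rle_trans. apply (growth_log b K holo (Rlt_le _ _ HK) Bl); auto.
apply Rmult_le_compat_l. lra.
assert (ln s0 <= ln (hs z a)) by (apply ln_le; lra). rewrite ln_s0 in H0. lra.
Qed.

Lemma stopped_weight_ge0 n : 0 <= stopped_weight n.
Proof. unfold stopped_weight. destruct (Rlt_dec _ _). apply Rlt_le, exp_pos. lra. Qed.

(** Crude: [mu q <= 9 lam K^2 L <= L], and [exp L = 1/(1 - r^2)]. It is used on the boundary only,
    where the third power in [s0] makes it sufficient. *)
Lemma stopped_weight_le n : stopped_weight n <= / (1 - r ^ 2).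
Proof.
assert (X := one_minus_r2_bounds). assert (XL := L_ge_half). unfold stopped_weight. destruct (Rlt_dec _ _) as [H|H].
2: apply Rlt_le, Rinv_0_lt_compat; lra.
apply growth_stopped in H.
replace (/ (1 - r ^ 2)) with (exp L).
2:{ unfold L. rewrite exp_Ropp, exp_ln; lra. }
unfold F. assert (E : mu * q (zs n) <= L).
{ apply Rle_trans with (mu * (K * (3 * L)) ^ 2).
  - apply Rmult_le_compat_l. apply Rlt_le, mu_pos. apply pow_incr. split; auto. apply Cmod_ge_0.
  - replace (mu * (K * (3 * L)) ^ 2) with (9 * (lam * K ^ 2) * L) by (unfold mu; field; lra).
    nra. }
destruct E as [E| ->]; [|lra]. apply Rlt_le, exp_increasing; auto.
Qed.

Lemma exp_le x y : x <= y -> exp x <= exp y.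
Proof. intros [H| ->]; [|lra]. apply Rlt_le, exp_increasing; auto. Qed.

(** The oscillation of [q] is a difference of squares: with [l = 1 - ln (hs z (zs n))] it is at most
    [K l * 8 K L], linear in [L], so the factor [1/L] in [mu] leaves [8 lam K^2 l <= l]. Finally
    [exp l = e/hs]. *)
Lemma stopped_weight_compare z n : in_disc z -> s0 <= hs z a ->
  stopped_weight n * hs z (zs n) <= exp 1 * F z.
Proof.
intros Hz H. assert (XL := L_ge_half). assert (Hp := hs_pos z (zs n) Hz (zs_in n)).
unfold stopped_weight. destruct (Rlt_dec _ _) as [Hn|Hn].
2: rewrite Rmult_0_l; apply Rlt_le, Rmult_lt_0_compat; apply exp_pos.
apply growth_stopped in Hn. apply growth_region in H; auto.
assert (G := growth_log b K holo (Rlt_le _ _ HK) Bl z (zs n) Hz (zs_in n)).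
set (l := 1 - ln (hs z (zs n))) in *.
assert (Hl : 0 < l).
{ assert (Y := hs_le_1 z (zs n) Hz (zs_in n)).
  assert (ln (hs z (zs n)) <= 0) by (rewrite <- ln_1; apply ln_le; lra). unfold l; lra. }
assert (E : mu * q (zs n) <= mu * q z + l).
{ assert (T : Cmod (b (zs n) - b a)%C <= Cmod (b z - b a)%C + Cmod (b z - b (zs n))%C).
  { replace (b (zs n) - b a)%C with ((b z - b a) + - (b z - b (zs n)))%C by ring.
    eapply Rle_trans. apply Cmod_triangle. rewrite Cmod_opp. lra. }
  unfold q. assert (P1 := Cmod_ge_0 (b (zs n) - b a)%C). assert (P2 := Cmod_ge_0 (b z - b a)%C).
  assert (P3 := Cmod_ge_0 (b z - b (zs n))%C).
  set (x := Cmod (b (zs n) - b a)%C) in *. set (y := Cmod (b z - b a)%C) in *.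
  set (e := Cmod (b z - b (zs n))%C) in *.
  assert (D : x ^ 2 - y ^ 2 <= (K * l) * (K * (8 * L))).
  { replace (x ^ 2 - y ^ 2) with ((x - y) * (x + y)) by ring.
    apply Rle_trans with (e * (x + y)). apply Rmult_le_compat_r; lra.
    apply Rmult_le_compat; lra. }
  assert (mu * (x ^ 2 - y ^ 2) <= mu * ((K * l) * (K * (8 * L)))).
  { apply Rmult_le_compat_l; auto. apply Rlt_le, mu_pos. }
  replace (mu * (K * l * (K * (8 * L)))) with (8 * (lam * K ^ 2) * l) in H0 by (unfold mu; field; lra).
  nra. }
apply exp_le in E. rewrite exp_plus in E. unfold l, Rminus in E.
rewrite exp_plus, exp_Ropp, exp_ln in E by auto. unfold F.
apply Rle_trans with (exp (mu * q z) * (exp 1 * / hs z (zs n)) * hs z (zs n)).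
- apply Rmult_le_compat_r; lra.
- apply Req_le. field. lra.
Qed.

Lemma lap_potential p : in_disc p -> exists c c' e e',
  lap phi p c c' (sum_f_R0 (fun n => - 2 * hs p (zs n) ^ 2 / (1 - Cmod p ^ 2) ^ 2) N) /\
  lap potential p e e' (sum_f_R0 (fun n => stopped_weight n * (- 2 * hs p (zs n) ^ 3 / (1 - Cmod p ^ 2) ^ 2)) N).
Proof.
intros Hp. assert (X := disc_pos p Hp).
assert (H : forall n, exists g : R * R, lap (fun z => hs z (zs n)) p (fst g) (snd g)
   (- 2 * hs p (zs n) ^ 2 / (1 - Cmod p ^ 2) ^ 2) /\
  fst g * fst g + snd g * snd g = 4 * (1 - hs p (zs n)) * hs p (zs n) ^ 2 / (1 - Cmod p ^ 2) ^ 2).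
{ intros n. destruct (lap_hs p (zs n) Hp (zs_in n)) as [g [g' G]]. now exists (g, g'). }
(* [lap_sum] wants the gradients as functions of [n], hence the choice. *)
set (g := fun n => proj1_sig (constructive_indefinite_description _ (H n))).
assert (G := fun n => proj2_sig (constructive_indefinite_description _ (H n))). fold g in G.
do 4 eexists. split.
- apply (lap_sum (fun n z => hs z (zs n))). intros n. apply (G n).
- apply (lap_sum (fun n z => stopped_weight n * (/ 2 * hs z (zs n) + / 4 * (hs z (zs n) * hs z (zs n))))).
  intros n. destruct (G n) as [G1 G2].
  eapply lap_ext. apply lap_scal. apply lap_lin. exact G1. apply lap_mult; exact G1.
  reflexivity. reflexivity. reflexivity.
  cbv beta. rewrite G2. field. lra.
Qed.

Lemma lap_barrier_pos p : in_disc p -> s0 <= hs p a -> exists c c' l,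
  lap barrier p c c' l /\ 0 < l.
Proof.
intros Hp Hs. assert (X := disc_pos p Hp). assert (XL := L_ge_half).
set (Y := / (1 - Cmod p ^ 2) ^ 2).
assert (HY : 0 < Y) by (apply Rinv_0_lt_compat, pow_lt; auto).
destruct (lap_potential p Hp) as [c [c' [e [e' [Lphi LV]]]]].
destruct (lap_holo_sqr b p (b a) holo Hp) as [d [gx [gy [Hd [Lq Hg]]]]].
destruct (lap_hs p a Hp Ha) as [k [k' [Ls Hk]]].
assert (Hsp := hs_pos p a Hp Ha).
assert (Lsg := lap_plus _ _ _ _ _ _ _ _ _ (lap_const (3 * L) p)
  (lap_comp ln _ _ _ _ _ _ _ Ls (jet2_ln _ Hsp))).
assert (Lu1 := lap_lin _ _ _ _ _ _ _ _ _ mu (-1) Lq Lphi).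
assert (L1 := lap_comp exp _ _ _ _ _ _ _ Lu1 (jet2_exp _)).
assert (Lu2 := lap_plus _ _ _ _ _ _ _ _ _ (lap_scal _ _ _ _ _ mu Lq)
  (lap_mult _ _ _ _ _ _ _ _ _ (lap_plus _ _ _ _ _ _ _ _ _ (lap_scal _ _ _ _ _ ka Lq) (lap_const ga p)) Lsg)).
assert (L2 := lap_comp exp _ _ _ _ _ _ _ Lu2 (jet2_exp _)).
assert (LW := lap_plus _ _ _ _ _ _ _ _ _ LV (lap_lin _ _ _ _ _ _ _ _ _ A (- A) L1 L2)).
do 3 eexists. split.
- eapply lap_ext. exact LW. 2,3,4: reflexivity. intros z. reflexivity.
- cbv beta. fold (q p). fold (sig p). fold (u2 p).
  set (hx := / hs p a * k). set (hy := / hs p a * k').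
  assert (HA : 0 < A) by apply exp_pos.
  (* [T2] belongs to [exp u2] and supplies the strict inequality; the other two terms together need
     only be nonnegative. *)
  match goal with |- 0 < ?SV + (A * ?T1 + - A * ?T2) =>
    assert (E2 : T2 < 0); [|assert (E1 : 0 <= SV + A * T1)] end.
  + assert (fac : forall e l g : R, e * l + e / 2 * g = e * (l + / 2 * g)) by (intros; field).
    rewrite fac. match goal with |- exp _ * ?l < 0 => assert (l < 0) end.
    { assert (Hd2 : 0 <= Cmod d ^ 2 <= K ^ 2 * Y).
      { split. apply pow2_ge_0. assert (B := Bl p Hp d Hd).
        unfold Y. apply Rmult_le_reg_r with ((1 - Cmod p ^ 2) ^ 2). apply pow_lt; auto.
        rewrite Rmult_assoc, Rinv_l, Rmult_1_r by (apply pow_nonzero; lra).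
        rewrite <- Rpow_mult_distr. apply pow_incr. split; auto.
        apply Rmult_le_pos. apply Cmod_ge_0. lra. }
      assert (Hqb : 0 <= q p <= 25 * K ^ 2 * L ^ 2).
      { split. apply pow2_ge_0. replace (25 * K ^ 2 * L ^ 2) with ((K * (5 * L)) ^ 2) by ring.
        apply pow_incr. split. apply Cmod_ge_0. now apply growth_region. }
      assert (Hsgb : 0 <= sig p <= 3 * L).
      { unfold sig. split.
        - assert (ln s0 <= ln (hs p a)) by (apply ln_le; auto; apply s0_pos).
          rewrite ln_s0 in H. lra.
        - assert (ln (hs p a) <= 0); [|lra]. rewrite <- ln_1. apply ln_le; auto. now apply hs_le_1. }
      assert (Hh : hx * hx + hy * hy <= 4 * Y).
      { replace (hx * hx + hy * hy) with ((k * k + k' * k') / (hs p a) ^ 2) by (unfold hx, hy; field; lra).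
        rewrite Hk. unfold Y.
        replace (4 * (1 - hs p a) * hs p a ^ 2 / (1 - Cmod p ^ 2) ^ 2 / hs p a ^ 2) with
          (4 * / (1 - Cmod p ^ 2) ^ 2 * (1 - hs p a)) by (field; lra).
        fold Y. nra. }
      assert (S := supersolution_exponent lam K L (q p) (sig p) (Cmod d ^ 2) Y gx gy hx hy
        Hlam HK XL HlamK Hqb Hsgb HY Hd2 Hg Hh).
      cbv zeta in S. fold mu ka ga in S.
      match type of S with ?l1 + / 2 * ?g1 < 0 => match goal with |- ?l2 + / 2 * ?g2 < 0 =>
        replace l2 with l1; [replace g2 with g1; [exact S|]|] end end.
      - unfold hx, hy. ring.
      - replace (/ hs p a * (-2 * hs p a ^ 2 / (1 - Cmod p ^ 2) ^ 2) +
           - / (2 * (hs p a * hs p a)) * (k * k + k' * k')) with (- 2 * Y).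
        unfold hx, hy. ring.
        rewrite Hk. unfold Y. field. lra. }
    assert (P := exp_pos (u2 p)).
    apply Ropp_lt_cancel. rewrite Ropp_0, Ropp_mult_distr_r. apply Rmult_lt_0_compat. exact P. lra.
  (* As [phi <= M], [A exp (mu q - phi) >= e F(p)]. Each term of [- phi] thus gains at least
     [e F(p) * 2 s^2 Y] with [s = hs p (zs n)], against the loss [stopped_weight n * s * 2 s^2 Y] in
     [potential]. *)
  + assert (Eb : 0 <= A * (exp (mu * q p + -1 * phi p) * (-1 * sum_f_R0 (fun n => -2 * hs p (zs n) ^ 2 / (1 - Cmod p ^ 2) ^ 2) N))
       + sum_f_R0 (fun n => stopped_weight n * (-2 * hs p (zs n) ^ 3 / (1 - Cmod p ^ 2) ^ 2)) N).
    { assert (Ph := Carl p Hp N). fold (phi p) in Ph.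
      assert (EA : exp 1 * F p <= A * exp (mu * q p + -1 * phi p)).
      { unfold A, F. rewrite <- !exp_plus. apply exp_le. lra. }
      rewrite <- (Rmult_assoc A).
      set (S2 := sum_f_R0 (fun n => 2 * hs p (zs n) ^ 2 * Y) N).
      assert (ES : -1 * sum_f_R0 (fun n => -2 * hs p (zs n) ^ 2 / (1 - Cmod p ^ 2) ^ 2) N = S2).
      { rewrite scal_sum. apply sum_eq. intros n _. unfold Y. field. lra. }
      rewrite ES.
      assert (S2p : 0 <= S2).
      { apply sum_nonneg. intros n. apply Rmult_le_pos; [|lra]. assert (Q := pow2_ge_0 (hs p (zs n))). lra. }
      assert (SV : - (exp 1 * F p * S2) <= sum_f_R0 (fun n => stopped_weight n * (-2 * hs p (zs n) ^ 3 / (1 - Cmod p ^ 2) ^ 2)) N).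
      { replace (- (exp 1 * F p * S2)) with ((- (exp 1 * F p)) * S2) by ring.
        unfold S2. rewrite scal_sum. apply sum_Rle. intros n _.
        assert (O := stopped_weight_compare p n Hp Hs).
        replace (stopped_weight n * (-2 * hs p (zs n) ^ 3 / (1 - Cmod p ^ 2) ^ 2)) with
          (- (2 * hs p (zs n) ^ 2 * Y * (stopped_weight n * hs p (zs n)))) by (unfold Y; field; lra).
        replace (2 * hs p (zs n) ^ 2 * Y * - (exp 1 * F p)) with
          (- (2 * hs p (zs n) ^ 2 * Y * (exp 1 * F p))) by ring.
        apply Ropp_le_contravar. apply Rmult_le_compat_l; auto.
        apply Rmult_le_pos; [|lra]. assert (Q := pow2_ge_0 (hs p (zs n))). lra. }
      assert (exp 1 * F p * S2 <= A * exp (mu * q p + -1 * phi p) * S2) by (apply Rmult_le_compat_r; auto).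
      lra. }
    match goal with |- 0 <= ?SV + A * (exp ?u * (mu * ?qq + ?ph) + exp ?u' / 2 * ?g) =>
      assert (0 <= A * (exp u * (mu * qq))); [|assert (0 <= A * (exp u' / 2 * g))] end.
    * apply Rmult_le_pos. lra. apply Rmult_le_pos. apply Rlt_le, exp_pos.
      assert (Q := pow2_ge_0 (Cmod d)). assert (Mp := mu_pos). apply Rmult_le_pos; lra.
    * apply Rmult_le_pos. lra. apply Rmult_le_pos.
      match goal with |- 0 <= exp ?u / 2 => assert (P := exp_pos u) end. lra.
      match goal with |- 0 <= ?x * ?x + ?y * ?y => assert (Q1 := Rle_0_sqr x); assert (Q2 := Rle_0_sqr y) end.
      unfold Rsqr in *. lra.
    * lra.
  + apply (Rmult_lt_compat_l _ _ _ HA) in E2. lra.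
Qed.

Let region (z : C) : Prop := in_disc z /\ s0 <= hs z a.

Lemma region_bounded z : region z -> Cmod z <= 1.
Proof. intros [H _]. unfold in_disc in H. lra. Qed.

(** Closedness is read off the polynomial [G], the condition with denominators cleared. On the unit
    circle [G = - s0 |1 - conj(a) z|^2 < 0], so the region stays away from it. *)
Lemma region_closed z : ~ region z -> exists d, 0 < d /\
  forall w, Cmod (w - z)%C < d -> ~ region w.
Proof.
intros Hn. assert (S0 := s0_pos).
destruct (Rlt_dec 1 (Cmod z)) as [H1|H1].
{ exists (Cmod z - 1). split. lra. intros w Hw [Hd _]. unfold in_disc in Hd.
  assert (T := Cmod_triangle w (- (w - z))%C). rewrite Cmod_opp in T.
  replace (w + - (w - z))%C with z in T by ring. lra. }
set (G := fun z => (1 - Cmod a ^ 2) * (1 - Cmod z ^ 2) + - s0 * Cmod (1 - Cconj a * z)%C ^ 2).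
assert (LG := lap_lin _ _ _ _ _ _ _ _ _ (1 - Cmod a ^ 2) (- s0) (lap_norm_sqr z) (lap_disc_kernel_sqr z a)).
destruct LG as [CG _]. fold G in CG.
assert (Hreg : forall w, region w -> 0 <= G w).
{ intros w [Hd Hs]. assert (Kp := disc_kernel_pos w a Hd Ha). unfold hs in Hs.
  apply (Rmult_le_compat_r (Cmod (1 - Cconj a * w)%C ^ 2)) in Hs. 2: apply pow2_ge_0.
  unfold Rdiv in Hs. rewrite Rmult_assoc, Rinv_l in Hs by (apply pow_nonzero; lra).
  unfold G. lra. }
assert (HG : G z < 0).
{ apply Rnot_le_lt. intros HG. apply Hn.
  assert (Hz : in_disc z).
  { destruct (Req_dec (Cmod z) 1) as [E|E]. 2: unfold in_disc; lra.
    exfalso. unfold G in HG. rewrite E in HG.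
    assert (0 < Cmod (1 - Cconj a * z)%C).
    { assert (T := Cmod_triangle (1 - Cconj a * z)%C (Cconj a * z)%C).
      replace (1 - Cconj a * z + Cconj a * z)%C with (RtoC 1) in T by ring.
      rewrite Cmod_1, Cmod_mult, Cmod_conj, E in T. unfold in_disc in Ha. lra. }
    assert (0 < s0 * Cmod (1 - Cconj a * z)%C ^ 2)
      by (apply Rmult_lt_0_compat; auto; apply pow_lt; auto).
    lra. }
  split; auto. assert (Kp := disc_kernel_pos z a Hz Ha). unfold hs.
  apply Rmult_le_reg_r with (Cmod (1 - Cconj a * z)%C ^ 2). now apply pow_lt.
  unfold Rdiv. rewrite Rmult_assoc, Rinv_l by (apply pow_nonzero; lra).
  unfold G in HG. lra. }
destruct (proj1 (continuous_C_eps_delta G z) CG (- G z) ltac:(lra)) as [d [Hd Hc]].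
exists d. split; auto. intros w Hw Rw. specialize (Hc w Hw). apply Hreg in Rw.
apply Rabs_lt_between in Hc. lra.
Qed.

(** With [x = 1 - r^2], [sa = hs a (zs n) >= x] and [sp = hs p (zs n)], [hs_triangle] gives
    [sp <= 4 x^3/sa <= 4 x sa]; multiplied by [stopped_weight n <= 1/x] this is at most [4 sa]. The
    3 is [4 * 3/4], from [sp/2 + sp^2/4 <= 3 sp/4]. *)
Lemma potential_boundary p : in_disc p -> hs p a = s0 -> potential p <= 3 * M.
Proof.
intros Hp Hs. assert (X := one_minus_r2_bounds).
apply Rle_trans with (3 * sum_f_R0 (fun n => hs a (zs n)) N).
2: apply Rmult_le_compat_l; [lra | apply Carl; auto].
unfold potential. rewrite scal_sum. apply sum_Rle. intros n _.
assert (H1 := hs_pos p (zs n) Hp (zs_in n)). assert (H2 := hs_le_1 p (zs n) Hp (zs_in n)).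
assert (H3 := hs_pos a (zs n) Ha (zs_in n)).
assert (O := stopped_weight_ge0 n).
apply Rle_trans with (3 / 4 * (stopped_weight n * hs p (zs n))).
{ replace (stopped_weight n * (/ 2 * hs p (zs n) + / 4 * (hs p (zs n) * hs p (zs n)))) with
   ((/ 2 + / 4 * hs p (zs n)) * (stopped_weight n * hs p (zs n))) by ring.
  apply Rmult_le_compat_r. apply Rmult_le_pos; lra. lra. }
assert (Key : stopped_weight n * hs p (zs n) <= 4 * hs a (zs n)); [|lra].
unfold stopped_weight in *. destruct (Rlt_dec _ _) as [Hn|Hn]. 2: lra.
assert (Ol := stopped_weight_le n). unfold stopped_weight in Ol.
destruct (Rlt_dec _ _) in Ol; [|contradiction].
apply hs_gt_of_rho_lt in Hn; auto.
assert (T := hs_triangle p (zs n) a Hp (zs_in n) Ha). rewrite Hs, (hs_sym (zs n) a) in T.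
set (x := 1 - r ^ 2) in *. set (sa := hs a (zs n)) in *. set (sp := hs p (zs n)) in *.
unfold s0 in T. fold x in T.
assert (Hsp : sp <= 4 * x * sa).
{ apply Rmult_le_reg_r with sa; auto. eapply Rle_trans. exact T.
  replace (4 * x ^ 3) with (4 * x * (x * x)) by ring.
  replace (4 * x * sa * sa) with (4 * x * (sa * sa)) by ring.
  apply Rmult_le_compat_l. lra. apply Rmult_le_compat; lra. }
apply Rle_trans with (/ x * (4 * x * sa)).
- apply Rmult_le_compat; lra.
- apply Req_le. field. lra.
Qed.

Lemma main_estimate :
  sum_f_R0 (fun n => stopped_weight n * hs a (zs n)) N <= 2 * (3 * M + exp (M + 2)).
Proof.
assert (X := one_minus_r2_bounds). assert (XL := L_ge_half). assert (S0 := s0_pos).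
assert (HA : 0 < A) by apply exp_pos.
assert (Raa : region a).
{ split; auto. rewrite hs_refl by auto. unfold s0.
  rewrite <- (pow1 3). apply pow_incr. lra. }
destruct (extreme_value region region_bounded region_closed barrier a Raa) as [p [[Hp Hsp] Hmax]].
{ intros z [Hz Hs]. destruct (lap_barrier_pos z Hz Hs) as [c [c' [l [[HW _] _]]]]. exact HW. }
assert (WaP := Hmax a Raa).
(* If [hs p a > s0], a small disc around [p] stays in the region, and a maximum there contradicts
   the positive Laplacian. *)
assert (Hbd : hs p a = s0).
{ destruct (Req_dec (hs p a) s0) as [E|E]; auto. exfalso.
  destruct (lap_barrier_pos p Hp Hsp) as [c [c' [l [HW Hl]]]].
  destruct (lap_hs p a Hp Ha) as [k [k' [[Hc _] _]]].
  destruct (proj1 (continuous_C_eps_delta _ p) Hc (hs p a - s0) ltac:(lra)) as [d [Hd Hd']].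
  assert (Hdp : 0 < 1 - Cmod p) by (unfold in_disc in Hp; lra).
  assert (l <= 0); [|lra].
  apply (lap_max barrier p c c' l (Rmin d (1 - Cmod p)) HW). now apply Rmin_pos.
  intros z Hz. assert (M1 := Rmin_l d (1 - Cmod p)). assert (M2 := Rmin_r d (1 - Cmod p)).
  apply Hmax. split.
  - unfold in_disc. assert (T := Cmod_triangle p (z - p)%C).
    replace (p + (z - p))%C with z in T by ring. lra.
  - specialize (Hd' z ltac:(lra)). apply Rabs_lt_between in Hd'. lra. }
assert (Wp : barrier p <= 3 * M).
{ unfold barrier. assert (VB := potential_boundary p Hp Hbd).
  assert (Sg : sig p = 0). { unfold sig. rewrite Hbd, ln_s0. ring. }
  assert (U2 : u2 p = mu * q p). { unfold u2. rewrite Sg. ring. }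
  rewrite U2.
  assert (Ph : 0 <= phi p). { apply sum_nonneg. intros n. apply Rlt_le, hs_pos; auto. }
  assert (E : exp (mu * q p + -1 * phi p) <= exp (mu * q p)) by (apply exp_le; lra).
  apply (Rmult_le_compat_l A) in E; lra. }
assert (Wa : potential a - A * exp 1 <= barrier a).
{ unfold barrier.
  assert (Q : q a = 0).
  { unfold q. replace (b a - b a)%C with (RtoC 0) by ring. rewrite Cmod_0. ring. }
  (* At the centre only [ga * 3 L = 120 lam K^2 <= 120/1280] survives. *)
  assert (U : u2 a <= 1).
  { unfold u2, sig. rewrite Q, hs_refl, ln_1 by auto.
    replace (mu * 0 + (ka * 0 + ga) * (3 * L + 0)) with (120 * (lam * K ^ 2))
      by (unfold ga; field; lra). lra. }
  apply exp_le in U. apply (Rmult_le_compat_l A) in U; [|lra].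
  assert (0 < A * exp (mu * q a + -1 * phi a)) by (apply Rmult_lt_0_compat; auto; apply exp_pos).
  lra. }
assert (EA : A * exp 1 = exp (M + 2)).
{ unfold A. rewrite <- exp_plus. f_equal. ring. }
rewrite EA in Wa.
(* The factor 2 undoes the 1/2 in [potential], whose quadratic part is dropped. *)
assert (VV : sum_f_R0 (fun n => stopped_weight n * hs a (zs n)) N <= 2 * potential a).
{ unfold potential. rewrite scal_sum. apply sum_Rle. intros n _.
  assert (O := stopped_weight_ge0 n).
  assert (0 <= stopped_weight n * (hs a (zs n) * hs a (zs n))).
  { apply Rmult_le_pos; auto. apply Rle_0_sqr. }
  lra. }
lra.
Qed.
End MainEstimate.

(** * Dyadic layers *)

Section Disc.
Variables (b : C -> C) (K M : R) (zs : nat -> C).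
Hypothesis holo : holo_disc b.
Hypothesis HK : 0 < K.
Hypothesis Bl : forall z, in_disc z -> forall d : C, is_derive b z d ->
  Cmod d * (1 - Cmod z ^ 2) <= K.
Hypothesis zs_in : forall n, in_disc (zs n).
Hypothesis Carl : forall z, in_disc z -> forall N,
  sum_f_R0 (fun n => hs z (zs n)) N <= M.
Variable lam : R.
Hypothesis Hlam : 0 < lam.
Hypothesis HlamK : lam * K ^ 2 <= / 1280.

Let q (z : C) (n : nat) := Cmod (b (zs n) - b z)%C ^ 2.

Lemma carleson_const_nonneg : 0 <= M.
Proof.
assert (H0 : in_disc 0) by (unfold in_disc; rewrite Cmod_0; lra).
eapply Rle_trans; [|apply (Carl 0%C H0 0%nat)]. apply Rlt_le, hs_pos; auto.
Qed.

(** The bounds for [r^2 <= 1/2] and for [r^2 > 1/2], added. *)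
Definition stopped_sum_bound := exp 1 * M + 2 * (3 * M + exp (M + 2)).

Lemma oscillation_near z n : in_disc z -> / 2 <= hs z (zs n) -> q z n <= 4 * K ^ 2 * (1 - hs z (zs n)).
Proof.
intros Hz Hs. rewrite hs_sym in *. apply (growth_small b K holo (Rlt_le _ _ HK) Bl); auto.
Qed.

(** For [r^2 <= 1/2] the logarithm [L] may be arbitrarily small, out of reach of [main_estimate];
    there [lam q <= 4 lam K^2 r^2 <= L], so the exponential is at most [e]. *)
Lemma stopped_sum z r N : in_disc z -> 0 < r < 1 ->
  sum_f_R0 (fun n => if Rlt_dec (rho z (zs n)) r then
     exp (lam * q z n / (- ln (1 - r ^ 2))) * hs z (zs n) else 0) N <= stopped_sum_bound.
Proof.
intros Hz Hr. assert (HM := carleson_const_nonneg). unfold stopped_sum_bound.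
assert (E1 := exp_pos 1). assert (E2 := exp_pos (M + 2)).
assert (0 <= exp 1 * M) by (apply Rmult_le_pos; lra).
destruct (Rlt_dec (/ 2) (r ^ 2)) as [H2|H2].
- assert (T := main_estimate b K M zs holo HK Bl zs_in Carl lam r z N Hlam HlamK Hr H2 Hz).
  apply Rle_trans with (2 * (3 * M + exp (M + 2))); [|lra].
  eapply Rle_trans; [|exact T]. apply sum_Rle. intros n _. unfold stopped_weight.
  destruct (Rlt_dec _ _) as [Hn|Hn]; [|lra]. apply Req_le. f_equal. f_equal.
  unfold q, Rdiv. ring.
- apply Rle_trans with (exp 1 * M). 2: lra.
  apply Rle_trans with (exp 1 * sum_f_R0 (fun n => hs z (zs n)) N).
  2: apply Rmult_le_compat_l; [lra | auto].
  rewrite scal_sum. apply sum_Rle. intros n _.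
  assert (Hp := hs_pos z (zs n) Hz (zs_in n)).
  destruct (Rlt_dec _ _) as [Hn|Hn].
  2: apply Rmult_le_pos; lra.
  rewrite Rmult_comm. apply Rmult_le_compat_l. lra. apply exp_le.
  assert (Hx := hs_gt_of_rho_lt r z (zs n) Hz (zs_in n) Hn).
  assert (Q := oscillation_near z n Hz ltac:(lra)).
  assert (HL : r ^ 2 <= - ln (1 - r ^ 2)).
  { assert (X := ln_le_sub_1 (1 - r ^ 2) ltac:(nra)). lra. }
  assert (Hr2 : 0 < r ^ 2) by (apply pow_lt; lra).
  apply Rmult_le_reg_r with (- ln (1 - r ^ 2)). lra.
  unfold Rdiv. rewrite Rmult_assoc, Rinv_l, Rmult_1_r, Rmult_1_l by lra.
  apply Rle_trans with (lam * (4 * K ^ 2 * (1 - hs z (zs n)))).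
  apply Rmult_le_compat_l; lra.
  replace (lam * (4 * K ^ 2 * (1 - hs z (zs n)))) with (4 * (lam * K ^ 2) * (1 - hs z (zs n))) by ring.
  assert (X := hs_le_1 z (zs n) Hz (zs_in n)).
  apply Rle_trans with (1 * (1 - hs z (zs n))); [apply Rmult_le_compat_r|]; lra.
Qed.

(** As [- ln hs >= 1 - hs], the exponent is at most [lam K^2 <= 1]. This starts the induction over
    the layers. *)
Lemma weight_near z n : in_disc z -> / 2 <= hs z (zs n) ->
  weight_ii (lam / 4) b z (zs n) <= exp 1 * hs z (zs n).
Proof.
intros Hz Hs. assert (Hp := hs_pos z (zs n) Hz (zs_in n)).
unfold weight_ii. rewrite hs_rho by auto. apply Rmult_le_compat_r. lra.
destruct (Req_EM_T _ _) as [E|E].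
- assert (X := exp_ineq1_le 1). lra.
- apply exp_le. assert (Q := oscillation_near z n Hz Hs). fold (q z n).
  assert (HL := ln_le_sub_1 _ Hp).
  assert (H1 : 0 < 1 - hs z (zs n)).
  { assert (Kp := disc_kernel_pos z (zs n) Hz (zs_in n)).
    assert (Hr2 : 0 < rho z (zs n) ^ 2).
    { apply pow_lt. unfold rho. rewrite Cmod_div by (apply (proj2 (Cmod_gt_0 _)); exact Kp).
      apply Rdiv_lt_0_compat; auto. assert (X := Cmod_ge_0 (zs n - z)%C). lra. }
    rewrite <- hs_rho by auto. lra. }
  apply Rmult_le_reg_r with (- ln (hs z (zs n))). lra.
  unfold Rdiv. rewrite Rmult_assoc, Rinv_l, Rmult_1_r, Rmult_1_l by lra.
  apply Rle_trans with (lam * / 4 * (4 * K ^ 2 * (1 - hs z (zs n)))).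
  apply Rmult_le_compat_l; lra.
  replace (lam * / 4 * (4 * K ^ 2 * (1 - hs z (zs n)))) with ((lam * K ^ 2) * (1 - hs z (zs n))) by field.
  apply Rle_trans with (1 * (1 - hs z (zs n))); [apply Rmult_le_compat_r|]; lra.
Qed.

(** * Points of large weight, layer by layer *)

Section Layers.
Variables (z : C) (t : R).
Hypothesis Hz : in_disc z.
Hypothesis Ht : 0 < t.

(** Cumulative in [J]: passing to [S J] adds one dyadic layer, which suits an induction with a
    telescoping bound. *)
Definition counted (J n : nat) : R :=
  if Rlt_dec t (weight_ii (lam / 4) b z (zs n)) then
    if Rlt_dec ((/ 2) ^ J) (hs z (zs n)) then 1 else 0 else 0.

(* Telescoping device: [frac (2 y) - frac y] is comparable to [min y (1/y)]. *)
Definition frac (y : R) : R := y / (1 + y).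

(** [r] satisfies [1 - r^2 = 2^-(J+1)], so the new layer lies in the disc [rho < r]. A new point
    with weight above [t] has an exponential factor at least [y = t 2^J], whose square is at most
    the exponential [Ex] of (i). Hence it contributes at least [2^-(J+1) max(1, y^2)] to the stopped
    sum. *)
Lemma layer_term (J n : nat) : (1 <= J)%nat ->
  let r := sqrt (1 - (/ 2) ^ (S J)) in
  let y := t * 2 ^ J in
  counted (S J) n <= counted J n + 12 / t * (frac (2 * y) - frac y) *
    (if Rlt_dec (rho z (zs n)) r then
     exp (lam * q z n / (- ln (1 - r ^ 2))) * hs z (zs n) else 0).
Proof.
intros HJ r y.
assert (Hp := hs_pos z (zs n) Hz (zs_in n)).
assert (H2J : 0 < 2 ^ J) by (apply pow_lt; lra).
assert (Hh : (/ 2) ^ J = / 2 ^ J) by (rewrite pow_inv; auto; lra).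
assert (HhS : (/ 2) ^ S J = / 2 * / 2 ^ J) by (simpl; rewrite Hh; auto).
assert (Hi : 0 < / 2 ^ J) by (apply Rinv_0_lt_compat; auto).
assert (H2le : 2 <= 2 ^ J).
{ rewrite <- (pow_1 2) at 1. apply Rle_pow; auto. lra. }
assert (H1J : / 2 ^ J <= / 2) by (apply Rinv_le_contravar; lra).
assert (Hy : 0 < y) by (unfold y; apply Rmult_lt_0_compat; auto).
assert (Hr2 : r ^ 2 = 1 - / 2 * / 2 ^ J).
{ unfold r. rewrite HhS. rewrite pow2_sqrt; lra. }
assert (Hr0 : 0 <= r) by apply sqrt_pos.
assert (Hfr : frac (2 * y) - frac y = y / ((1 + 2 * y) * (1 + y))).
{ unfold frac. field. split; lra. }
assert (Hfr0 : 0 < 12 / t * (frac (2 * y) - frac y)).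
{ rewrite Hfr. apply Rmult_lt_0_compat; apply Rdiv_lt_0_compat; nra. }
set (coef := 12 / t * (frac (2 * y) - frac y)) in *.
set (body := if Rlt_dec (rho z (zs n)) r then
     exp (lam * q z n / (- ln (1 - r ^ 2))) * hs z (zs n) else 0).
assert (Hb0 : 0 <= body).
{ unfold body. destruct (Rlt_dec _ _); [|lra]. apply Rmult_le_pos; [|lra]. apply Rlt_le, exp_pos. }
assert (Hcb : 0 <= coef * body) by (apply Rmult_le_pos; lra).
unfold counted. rewrite Hh, HhS.
destruct (Rlt_dec t _) as [Hw|Hw]; [|lra].
destruct (Rlt_dec (/ 2 * / 2 ^ J) _) as [HS|HS]; destruct (Rlt_dec (/ 2 ^ J) _) as [HJx|HJx]; try lra.
assert (Hx := hs_pos z (zs n) Hz (zs_in n)).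
set (x := hs z (zs n)) in *.
assert (Hrho : rho z (zs n) < r).
{ apply Rnot_le_lt. intros Hle.
  assert (r ^ 2 <= rho z (zs n) ^ 2) by (apply pow_incr; lra).
  assert (E := hs_rho z (zs n) Hz (zs_in n)). fold x in E. lra. }
unfold body. destruct (Rlt_dec _ _) as [_|]; [|contradiction].
set (Ex := exp (lam * q z n / - ln (1 - r ^ 2))).
(* [Ex] dominates the square of the exponential factor of the weight, since [- ln x] is at least
   half of [- ln (1 - r ^ 2)]. *)
assert (HLn : 0 < ln 2) by (rewrite <- ln_1; apply ln_increasing; lra).
set (l := ln (2 ^ J)).
assert (Hl : ln 2 <= l).
{ apply ln_le; lra. }
assert (HlS : - ln (1 - r ^ 2) = ln 2 + l).
{ rewrite Hr2. replace (1 - (1 - / 2 * / 2 ^ J)) with (/ (2 * 2 ^ J)) by (field; lra).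
  rewrite ln_Rinv, ln_mult; try lra. unfold l; ring. }
assert (Hlx : l <= - ln x).
{ assert (ln x <= ln (/ 2 ^ J)) by (apply ln_le; lra). rewrite ln_Rinv in H by auto. unfold l. lra. }
assert (Hq : 0 <= q z n) by apply pow2_ge_0.
assert (HE1 : 1 <= Ex).
{ rewrite <- exp_0. apply exp_le. rewrite HlS. apply Rdiv_le_0_compat. apply Rmult_le_pos; lra. lra. }
assert (HEy : y * y <= Ex).
{ unfold weight_ii in Hw. rewrite hs_rho in Hw by auto. fold x (q z n) in Hw.
  set (Fn := if Req_EM_T (Cmod (zs n - z)) 0 then 1 else exp (lam / 4 * q z n / - ln x)) in *.
  assert (HF2 : Fn * Fn <= Ex).
  { unfold Fn. destruct (Req_EM_T _ _) as [_|_]. lra.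
    rewrite <- exp_plus. apply exp_le. rewrite HlS.
    apply Rle_trans with (lam / 2 * q z n * / l).
    - replace (lam / 4 * q z n / - ln x + lam / 4 * q z n / - ln x) with
        (lam / 2 * q z n * / (- ln x)) by (field; lra).
      apply Rmult_le_compat_l. apply Rmult_le_pos; lra. apply Rinv_le_contravar; lra.
    - replace (lam * q z n / (ln 2 + l)) with (lam / 2 * q z n * (2 / (ln 2 + l))) by (field; lra).
      apply Rmult_le_compat_l. apply Rmult_le_pos; lra.
      replace (2 / (ln 2 + l)) with (/ ((ln 2 + l) / 2)) by (field; lra).
      apply Rinv_le_contravar; lra. }
  assert (HFy : y <= Fn).
  { assert (HF0 : 0 < Fn). { unfold Fn. destruct (Req_EM_T _ _). lra. apply exp_pos. }
    assert (Fn * x <= Fn * / 2 ^ J) by (apply Rmult_le_compat_l; lra).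
    apply Rmult_le_reg_r with (/ 2 ^ J); auto. unfold y. rewrite Rmult_assoc, Rinv_r; lra. }
  eapply Rle_trans; [|exact HF2]. apply Rmult_le_compat; lra. }
(* From [1 <= Ex], [y^2 <= Ex] and [2 y <= 1 + y^2]: [1 + 3 y + 2 y^2 <= (1 + 3 + 2) Ex]. With the
   lower bound [2^-(J+1)] for [x] this 6 becomes the 12 of the coefficient. *)
assert (Hmain : (1 + 2 * y) * (1 + y) <= 6 * Ex) by nra.
replace (0 + coef * (Ex * x)) with (coef * Ex * x) by ring.
apply Rle_trans with (coef * Ex * (/ 2 * / 2 ^ J)).
2: apply Rmult_le_compat_l; [apply Rmult_le_pos; lra | lra].
unfold coef. rewrite Hfr.
replace (12 / t * (y / ((1 + 2 * y) * (1 + y))) * Ex * (/ 2 * / 2 ^ J)) with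
  (6 * Ex * / ((1 + 2 * y) * (1 + y))).
2:{ unfold y. field. repeat split; nra. }
apply Rmult_le_reg_r with ((1 + 2 * y) * (1 + y)). nra.
rewrite Rmult_assoc, Rinv_l by nra. lra.
Qed.

(** Induction over the layers: points with [hs > 1/2] are handled by [weight_near] and the Carleson
    bound, and the contributions of the further layers telescope in [frac]. *)
Lemma counted_le J N : (1 <= J)%nat -> sum_f_R0 (counted J) N <=
  exp 1 * M / t + 12 / t * stopped_sum_bound * frac (t * 2 ^ J).
Proof.
assert (HM := carleson_const_nonneg). assert (E1 := exp_pos 1).
assert (Hfp : forall y, 0 < y -> 0 < frac y) by (intros y Hy; apply Rdiv_lt_0_compat; lra).
assert (HB : 0 < stopped_sum_bound).
{ unfold stopped_sum_bound. assert (E2 := exp_pos (M + 2)).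
  assert (0 <= exp 1 * M) by (apply Rmult_le_pos; lra). lra. }
assert (H12 : 0 < 12 / t) by (apply Rdiv_lt_0_compat; lra).
intros HJ. induction HJ as [|J HJ IH].
- apply Rle_trans with (exp 1 * M / t).
  2:{ assert (0 < 12 / t * stopped_sum_bound * frac (t * 2 ^ 1)); [|lra].
      apply Rmult_lt_0_compat; [now apply Rmult_lt_0_compat|]. apply Hfp. simpl; lra. }
  apply Rle_trans with (exp 1 / t * sum_f_R0 (fun n => hs z (zs n)) N).
  + rewrite scal_sum. apply sum_Rle. intros n _.
    assert (Hp := hs_pos z (zs n) Hz (zs_in n)).
    assert (0 < hs z (zs n) * (exp 1 / t)).
    { apply Rmult_lt_0_compat; auto. apply Rdiv_lt_0_compat; lra. }
    unfold counted. destruct (Rlt_dec t _) as [Hw|Hw]; [|lra].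
    destruct (Rlt_dec _ _) as [Hx|Hx]; [|lra].
    assert (Wl := weight_near z n Hz ltac:(lra)).
    apply Rmult_le_reg_r with t; auto.
    replace (hs z (zs n) * (exp 1 / t) * t) with (exp 1 * hs z (zs n)) by (field; lra). lra.
  + replace (exp 1 * M / t) with (exp 1 / t * M) by (field; lra).
    apply Rmult_le_compat_l. apply Rlt_le, Rdiv_lt_0_compat; lra. auto.
- set (y := t * 2 ^ J) in *.
  assert (H2J : 0 < 2 ^ J) by (apply pow_lt; lra).
  assert (Hy : 0 < y) by (unfold y; apply Rmult_lt_0_compat; auto).
  replace (t * 2 ^ S J) with (2 * y) by (unfold y; simpl; ring).
  set (r := sqrt (1 - (/ 2) ^ (S J))).
  assert (Hhalf : 0 < (/ 2) ^ S J < 1).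
  { split. apply pow_lt; lra. apply pow_lt_1_compat. lra. lia. }
  assert (Hr : 0 < r < 1).
  { unfold r. split. apply sqrt_lt_R0; lra.
    apply Rlt_le_trans with (sqrt 1); [apply sqrt_lt_1; lra | rewrite sqrt_1; lra]. }
  assert (St := stopped_sum z r N Hz Hr).
  set (body := fun n => if Rlt_dec (rho z (zs n)) r then
     exp (lam * q z n / (- ln (1 - r ^ 2))) * hs z (zs n) else 0) in *.
  assert (Hfr : 0 < frac (2 * y) - frac y).
  { replace (frac (2 * y) - frac y) with (y / ((1 + 2 * y) * (1 + y)))
      by (unfold frac; field; split; lra).
    apply Rdiv_lt_0_compat; nra. }
  apply Rle_trans with (sum_f_R0 (fun n => counted J n + body n * (12 / t * (frac (2 * y) - frac y))) N).
  + apply sum_Rle. intros n _. rewrite (Rmult_comm (body n)). now apply layer_term.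
  + rewrite sum_plus, <- scal_sum.
    assert (12 / t * (frac (2 * y) - frac y) * sum_f_R0 body N <=
      12 / t * (frac (2 * y) - frac y) * stopped_sum_bound).
    { apply Rmult_le_compat_l; auto. apply Rlt_le, Rmult_lt_0_compat; auto. }
    lra.
Qed.

Lemma all_counted N : exists J, (1 <= J)%nat /\ forall n, (n <= N)%nat ->
  (/ 2) ^ J < hs z (zs n).
Proof.
assert (H1 : forall n, exists J, forall J', (J <= J')%nat -> (/ 2) ^ J' < hs z (zs n)).
{ intros n. destruct (pow_lt_1_zero (/ 2)) with (y := hs z (zs n)) as [J HJ].
  - rewrite Rabs_pos_eq; lra.
  - now apply hs_pos.
  - exists J. intros J' H. specialize (HJ J' H).
    rewrite Rabs_pos_eq in HJ; auto. apply pow_le; lra. }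
assert (H2 : exists J, forall J', (J <= J')%nat -> forall n, (n <= N)%nat -> (/ 2) ^ J' < hs z (zs n)).
{ induction N as [|N' [J2 IH]].
  - destruct (H1 0%nat) as [J HJ]. exists J. intros J' H n Hn.
    replace n with 0%nat by lia. auto.
  - destruct (H1 (S N')) as [J HJ]. exists (max J J2). intros J' H n Hn.
    destruct (Nat.eq_dec n (S N')) as [->|Hne]. apply HJ; lia. apply IH; lia. }
destruct H2 as [J HJ]. exists (S J). split. lia. apply HJ. lia.
Qed.

(** Finitely many points have [hs] bounded below, so one [J] covers them; [frac <= 1] then removes
    the dependence on [J], and with it that on [N]. *)
Lemma sum_counted N :
  sum_f_R0 (fun n => if Rlt_dec t (weight_ii (lam / 4) b z (zs n)) then 1 else 0) N
  <= (exp 1 * M + 12 * stopped_sum_bound) / t.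
Proof.
destruct (all_counted N) as [J [HJ HJN]].
assert (Cl := counted_le J N HJ).
apply Rle_trans with (sum_f_R0 (counted J) N).
- apply sum_Rle. intros n Hn. unfold counted. destruct (Rlt_dec t _); [|lra].
  destruct (Rlt_dec _ _); [lra|]. exfalso. auto.
- eapply Rle_trans. exact Cl.
  assert (Hf : frac (t * 2 ^ J) <= 1).
  { assert (0 < t * 2 ^ J) by (apply Rmult_lt_0_compat; auto; apply pow_lt; lra).
    unfold frac. apply Rmult_le_reg_r with (1 + t * 2 ^ J). lra.
    unfold Rdiv. rewrite Rmult_assoc, Rinv_l; lra. }
  assert (HB : 0 <= 12 / t * stopped_sum_bound).
  { apply Rmult_le_pos. apply Rlt_le, Rdiv_lt_0_compat; lra.
    assert (HM := carleson_const_nonneg). unfold stopped_sum_bound. assert (E2 := exp_pos (M + 2)).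
    assert (E1 := exp_pos 1).
    assert (0 <= exp 1 * M) by (apply Rmult_le_pos; lra). lra. }
  apply (Rmult_le_compat_l _ _ _ HB) in Hf. rewrite Rmult_1_r in Hf.
  replace ((exp 1 * M + 12 * stopped_sum_bound) / t) with
    (exp 1 * M / t + 12 / t * stopped_sum_bound) by (field; lra). lra.
Qed.
End Layers.
End Disc.

Lemma length_filter_seq (f : nat -> bool) N :
  INR (length (List.filter f (List.seq 0 (S N)))) = sum_f_R0 (fun n => if f n then 1 else 0) N.
Proof.
induction N as [|N IH].
- simpl. destruct (f 0%nat); reflexivity.
- rewrite List.seq_S, List.filter_app, List.length_app, plus_INR, IH. simpl.
  destruct (f (S N)); reflexivity.
Qed.

Theorem theorem1p4 (b : C -> C) (zs : nat -> C) :
  bloch b ->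
  (forall n, in_disc (zs n)) ->
  carleson zs ->
  (* (i) *)
  (exists lam : R, 0 < lam /\
     exists M : R, forall z, in_disc z -> forall r : R, 0 < r < 1 ->
       forall N : nat,
         sum_f_R0 (fun n =>
           if Rlt_dec (rho z (zs n)) r then
             exp (lam * Cmod (b (zs n) - b z)%C ^ 2 / (- ln (1 - r ^ 2)))
               * (1 - rho z (zs n) ^ 2)
           else 0) N <= M)
  /\
  (* (ii) : #{n | weight > t} <= C / t, i.e. every finite initial segment
     of that set has at most C/t elements *)
  (exists lam Cst : R, 0 < lam /\ 0 < Cst /\
     forall z, in_disc z -> forall t : R, 0 < t ->
       forall N : nat,
         INR (length (List.filter
                (fun n => if Rlt_dec t (weight_ii lam b z (zs n)) then true else false)
                (List.seq 0 N))) <= Cst / t).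
Proof.
intros [holo [K0 HK0]] zs_in [M HM].
(* The maximum with 1 ensures [K > 0], so that [lam] below is meaningful. *)
set (K := Rmax K0 1).
assert (HK : 0 < K) by (assert (X := Rmax_r K0 1); unfold K; lra).
assert (Bl : forall z, in_disc z -> forall d : C, is_derive b z d ->
  Cmod d * (1 - Cmod z ^ 2) <= K).
{ intros z Hz d Hd. eapply Rle_trans. apply HK0; auto. apply Rmax_l. }
assert (Carl : forall z, in_disc z -> forall N, sum_f_R0 (fun n => hs z (zs n)) N <= M).
{ intros z Hz N. eapply Rle_trans; [|apply (HM z Hz N)]. apply Req_le, sum_eq.
  intros n _. now rewrite hs_rho. }
assert (HK2 : 0 < K ^ 2) by now apply pow_lt.
(* Exactly the threshold of [supersolution_exponent]. *)
set (lam := / (1280 * K ^ 2)).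
assert (Hlam : 0 < lam) by (apply Rinv_0_lt_compat; lra).
assert (HlamK : lam * K ^ 2 <= / 1280) by (apply Req_le; unfold lam; field; lra).
split.
- exists lam. split; auto. exists (stopped_sum_bound M). intros z Hz r Hr N.
  eapply Rle_trans; [|apply (stopped_sum b K M zs holo HK Bl zs_in Carl lam Hlam HlamK z r N Hz Hr)].
  apply Req_le, sum_eq. intros n _. now rewrite hs_rho.
- assert (HM0 := carleson_const_nonneg M zs zs_in Carl).
  (* One factor 2 is spent on squaring the exponential, the other on [- ln (1 - r^2)], which in a
     layer may be up to twice [- ln hs]. *)
  exists (lam / 4), (exp 1 * M + 12 * stopped_sum_bound M).
  assert (E1 := exp_pos 1). assert (E2 := exp_pos (M + 2)).
  assert (HC : 0 < exp 1 * M + 12 * stopped_sum_bound M).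
  { assert (0 <= exp 1 * M) by (apply Rmult_le_pos; lra). unfold stopped_sum_bound. lra. }
  split. lra. split. exact HC.
  (* [seq 0 N] has [N] elements while [sum_f_R0] up to [N] has [N + 1] terms, so the empty segment
     is treated apart. *)
  intros z Hz t Ht [|N].
  + simpl. apply Rlt_le, Rdiv_lt_0_compat; auto.
  + rewrite length_filter_seq.
    eapply Rle_trans; [|apply (sum_counted b K M zs holo HK Bl zs_in Carl lam Hlam HlamK z t Hz Ht N)].
    apply Req_le, sum_eq. intros n _. now destruct (Rlt_dec _ _).
Qed.
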